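(* Let $d=d(n)$ be a positive-integer-valued function of $n$ with $d(n)=o(n^{1/5})$ (and $dn$ even). For every constant $\varepsilon>0$ there exists an integer $n_0=n_0(\varepsilon)$ such that for every $n>n_0$ there exists an integer $t=t(n,d,\varepsilon)$ with $$\Pr\big[\chi(\mathcal{G}_{n,d})\in\{t,t+1\}\big]\geq 1-\varepsilon.$$
   Context: $\mathcal{G}_{n,d}$ denotes the uniform probability space of all (simple) $d$-regular graphs on the vertex set $[n]=\{1,\dots,n\}$ (defined when $dn$ is even), and also a random graph drawn from it. $\chi(G)$ is the chromatic number of $G$. *)

(* Defs.v *)
From HB Require Import structures.
From mathcomp Require Import all_boot all_order all_algebra.
From mathcomp Require Import reals.

Set Implicit Arguments.
Unset Strict Implicit.
Unset Printing Implicit Defensive.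

Import Order.TTheory GRing.Theory Num.Theory.

(* A simple graph on T is given by its edge set, a set of 2-subsets of T; two
   graphs are equal iff they have the same edges, so counting inhabitants of
   [sgraph 'I_n] counts labelled graphs. *)
Record sgraph (T : finType) := SGraph {
  edges : {set {set T}};
  edges_card2 : [forall e in edges, #|e| == 2] }.

HB.instance Definition _ (T : finType) := [isSub for @edges T].
HB.instance Definition _ (T : finType) := [Finite of sgraph T by <:].

Definition adj (T : finType) (G : sgraph T) (x y : T) : bool :=
  [set x; y] \in edges G.

Definition degree (T : finType) (G : sgraph T) (x : T) : nat :=
  #|[set y | adj G x y]|.

Definition regular (T : finType) (d : nat) (G : sgraph T) : bool :=
  [forall x, degree G x == d].

Definition proper_coloring (T : finType) (G : sgraph T) (k : nat)
    (c : {ffun T -> 'I_k}) : bool :=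
  [forall x, forall y, adj G x y ==> (c x != c y)].

Definition colorable (T : finType) (G : sgraph T) (k : nat) : bool :=
  [exists c : {ffun T -> 'I_k}, proper_coloring G c].

Lemma adj_irrefl (T : finType) (G : sgraph T) (x : T) : adj G x x = false.
Proof.
apply/negP => Gx; have /forallP/(_ [set x; x])/implyP/(_ Gx) := edges_card2 G.
by rewrite setUid cards1.
Qed.

Lemma colorable_card (T : finType) (G : sgraph T) : colorable G #|T|.
Proof.
apply/existsP; exists [ffun x => enum_rank x].
apply/forallP => x; apply/forallP => y; apply/implyP => Gxy.
rewrite !ffunE (inj_eq enum_rank_inj); apply/eqP => xy.
by rewrite xy adj_irrefl in Gxy.
Qed.

Lemma ex_colorable (T : finType) (G : sgraph T) : exists k, colorable G k.
Proof. by exists #|T|; apply: colorable_card. Qed.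

Definition chromatic_number (T : finType) (G : sgraph T) : nat :=
  ex_minn (ex_colorable G).

Definition regular_graphs (n d : nat) : {set sgraph 'I_n} :=
  [set G | regular d G].

(* When there is no d-regular graph on n vertices the denominator is 0 and the
   value is 0, so a positive lower bound on it entails that such graphs exist. *)
Definition prob_regular (R : realType) (n d : nat) (P : pred (sgraph 'I_n)) : R :=
  (#|[set G in regular_graphs n d | P G]|%:R / #|regular_graphs n d|%:R)%R.

(* Main.v *)
Require Import Defs.
From mathcomp Require Import all_boot all_order all_algebra all_fingroup.
From mathcomp Require Import reals sequences exp.
From mathcomp Require Import ring lra zify.

(** Let [t] be least such that [chi <= t] has probability bounded away from 0.
In the configuration model let [Y] be the least number of vertices whose
deletion leaves a [t]-colourable multigraph (with colour classes of bounded
size).  Exposing the pairing pair by pair gives a martingale whose conditional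
variances are small because a random switch rarely produces a monochromatic
pair; since a random pairing is simple with probability [exp (- O(d^2))] (local
lemma), with high probability all but a set [U0] of about [d sqrt n], up to
lower-order factors, vertices of the random graph can be [t]-coloured.  The
local lemma also bounds the probability that given edges are all present by
[(4 d / n) ^ k].

It remains to colour everything with [t + 1] colours.  If [d] is a small power
of [n], enlarge [U0] while two adjacent outside vertices both have neighbours
inside: each step adds two vertices and three edges, so sparsity of small sets
stops it.  Then the neighbourhood of [U] is independent and receives the new
colour, while [U] is 3-colourable.  For larger [d] we have [t] close to [d] up
to lower-order factors; close [U0] so that outside vertices have few neighbours
in [U] and few neighbours adjacent to [U].  Each [u] in [U] takes an old colour
[i], and its neighbours coloured [i] take the new colour; the local lemma shows
that these choices can be made without conflicts. *)

(** The size of the exceptional set decides everything. A tail bound that survives conditioning on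
    simplicity must be smaller than [exp (- 48 d^2)], which forces a deviation of about [d] standard
    deviations. Capping the colour classes near [n / d] keeps the variance near [n] instead of
    [n d], whence [d sqrt n]. A vertex then has on average about [d^2 / sqrt n] neighbours in such a
    set. For [d] up to [n ^ (1 / 5)] this is [n ^ (- 1 / 10)], polynomially small: a bounded number
    of neighbours (15 here) is already exceptional, and closing the set enlarges it only by a
    constant factor. The two colouring arguments have complementary limits. The sparse one needs the
    size of the closed set times [d^4] to stay below [n]; the recolouring one needs long lists of
    colours, hence a large chromatic number, so it cannot start at bounded [d]. The range is cut at
    [w ^ 15], where [n] is about [w ^ 200]. *)

Set Implicit Arguments.
Unset Strict Implicit.
Unset Printing Implicit Defensive.
Import Order.TTheory GRing.Theory Num.Theory.

(** * The local lemma, by counting *)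

Local Open Scope ring_scope.

Section LocalLemma.
Variables (R : realFieldType) (T I : finType) (X : {set T}) (A : I -> {set T}).

Definition avoiding (S : {set I}) : {set T} :=
  [set y in X | [forall j in S, y \notin A j]].

Lemma in_avoiding (S : {set I}) y :
  reflect (y \in X /\ forall j, j \in S -> y \notin A j) (y \in avoiding S).
Proof.
rewrite inE; apply: (iffP andP) => -[yX h]; split => //; first exact/forall_inP.
exact/forall_inP.
Qed.

Lemma avoiding_sub (S1 S2 : {set I}) : S1 \subset S2 -> avoiding S2 \subset avoiding S1.
Proof.
move=> s12; apply/subsetP => y /in_avoiding[yX h]; apply/in_avoiding.
by split=> // j jS; apply: h; apply: (subsetP s12).
Qed.

Lemma avoidingU1 j (S : {set I}) : avoiding (j |: S) = avoiding S :\: A j.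
Proof.
apply/setP => y; rewrite in_setD; apply/in_avoiding/andP.
  move=> [yX h]; split; first by apply: h; rewrite setU11.
  by apply/in_avoiding; split => // i iS; apply: h; rewrite setU1r.
move=> [yA /in_avoiding[yX h]]; split => // i /setU1P[->//|]; exact: h.
Qed.

Variables (nb : rel I) (x : I -> R).
Hypothesis x_ge0 : forall i, 0 <= x i.
Hypothesis cond_le : forall i (S : {set I}), (forall j, j \in S -> ~~ nb i j) ->
  (#|A i :&: avoiding S|%:R <= x i / 2 * #|avoiding S|%:R :> R).
Hypothesis nb_le : forall i, \sum_(j | nb i j) x j <= 1 / 2.

(** Lopsided local lemma in sum form. Dropping the neighbours of [i] from [S] gives [S2], where
    [cond_le] bounds [A i] with a factor 2 to spare. By induction those neighbours remove at most
    half of [avoiding S2], so passing back to [S] costs at most that factor. Only an upper bound on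
    conditional frequencies is assumed, which is what switchings provide in the absence of
    independence. *)
Lemma local_lemma_cond i (S : {set I}) :
  #|A i :&: avoiding S|%:R <= x i * #|avoiding S|%:R :> R.
Proof.
have [k] := ubnP #|S|; elim: k => // k IHk in i S *; rewrite ltnS => Sk.
pose S2 := [set j in S | ~~ nb i j].
have S2S : S2 \subset S by apply/subsetP => j; rewrite inE => /andP[].
have x0 := x_ge0 i.
have h2 : #|A i :&: avoiding S2|%:R <= x i / 2 * #|avoiding S2|%:R :> R.
  by apply: cond_le => j; rewrite inE => /andP[].
(* With no neighbour in [S] the induction would not descend, but then [cond_le] already suffices. *)
have [eS|neS] := eqVneq S2 S.
  rewrite eS in h2; apply: le_trans h2 _; rewrite ler_wpM2r ?ler0n //; lra.
have ltS : (#|S2| < k)%N.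
  by apply: leq_trans Sk; rewrite proper_card // properEneq neS.
have h1 : (#|A i :&: avoiding S| <= #|A i :&: avoiding S2|)%N.
  by rewrite subset_leq_card // setIS // avoiding_sub.
have h3 : (#|avoiding S2| <= #|avoiding S| +
    \sum_(j | nb i j) #|A j :&: avoiding S2|)%N.
  have sub : avoiding S2 \subset avoiding S :|:
      \bigcup_(j | nb i j) (A j :&: avoiding S2).
    apply/subsetP => y yS2; rewrite inE; have [//|yS /=] := boolP (y \in avoiding S).
    have /in_avoiding[yX h] := yS2.
    have : ~~ [forall j in S, y \notin A j].
      by apply: contra yS => hh; rewrite inE yX.
    rewrite negb_forall_in => /exists_inP[j jS]; rewrite negbK => yj.
    apply/bigcupP; exists j; last by rewrite inE yj.
    by apply: contraLR yj => nij; apply: h; rewrite inE jS.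
  apply: leq_trans (subset_leq_card sub) _.
  apply: leq_trans (leq_card_setU _ _) _; rewrite leq_add2l.
  elim/big_rec2: _ => [|j m B _ IH]; first by rewrite cards0.
  by apply: leq_trans (leq_card_setU _ _) _; rewrite leq_add2l.
have h4 : #|avoiding S2|%:R <= 2 * #|avoiding S|%:R :> R.
  move: h3; rewrite -(ler_nat R) natrD natr_sum => h3.
  have h5 : \sum_(j | nb i j) #|A j :&: avoiding S2|%:R <=
            \sum_(j | nb i j) x j * #|avoiding S2|%:R :> R.
    by apply: ler_sum => j _; apply: IHk.
  rewrite -mulr_suml in h5.
  have := ler_wpM2r (ler0n R #|avoiding S2|) (nb_le i); lra.
rewrite -(ler_nat R) in h1; apply: le_trans h1 _; apply: le_trans h2 _.
by rewrite -mulrA ler_wpM2l //; lra.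
Qed.

(** The events of [S'] are added one at a time, each keeping a fraction [1 - x i]. A general base
    [S] lets [edges_in_simple] compare all bad events with those away from given vertices. *)
Lemma local_lemma (S S' : {set I}) : (forall i, i \in S' -> x i <= 1) ->
  \prod_(i in S') (1 - x i) * #|avoiding S|%:R <= #|avoiding (S' :|: S)|%:R :> R.
Proof.
move=> x1; have [k] := ubnP #|S'|; elim: k => // k IHk in S' x1 *.
have [->|[i iS]] := set_0Vmem S'; first by rewrite big_set0 mul1r set0U.
rewrite ltnS => Sk; rewrite (big_setD1 i) //=.
have -> : S' :|: S = i |: (S' :\ i :|: S) by rewrite setUA setD1K.
have H : \prod_(j in S' :\ i) (1 - x j) * #|avoiding S|%:R <=
    #|avoiding (S' :\ i :|: S)|%:R :> R.
  apply: IHk => [j /setD1P[_ /x1] //|].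
  by apply: leq_trans Sk; rewrite [X in (_ < X)%N](cardsD1 i) iS.
rewrite avoidingU1 -mulrA; apply: (le_trans (ler_wpM2l _ H)).
  by rewrite subr_ge0 x1.
have := local_lemma_cond i (S' :\ i :|: S); rewrite setIC.
have /(congr1 (fun k => k%:R : R)) := cardsID (A i) (avoiding (S' :\ i :|: S)).
rewrite natrD; lra.
Qed.

End LocalLemma.

Local Close Scope ring_scope.

(** * Pairings and switchings *)

Section Pairings.
Variable T : finType.
Implicit Types (P Q : {perm T}) (D : {set T}) (a b c x y : T).

(** Perfect matchings as fixed-point-free involutions; [locked] keeps [inE] from expanding
    membership. *)
Definition pairings : {set {perm T}} :=
  locked [set P : {perm T} | [forall x, (P (P x) == x) && (P x != x)]].

Lemma pairingsE P :
  (P \in pairings) = [forall x, (P (P x) == x) && (P x != x)].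
Proof. by rewrite /pairings -lock in_set. Qed.

Lemma pairingK P : P \in pairings -> involutive P.
Proof. by rewrite pairingsE => /forallP h x; have /andP[/eqP] := h x. Qed.

Lemma pairing_neq P x : P \in pairings -> P x != x.
Proof. by rewrite pairingsE => /forallP /(_ x) /andP[]. Qed.

Lemma conj_pairing P (s : {perm T}) : P \in pairings -> (P ^ s)%g \in pairings.
Proof.
move=> PP; rewrite pairingsE; apply/forallP => x; rewrite -[x](permKV s) !permJ.
by rewrite pairingK // eqxx (inj_eq perm_inj) pairing_neq.
Qed.

(* If [P a = b] and [c != a], conjugation turns the pairs [a b], [c (P c)] into
   [a c], [b (P c)]. *)
Definition switch b c P : {perm T} := (P ^ tperm b c)%g.

Lemma switch_pairing b c P : P \in pairings -> switch b c P \in pairings.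
Proof. exact: conj_pairing. Qed.

Lemma switchE b c P x : switch b c P x = tperm b c (P (tperm b c x)).
Proof. by rewrite /switch -{1}[x](tpermK b c) permJ. Qed.

Lemma switchK b c : involutive (switch b c).
Proof. by move=> P; rewrite /switch -conjgM tperm2 conjg1. Qed.

Lemma switchC b c P : switch b c P = switch c b P.
Proof. by rewrite /switch tpermC. Qed.

Lemma switch_to a b c P : P \in pairings -> P a = b -> c != a ->
  switch b c P a = c.
Proof.
move=> PP Pa ca; rewrite switchE [tperm b c a]tpermD ?Pa ?tpermL //.
by rewrite -Pa pairing_neq.
Qed.

Lemma switch_out b c P x : b != x -> c != x -> b != P x -> c != P x ->
  switch b c P x = P x.
Proof. by move=> *; rewrite switchE !tpermD. Qed.

(** Conditioning on the exposed part of [P0]: [D] holds the exposed points, a union of pairs when it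
    is [stable]. *)
Definition extending D P0 : {set {perm T}} :=
  locked [set P : {perm T} in pairings | [forall x in D, P x == P0 x]].

Lemma extendingP D P0 P : reflect (P \in pairings /\ {in D, P =1 P0})
  (P \in extending D P0).
Proof.
rewrite /extending -lock in_set; apply: (iffP andP) => -[PP h]; split=> //.
  by move=> x xD; apply/eqP; apply: (forall_inP h).
by apply/forall_inP => x xD; rewrite h.
Qed.

Lemma extending0 P0 : extending set0 P0 = pairings.
Proof.
apply/setP => P; apply/extendingP/idP => [[]//|PP].
by split=> // x; rewrite inE.
Qed.

Definition stable D P0 := {in D, forall x, P0 x \in D}.

Lemma stable_out D P0 x : P0 \in pairings -> stable D P0 -> x \notin D ->
  P0 x \notin D.
Proof.
by move=> PP st; apply: contra => /st; rewrite pairingK.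
Qed.

Lemma stable_ext D P0 P : stable D P0 -> P \in extending D P0 -> stable D P.
Proof. by move=> st /extendingP[_ e] x xD; rewrite e // st. Qed.

Lemma switch_extending D P0 P b c : stable D P0 -> P \in extending D P0 ->
  b \notin D -> c \notin D -> switch b c P \in extending D P0.
Proof.
move=> st /extendingP[PP e] bD cD; apply/extendingP.
split=> [|x xD]; first exact: switch_pairing.
have P0x := st _ xD; rewrite -(e x) // switch_out // ?e //.
- by apply: contraNneq bD => ->.
- by apply: contraNneq cD => ->.
- by apply: contraNneq bD => ->.
- by apply: contraNneq cD => ->.
Qed.

(** Replacing the pair [a b] by [a c] is injective in the pairing and [c] together: the image sends
    [a] to [c], and undoing the switch recovers the rest. So inside any [C] closed under these
    switches, [P a = b] has frequency at most [1 / (|T| - |D| - 1)]. *)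
Lemma switch_count D P0 a b (C : {set {perm T}}) : stable D P0 ->
  a \notin D -> b \notin D ->
  (forall P c, P \in C -> P \in pairings -> P a = b -> c != a ->
    switch b c P \in C) ->
  #|[set P : {perm T} in extending D P0 :&: C | P a == b]| * (#|T| - #|D| - 1) <=
  #|extending D P0 :&: C|.
Proof.
move=> st aD bD CC.
set A := [set P in _ | _].
pose f (u : {perm T} * T) := switch b u.2 u.1.
have -> : #|T| - #|D| - 1 = #|~: D :\ a|.
  by rewrite -(cardsC D) addKn (cardsD1 a (~: D)) inE aD addKn.
rewrite -cardsX -(card_in_imset (f := f)); last first.
  move=> [P c] [P' c']; rewrite !in_setX /= => /andP[PA cD] /andP[PA' cD'].
  rewrite /f /= => e.
  have h Q q : Q \in A -> q \in ~: D :\ a -> switch b q Q a = q.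
    rewrite !inE => /andP[/andP[/extendingP[QP _] _] /eqP Qa] /andP[qa _].
    exact: switch_to.
  have cc : c = c' by rewrite -(h P c) // e h.
  by congr (_, _) => //; rewrite -(switchK b c P) e cc switchK.
apply: subset_leq_card; apply/subsetP => _ /imsetP[[P c] + ->].
rewrite in_setX /f /= => /andP[]; rewrite inE => /andP[/setIP[PE PC] /eqP Pa].
rewrite !inE => /andP[ca cD]; apply/andP; split.
  exact: (switch_extending st PE bD cD).
by have /extendingP[PP _] := PE; exact: CC.
Qed.

Definition fiber D P0 a b := [set P : {perm T} in extending D P0 | P a == b].

Lemma switch_fiber D P0 a b c P : stable D P0 -> b \notin D -> c \notin D ->
  c != a -> P \in fiber D P0 a b -> switch b c P \in fiber D P0 a c.
Proof.
move=> st bD cD ca; rewrite /fiber !in_set => /andP[PE /eqP Pa].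
rewrite switch_extending //= (switch_to _ Pa) //.
by have /extendingP[] := PE.
Qed.

Lemma fiber_switch D P0 a b c : stable D P0 -> b \notin D -> c \notin D ->
  b != a -> c != a -> fiber D P0 a c = switch b c @: fiber D P0 a b.
Proof.
move=> st bD cD ba ca; apply/setP => P; apply/idP/imsetP => [PF|[Q QF ->]].
  exists (switch b c P); last by rewrite switchK.
  by rewrite switchC; apply: (switch_fiber st cD).
exact: (switch_fiber st bD).
Qed.

(** The partner of an unexposed [a] is uniform; switching is the bijection, and later the coupling,
    between two of its values. *)
Lemma card_fiber_eq D P0 a b c : stable D P0 -> b \notin D -> c \notin D ->
  b != a -> c != a -> #|fiber D P0 a c| = #|fiber D P0 a b|.
Proof.
move=> st bD cD ba ca; rewrite (fiber_switch st bD) //.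
by rewrite card_imset //; exact: inv_inj (switchK b c).
Qed.

(** Conditioning on one more pair keeps the [extending] form, with two more exposed points; this
    drives the inductions on pairings below. *)
Lemma fiber_ext D P0 a b P : P \in fiber D P0 a b ->
  fiber D P0 a b = extending (a |: (b |: D)) P.
Proof.
rewrite inE => /andP[/extendingP[PP e] /eqP Pa].
apply/setP => Q; rewrite inE; apply/andP/extendingP.
  move=> [/extendingP[QP e'] /eqP Qa]; split => // x /setU1P[->|/setU1P[->|xD]].
  - by rewrite Qa.
  - by rewrite -[in LHS]Qa -[in RHS]Pa !pairingK.
  - by rewrite e' ?e.
move=> [QP h]; split; last by rewrite h ?setU11 // Pa.
apply/extendingP; split => // x xD; rewrite h ?e //.
by rewrite !inE xD !orbT.
Qed.

Lemma fiber_stable D P0 a b P : stable D P0 -> P \in fiber D P0 a b ->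
  stable (a |: (b |: D)) P.
Proof.
move=> st; rewrite inE => /andP[PE /eqP Pa].
have /extendingP[PP e] := PE.
move=> x /setU1P[->|/setU1P[->|xD]]; rewrite !inE ?Pa ?eqxx ?orbT //.
  by rewrite -Pa pairingK // eqxx.
by rewrite (stable_ext st PE) ?orbT.
Qed.

Lemma sum_fiber (R : nmodType) D P0 a (f : {perm T} -> R) : stable D P0 ->
  a \notin D ->
  (\sum_(P in extending D P0) f P =
   \sum_(b in ~: D :\ a) \sum_(P in fiber D P0 a b) f P)%R.
Proof.
move=> st aD; rewrite (partition_big (fun P : {perm T} => P a) (mem (~: D :\ a))) /=.
  apply: eq_bigr => b _; apply: eq_bigl => P; by rewrite !inE.
move=> P PE; have /extendingP[PP _] := PE.
by rewrite !inE pairing_neq ?(stable_out PP (stable_ext st PE) aD).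
Qed.

Lemma card_rest D a : a \notin D -> #|~: D :\ a| = #|T| - #|D| - 1.
Proof.
move=> aD; by rewrite -(cardsC D) addKn (cardsD1 a (~: D)) inE aD addKn.
Qed.

Lemma card_extending D P0 a b : stable D P0 -> a \notin D -> b \notin D ->
  b != a -> #|extending D P0| = (#|T| - #|D| - 1) * #|fiber D P0 a b|.
Proof.
move=> st aD bD ba; rewrite -sum1_card.
rewrite (partition_big (fun P : {perm T} => P a) (mem (~: D :\ a))) /=; last first.
  move=> P PE; have /extendingP[PP _] := PE.
  by rewrite !inE pairing_neq ?(stable_out PP (stable_ext st PE) aD).
rewrite -(card_rest aD) -sum_nat_const; apply: eq_bigr => c.
rewrite !inE => /andP[ca cD]; rewrite -(card_fiber_eq st bD cD) //.
by rewrite -sum1_card; apply: eq_bigl => P; rewrite !inE.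
Qed.

End Pairings.

(** * The configuration model *)

(** The only new pairs of the switch are [a c] and [b (P c)], so a pair of the result that meets
    neither [a] nor [b] was already a pair of [P]. *)
Lemma switch_back (T : finType) (P : {perm T}) a b c x : P \in pairings T ->
  P a = b -> c != a -> x != a -> x != b ->
  switch b c P x != a -> switch b c P x != b -> P x = switch b c P x.
Proof.
move=> PP Pa ca xa xb; set y := switch b c P x => ya yb.
have Qa := switch_to PP Pa ca.
have QP := switch_pairing b c PP.
have xc : x != c.
  by apply: contraNneq ya => xc; apply/eqP; rewrite /y xc -[RHS](pairingK QP) Qa.
have yc : y != c.
  by apply: contraNneq xa => yc; apply/eqP; rewrite -[LHS](pairingK QP) -/y yc -[RHS](pairingK QP) Qa.
have := switchE b c P x; rewrite -/y [tperm b c x]tpermD 1?eq_sym //.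
move/(congr1 (tperm b c)); rewrite tpermK => <-.
by rewrite tpermD 1?eq_sym.
Qed.

Lemma mul_le_double x y N k : 2 * k <= N -> x * (N - k) <= y ->
  x * N <= 2 * y.
Proof.
move=> kN h; apply: (@leq_trans (x * (2 * (N - k)))); first by rewrite leq_mul //; lia.
by rewrite mulnCA leq_mul.
Qed.

Section Configuration.
Variables n d : nat.
Local Notation point := ('I_n * 'I_d)%type.
Implicit Types (P : {perm point}).

Definition event_index := (point * 'I_d + (point * 'I_d) * (point * 'I_d))%type.

(* [inl (a, j)]: the point [a] is matched inside its own vertex;
   [inr ((a, j), (b, k))]: the pairs [a b] and [(a.1, j) (b.1, k)] are parallel. *)
Definition bad_event (e : event_index) : {set {perm point}} :=
  match e with
  | inl (a, j) => [set P : {perm point} | P a == (a.1, j)]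
  | inr ((a, j), (b, k)) => [set P : {perm point} | [&& a.1 != b.1, j != a.2,
      P a == b & P (a.1, j) == (b.1, k)]]
  end.

(** Two events are treated as dependent exactly when these sets meet. *)
Definition event_points (e : event_index) : {set point} :=
  match e with
  | inl (a, j) => [set a; (a.1, j)]
  | inr ((a, j), (b, k)) => [set a; (a.1, j)] :|: [set b; (b.1, k)]
  end.

Definition simple_pairings : {set {perm point}} :=
  [set P in pairings point | [forall a, (P a).1 != a.1] &&
    [forall a, forall b, (a.1 == b.1) ==> ((P a).1 == (P b).1) ==> (a == b)]].

Lemma simple_pairingsP P : reflect
  [/\ P \in pairings point, forall a, (P a).1 != a.1 &
      forall a b, a.1 = b.1 -> (P a).1 = (P b).1 -> a = b]
  (P \in simple_pairings).
Proof.
rewrite inE; apply: (iffP and3P) => -[PP h1 h2]; split => //.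
- exact/forallP.
- move=> a b ab Pab; move/forallP/(_ a)/forallP/(_ b): h2.
  by rewrite ab Pab !eqxx /= => /eqP.
- exact/forallP.
- apply/forallP => a; apply/forallP => b; apply/implyP => /eqP ab.
  by apply/implyP => /eqP Pab; apply/eqP/h2.
Qed.

Lemma avoiding_simple :
  avoiding (pairings point) bad_event [set: event_index] = simple_pairings.
Proof.
apply/setP => P; apply/in_avoiding/simple_pairingsP => [[PP h]|[PP h1 h2]].
  have nl a : (P a).1 != a.1.
    have := h (inl (a, (P a).2)) (in_setT _); rewrite !inE.
    by apply: contraNneq => <-; rewrite -surjective_pairing.
  split=> // a b ab Pab; apply/eqP; apply: contraT => neab.
  (* As [a] and [b] lie over one vertex, [(a.1, b.2)] is [b]: this index describes the pairs of [a]
     and [b] as parallel. *)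
  have := h (inr ((a, b.2), (P a, (P b).2))) (in_setT _); rewrite !inE eqxx ab Pab.
  rewrite -!surjective_pairing eqxx -ab -Pab eq_sym nl /= andbT negbK => /eqP e.
  by rewrite [a]surjective_pairing ab -e -surjective_pairing eqxx in neab.
split=> // -[[a j]|[[a j] [b k]]] _; rewrite !inE.
  by apply: contraNneq (h1 a) => ->.
apply/negP => /and4P[ab ja /eqP Pa /eqP Pj].
have /(congr1 snd)/= e : a = (a.1, j) by apply: h2; rewrite // Pa Pj.
by rewrite -e eqxx in ja.
Qed.

(** A switch creates pairs only at [a] and [b], so it may destroy an event away from both but never
    create one. This monotonicity is what makes the local lemma applicable. *)
Lemma switch_avoiding (S : {set event_index}) a b P c :
  (forall e, e \in S -> (a \notin event_points e) && (b \notin event_points e)) ->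
  P \in avoiding (pairings point) bad_event S -> P \in pairings point ->
  P a = b -> c != a -> switch b c P \in avoiding (pairings point) bad_event S.
Proof.
move=> hS /in_avoiding[_ hP] PP Pa ca; apply/in_avoiding.
split=> [|e eS]; first exact: switch_pairing.
have /andP[ae be] := hS e eS; apply: contra (hP e eS).
have back x y : x \in event_points e -> y \in event_points e ->
    switch b c P x = y -> P x = y.
  move=> xe ye Qx; rewrite (switch_back PP Pa ca) ?Qx //.
  - by apply: contraNneq ae => <-.
  - by apply: contraNneq be => <-.
  - by apply: contraNneq ae => <-.
  - by apply: contraNneq be => <-.
move: back; case: e {hP eS hS ae be} => [[u j]|[[u j] [v k]]] back.
  rewrite !inE => /eqP /back ->; rewrite ?eqxx // !inE eqxx ?orbT //.
rewrite !inE => /and4P[-> -> /eqP e1 /eqP e2] /=.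
by rewrite (back _ _ _ _ e1) ?(back _ _ _ _ e2) ?eqxx // !inE eqxx ?orbT.
Qed.

(** With [N = n d]: a loop is one prescribed pair and costs [1 / (N - 1)]; a parallel event is two,
    the second counted with the first exposed, and costs [1 / ((N - 1) (N - 3))]. From [N >= 6] both
    factors are at least [N / 2]. *)
Lemma bad_event_le (e : event_index) (S : {set event_index})
  (C := avoiding (pairings point) bad_event S) : 6 <= n * d ->
  (forall e', e' \in S -> [disjoint event_points e & event_points e']) ->
  #|bad_event e :&: C| * (n * d) ^ (if e is inl _ then 1 else 2) <=
  2 ^ (if e is inl _ then 1 else 2) * #|C|.
Proof.
move=> N6 hS.
have cT : #|{: point}| = n * d by rewrite card_prod !card_ord.
have CP P : P \in C -> P \in pairings point by move=> /in_avoiding[].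
have [->|[P1]] := set_0Vmem (bad_event e :&: C); first by rewrite cards0.
rewrite inE => /andP[P1e P1C].
have P1P := CP _ P1C.
have st0 : stable set0 P1 by move=> x; rewrite inE.
have out x : x \in event_points e -> forall e', e' \in S -> x \notin event_points e'.
  by move=> xe e' e'S; have /disjointFr -> := hS _ e'S.
have sc x y : x \in event_points e -> y \in event_points e ->
    forall P c, P \in C -> P \in pairings point -> P x = y -> c != x ->
    switch y c P \in C.
  move=> xe ye P c PC PP Px cx; apply: (switch_avoiding (a := x)) => // e' e'S.
  by rewrite !out.
move: sc; clearbody C => sc; case: e P1e {hS} out sc => [[a j]|[[a j] [b k]]] /=; rewrite inE.
  move=> _ _ sc; rewrite !expn1.
  have := @switch_count _ set0 P1 a (a.1, j) C st0.
  rewrite !in_set0 cards0 cT extending0 => /(_ isT isT).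
  have -> : pairings point :&: C = C by apply/setIidPr/subsetP.
  have -> : [set P : {perm point} in C | P a == (a.1, j)] =
      [set P : {perm point} | P a == (a.1, j)] :&: C.
    by apply/setP => P; rewrite !inE andbC.
  move=> /(_ (sc _ _ _ _)); rewrite !inE !eqxx orbT => /(_ isT isT).
  by rewrite -subnDA add0n; apply: mul_le_double; apply: leq_trans N6.
move=> /and4P[ab ja /eqP Pa /eqP Pa'] _ sc.
have aj : (a.1, j) != a.
  by apply: contraNneq ja => /(congr1 snd) /= ->.
have bk : (b.1, k) != b.
  by apply: contraNneq aj => e; rewrite -(inj_eq (@perm_inj _ P1)) Pa Pa' e.
have := @switch_count _ set0 P1 a b C st0.
rewrite !in_set0 cards0 cT extending0 => /(_ isT isT).
have -> : pairings point :&: C = C by apply/setIidPr/subsetP.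
move=> /(_ (sc _ _ _ _)); rewrite !inE !eqxx !orbT => /(_ isT isT) h1.
pose D := a |: (b |: set0).
have FP : P1 \in fiber set0 P1 a b.
  by rewrite inE Pa eqxx andbT; apply/extendingP; split.
have stD : stable D P1 by apply: fiber_stable FP.
have ba : b != a by rewrite -Pa pairing_neq.
have cD : #|D| = 2.
  by rewrite /D cardsU1 cardsU1 cards0 !inE orbF eq_sym ba.
have := @switch_count _ D P1 (a.1, j) (b.1, k) C stD.
rewrite !inE (negPf aj) (negPf bk) !orbF cD cT.
have -> : ((a.1, j) == b) = false.
  by apply: contraNF ab => /eqP <-.
have -> : ((b.1, k) == a) = false.
  by apply: contraNF ab => /eqP <-.
move=> /(_ isT isT) /(_ (sc _ _ _ _)); rewrite !inE !eqxx !orbT => /(_ isT isT) h2.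
have e1 : extending D P1 :&: C = [set P : {perm point} in C | P a == b].
  apply/setP => P; rewrite -(fiber_ext FP) !inE extending0 [RHS]andbC.
  by have := CP P; case: (P \in C) => [/(_ isT) ->|_]; rewrite ?andbF ?andbT.
rewrite e1 in h2.
have : #|[set P : {perm point} | [&& a.1 != b.1, j != a.2, P a == b
    & P (a.1, j) == (b.1, k)]] :&: C| <=
    #|[set P : {perm point} in [set P : {perm point} in C | P a == b] |
       P (a.1, j) == (b.1, k)]|.
  apply: subset_leq_card; apply/subsetP => P.
  by rewrite !inE => /andP[/and4P[_ _ -> ->] ->].
move=> h3.
rewrite -subnDA in h1; rewrite -subnDA in h2.
have {}h1 := mul_le_double (leq_trans _ N6 : 2 * 1 <= n * d) h1.
have {}h2 := mul_le_double (leq_trans _ N6 : 2 * 3 <= n * d) h2.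
apply: (leq_trans (leq_mul h3 (leqnn _))).
rewrite !expnS !expn0 !muln1 mulnA; apply: (leq_trans (leq_mul (h2 isT) (leqnn _))).
by rewrite -!mulnA leq_mul2l /= h1.
Qed.

End Configuration.

(** * Weights of the bad events and the probability of being simple *)

Section ConfigurationBounds.
Variables n d : nat.
Local Notation point := ('I_n * 'I_d)%type.
Local Notation event_index := (event_index n d).

Lemma card_vertex_pair (p : point) :
  #|[set u : point * 'I_d | p \in [set u.1; (u.1.1, u.2)]]| <= 2 * d.
Proof.
have sub : [set u : point * 'I_d | p \in [set u.1; (u.1.1, u.2)]] \subset
    [set (p, j) | j : 'I_d] :|: [set ((p.1, j), p.2) | j : 'I_d].
  apply/subsetP => -[a j]; rewrite !inE /= => /orP[/eqP->|/eqP ->].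
    by apply/orP; left; apply/imsetP; exists j.
  by apply/orP; right; apply/imsetP; exists a.2; rewrite //= -surjective_pairing.
apply: leq_trans (subset_leq_card sub) _; apply: leq_trans (leq_card_setU _ _) _.
by rewrite mul2n -addnn leq_add // (leq_trans (leq_imset_card _ _)) // card_ord.
Qed.

Local Open Scope ring_scope.
Variable R : realType.
Local Notation N := (n * d)%N.

(** Twice the conditional frequencies [2 / N] and [4 / N ^ 2] of [bad_event_le], the slack that the
    local lemma asks for. *)
Definition weight (e : event_index) : R :=
  if e is inl _ then 4 / N%:R else 8 / N%:R ^+ 2.

Lemma weight_ge0 e : 0 <= weight e.
Proof. by case: e => ?; rewrite /weight divr_ge0 ?exprn_ge0 ?ler0n. Qed.

Lemma sum_weight_pred (p : pred event_index) (A : {set point * 'I_d})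
    (B : {set (point * 'I_d) * (point * 'I_d)}) :
  (forall u, p (inl u) -> u \in A) -> (forall u, p (inr u) -> u \in B) ->
  \sum_(e | p e) weight e <=
    #|A|%:R * (4 / N%:R) + #|B|%:R * (8 / N%:R ^+ 2).
Proof.
move=> hA hB.
rewrite big_sumType /=; apply: lerD.
  rewrite [#|A|%:R * _]mulr_natl -sumr_const big_mkcond [leRHS]big_mkcond /=.
  apply: ler_sum => u _; case: ifP => [/hA ->//|_]; case: ifP => // _.
  by rewrite divr_ge0 ?ler0n.
rewrite [#|B|%:R * _]mulr_natl -sumr_const big_mkcond [leRHS]big_mkcond /=.
apply: ler_sum => u _; case: ifP => [/hB ->//|_]; case: ifP => // _.
by rewrite divr_ge0 ?exprn_ge0 ?ler0n.
Qed.

Hypothesis n_gt0 : (0 < n)%N.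
Hypothesis d_gt0 : (0 < d)%N.

Let nR : 0 < n%:R :> R. Proof. by rewrite ltr0n. Qed.
Let dR : 1 <= d%:R :> R. Proof. by rewrite ler1n. Qed.

(** A point lies in at most [2 d] loop events and [4 d * (N d)] parallel ones, of total weight
    [(8 + 32 d) / n]. *)
Lemma sum_weight_point (p : point) :
  \sum_(e | p \in event_points e) weight e <= 40 * d%:R / n%:R.
Proof.
pose L := [set u : point * 'I_d | p \in [set u.1; (u.1.1, u.2)]].
have cL : (#|L| <= 2 * d)%N by apply: card_vertex_pair.
have cT : (#|{: point * 'I_d}| = N * d)%N by rewrite !card_prod !card_ord.
pose B := setX L [set: point * 'I_d] :|: setX [set: point * 'I_d] L.
have cB : (#|B| <= 4 * d * (N * d))%N.
  apply: leq_trans (leq_card_setU _ _) _; rewrite !cardsX cardsT cT.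
  rewrite [X in (_ + X)%N]mulnC addnn -mul2n.
  have -> : (4 * d * (N * d) = 2 * (2 * d * (N * d)))%N by rewrite !mulnA.
  by rewrite leq_mul2l /= leq_mul.
apply: (le_trans (@sum_weight_pred (fun e => p \in event_points e) L B _ _)).
- by move=> -[a j]; rewrite /= !inE.
- by move=> -[[a j] [b k]]; rewrite /= !inE andbT.
have d0 : 0 < d%:R :> R by rewrite ltr0n.
apply: (@le_trans _ _ ((2 * d)%:R * (4 / N%:R) +
    (4 * d * (N * d))%:R * (8 / N%:R ^+ 2))).
  by apply: lerD; rewrite ler_wpM2r ?divr_ge0 ?exprn_ge0 ?ler0n ?ler_nat.
rewrite !natrM; have -> : 2 * d%:R * (4 / (n%:R * d%:R)) +
   4 * d%:R * (n%:R * d%:R * d%:R) * (8 / (n%:R * d%:R) ^+ 2) =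
   (8 + 32 * d%:R) / n%:R :> R by field; rewrite !gt_eqF.
rewrite ler_pM2r ?invr_gt0 //; have := dR; lra.
Qed.

Lemma sum_weight_touch (Q : {set point}) :
  \sum_(e | ~~ [disjoint Q & event_points e]) weight e <=
  #|Q|%:R * (40 * d%:R / n%:R).
Proof.
rewrite [#|Q|%:R * _]mulr_natl -sumr_const.
apply: (@le_trans _ _ (\sum_(p in Q) \sum_(e | p \in event_points e) weight e)).
  under [leRHS]eq_bigr do rewrite big_mkcond.
  rewrite exchange_big [leLHS]big_mkcond /=; apply: ler_sum => e _.
  have s0 : 0 <= \sum_(p in Q) if p \in event_points e then weight e else 0.
    by apply: sumr_ge0 => p _; case: ifP; rewrite ?weight_ge0.
  case: ifP => // /negP/negP; rewrite disjoints_subset => /subsetPn[p pQ].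
  rewrite !inE negbK => pe; rewrite (bigD1 p) //= pe lerDl.
  by apply: sumr_ge0 => q _; case: ifP; rewrite ?weight_ge0.
by apply: ler_sum => p _; apply: sum_weight_point.
Qed.

Lemma sum_weight : \sum_e weight e <= 12 * d%:R ^+ 2.
Proof.
apply: (le_trans (@sum_weight_pred predT setT setT _ _)) ; [by move=> u _; rewrite in_setT|by move=> u _; rewrite in_setT|].
rewrite !cardsT !card_prod !card_ord !natrM.
have d0 : 0 < d%:R :> R by rewrite ltr0n.
have -> : n%:R * d%:R * d%:R * (4 / (n%:R * d%:R)) +
   n%:R * d%:R * d%:R * (n%:R * d%:R * d%:R) * (8 / (n%:R * d%:R) ^+ 2) =
   4 * d%:R + 8 * d%:R ^+ 2 :> R by field; rewrite !gt_eqF.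
by have := ler_wpM2l (ltW d0) dR; rewrite mulr1 -expr2; lra.
Qed.

Hypothesis dn : (320 * d ^ 2 <= n)%N.

Let N6 : (6 <= N)%N.
Proof. by apply: (@leq_trans (6 * 1)) => //; apply: leq_mul => //; nia. Qed.

Definition near_event (e e' : event_index) : bool :=
  ~~ [disjoint event_points e & event_points e'].

Lemma card_event_points (e : event_index) : (#|event_points e| <= 4)%N.
Proof.
case: e => [[a j]|[[a j] [b k]]] /=; first by rewrite cards2; case: eqP.
apply: leq_trans (leq_card_setU _ _) _; rewrite !cards2.
by case: eqP => _; case: eqP.
Qed.

(** Four points at [40 d / n] each stay below [1 / 2] once [n >= 320 d]. *)
Lemma near_event_weight e : \sum_(e' | near_event e e') weight e' <= 1 / 2.
Proof.
apply: le_trans (sum_weight_touch (event_points e)) _.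
have h : (320 * d <= n)%N by nia.
have hR : 320 * d%:R <= n%:R :> R by rewrite -natrM ler_nat.
have c4 : #|event_points e|%:R <= 4 :> R by rewrite ler_nat card_event_points.
apply: (@le_trans _ _ (4 * (40 * d%:R / n%:R))).
  by rewrite ler_wpM2r // divr_ge0 ?mulr_ge0 ?ler0n.
by rewrite mulrA ler_pdivrMr //; lra.
Qed.

Lemma bad_event_cond e (S : {set event_index}) :
  (forall e', e' \in S -> ~~ near_event e e') ->
  #|bad_event e :&: avoiding (pairings point) (@bad_event n d) S|%:R <=
    weight e / 2 * #|avoiding (pairings point) (@bad_event n d) S|%:R :> R.
Proof.
move=> hS; have := @bad_event_le n d e S N6.
have hS' e' : e' \in S -> [disjoint event_points e & event_points e'].
  by move=> /hS; rewrite negbK.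
move=> /(_ hS'); set x := #|_|; set y := #|_|.
have NR : 0 < N%:R :> R by rewrite ltr0n; apply: leq_trans N6.
rewrite -(ler_nat R); move: NR; rewrite /weight.
move: x y => x y; move: N => M NR.
have M0 : M%:R != 0 :> R by rewrite gt_eqF.
case: e {hS hS'} => u.
  rewrite !expn1 !natrM => h; rewrite -(ler_pM2r NR); apply: le_trans h _.
  by rewrite le_eqVlt; apply/orP; left; apply/eqP; field.
rewrite [(x * _)%:R]natrM [(_ * y)%:R]natrM !natrX => h; rewrite -(ler_pM2r (exprn_gt0 2 NR)).
apply: le_trans h _.
by rewrite le_eqVlt; apply/orP; left; apply/eqP; field.
Qed.

Lemma weight_le_half e : weight e <= 1 / 2.
Proof.
apply: le_trans (near_event_weight e).
have e0 : near_event e e.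
  rewrite /near_event -setI_eq0 setIid; apply/set0Pn.
  by case: e => [[a j]|[[a j] [b k]]]; exists a; rewrite !inE eqxx.
rewrite (bigD1 e) //= lerDl; apply: sumr_ge0 => *; exact: weight_ge0.
Qed.

Lemma expR_le_onem (x : R) : 0 <= x <= 1 / 2 -> expR (- (2 * x)) <= 1 - x.
Proof.
move=> /andP[x0 x2]; have := expR_ge1Dx (2 * x) => h.
rewrite expRN -div1r ler_pdivrMr ?expR_gt0 //.
have h2 : (1 - x) * (1 + 2 * x) = 1 + x * (1 - 2 * x) by ring.
apply: (@le_trans _ _ ((1 - x) * (1 + 2 * x))).
  by rewrite h2 lerDl mulr_ge0 //; lra.
by rewrite ler_wpM2l //; lra.
Qed.

Lemma avoiding_all (S S' : {set event_index}) (y : R) :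
  \sum_(e in S') weight e <= y ->
  expR (- (2 * y)) * #|avoiding (pairings point) (@bad_event n d) S|%:R <=
    #|avoiding (pairings point) (@bad_event n d) (S' :|: S)|%:R.
Proof.
move=> hy.
have := local_lemma weight_ge0 bad_event_cond near_event_weight S (S' := S').
have h1 e : weight e <= 1 by have := weight_le_half e; lra.
move=> /(_ (fun i _ => h1 i)); apply: le_trans; rewrite ler_wpM2r ?ler0n //.
apply: (@le_trans _ _ (\prod_(e in S') expR (- (2 * weight e)))).
  rewrite -expR_sum ler_expR sumrN -mulr_sumr; lra.
apply: ler_prod => e _; rewrite expR_ge0 /=.
by apply: expR_le_onem; rewrite weight_ge0 weight_le_half.
Qed.

(** The weights total at most [12 d ^ 2], and [1 - x >= exp (- 2 x)], valid for weights up to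
    [1 / 2], doubles the exponent. *)
Lemma card_simple_pairings :
  expR (- (24 * d%:R ^+ 2)) * #|pairings point|%:R <= #|simple_pairings n d|%:R :> R.
Proof.
have h : \sum_(e in [set: event_index]) weight e <= 12 * d%:R ^+ 2.
  by apply: le_trans sum_weight; rewrite big_mkcond; apply: ler_sum => e _; rewrite inE.
have := @avoiding_all set0 setT _ h; rewrite setU0 avoiding_simple.
have -> : avoiding (pairings point) (@bad_event n d) set0 = pairings point.
  apply/setP => P; apply/in_avoiding/idP => [[]//|PP]; split => // j.
  by rewrite inE.
by rewrite mulrA; have -> : 2 * 12 = 24 :> R by ring.
Qed.

End ConfigurationBounds.

(** * Probability that prescribed edges are present *)

Section EdgeProbability.
Variables n d : nat.
Local Notation point := ('I_n * 'I_d)%type.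
Local Notation N := (n * d)%N.

Definition edge_set (P : {perm point}) : {set {set 'I_n}} :=
  [set [set a.1; (P a).1] | a : point].

(** Edges are realised one at a time: an edge [u v] comes from one of [d * d] pairs of points, each
    of frequency at most [1 / M] in [C] by [switch_count] with the earlier pairs exposed. Exposed
    pairs lie over none of the remaining edges, so the points needed next are unexposed, and the
    size hypothesis keeps [N - |D| - 1 >= M] throughout. *)
Lemma lift_count (C : {set {perm point}}) (M : nat) (es : seq {set 'I_n})
  (D : {set point}) P0 :
  P0 \in pairings point -> stable D P0 -> uniq es ->
  {in es, forall e : {set 'I_n}, #|e| = 2} ->
  {in D, forall x : point, [set x.1; (P0 x).1] \notin es} ->
  (forall a b, [set a.1; b.1] \in es -> forall P c, P \in C ->
     P \in pairings point -> P a = b -> c != a -> switch b c P \in C) ->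
  (M + #|D| + 2 * size es <= N.+1)%N ->
  (#|[set P : {perm point} in extending D P0 :&: C | all (mem (edge_set P)) es]| * M ^ size es
   <= (d * d) ^ size es * #|extending D P0 :&: C|)%N.
Proof.
elim: es D P0 => [|e es IH] D P0 PP st.
  move=> _ _ _ _ _; rewrite !expn0 muln1 mul1n subset_leq_card //.
  by apply/subsetP => P; rewrite inE andbT.
rewrite cons_uniq => /andP[ees ues] ce hD hC hM.
have [u [v uv eE]] : exists u, exists2 v, u != v & e = [set u; v].
  have /eqP/cards2P[u [v [uv ->]]] := ce e (mem_head _ _).
  by exists u; exists v.
pose Y (jk : 'I_d * 'I_d) := [set P : {perm point} in extending D P0 :&: C |
  all (mem (edge_set P)) es & P (u, jk.1) == (v, jk.2)].
have sub : [set P : {perm point} in extending D P0 :&: C | all (mem (edge_set P)) (e :: es)]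
    \subset \bigcup_jk Y jk.
  apply/subsetP => P; rewrite inE /= => /and3P[PE /imsetP[a _ ea] Pes].
  have PP' : P \in pairings point by have /setIP[/extendingP[]] := PE.
  apply/bigcupP; move: ea; rewrite eE => ea.
  have [Pa|Pa] : (a.1 = u /\ (P a).1 = v) \/ (a.1 = v /\ (P a).1 = u).
  - have : a.1 \in [set u; v] by rewrite ea !inE eqxx.
    have : (P a).1 \in [set u; v] by rewrite ea !inE eqxx orbT.
    have : u \in [set a.1; (P a).1] by rewrite -ea !inE eqxx.
    have : v \in [set a.1; (P a).1] by rewrite -ea !inE eqxx orbT.
    rewrite !inE => /orP[/eqP h1|/eqP h1] /orP[/eqP h2|/eqP h2] _ _.
    + by move: uv; rewrite h1 h2 eqxx.
    + by right.
    + by left.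
    + by move: uv; rewrite h1 h2 eqxx.
  - exists (a.2, (P a).2) => //; rewrite inE PE Pes /=.
    by case: Pa => <- <-; rewrite -!surjective_pairing.
  exists ((P a).2, a.2) => //; rewrite inE PE Pes /=.
  by case: Pa => <- <-; rewrite -!surjective_pairing pairingK.
have hY jk : (#|Y jk| * M ^ (size es).+1 <=
    (d * d) ^ size es * #|extending D P0 :&: C|)%N.
  have [->|[P1]] := set_0Vmem (Y jk); first by rewrite cards0.
  case: jk => j k; rewrite inE /= => /and3P[P1EC P1es /eqP P1a].
  have /setIP[P1E P1C] := P1EC; have /extendingP[P1P e1] := P1E.
  set a : point := (u, j) in P1a; set b : point := (v, k) in P1a.
  have aD : a \notin D.
    apply/negP => aD; have := hD a aD; rewrite -e1 // P1a /= -eE.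
    by rewrite mem_head.
  have bD : b \notin D.
    by rewrite -P1a; apply: (stable_out P1P (stable_ext st P1E)).
  have ba : b != a by rewrite -P1a pairing_neq.
  have P1F : P1 \in fiber D P0 a b by rewrite inE P1E P1a eqxx.
  set D1 := a |: (b |: D).
  have cD1 : #|D1| = #|D|.+2.
    by rewrite /D1 cardsU1 cardsU1 !inE (negPf aD) (negPf bD) eq_sym (negPf ba).
  have fE : extending D1 P1 :&: C = [set P : {perm point} in extending D P0 :&: C | P a == b].
    by apply/setP => P; rewrite -(fiber_ext P1F) !inE andbAC.
  have sc := @switch_count _ D P0 a b C st aD bD _.
  have {}sc : (#|extending D1 P1 :&: C| * (N - #|D| - 1) <=
      #|extending D P0 :&: C|)%N.
    rewrite fE; have := sc; rewrite card_prod !card_ord; apply.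
    by apply: (hC a b); rewrite /= -eE mem_head.
  have IH1 := IH D1 P1 P1P (fiber_stable st P1F) ues.
  have {}IH1 : (#|[set P : {perm point} in extending D1 P1 :&: C | all (mem (edge_set P)) es]| *
      M ^ size es <= (d * d) ^ size es * #|extending D1 P1 :&: C|)%N.
    apply: IH1.
    - by move=> f fes; apply: ce; rewrite inE fes orbT.
    - move=> x /setU1P[->|/setU1P[->|xD]].
      + by rewrite P1a /= -eE.
      + have -> : P1 b = a by rewrite -P1a pairingK.
        by rewrite /= setUC -eE.
      + by rewrite e1 //; have := hD x xD; rewrite inE negb_or => /andP[].
    - by move=> a' b' ab; apply: hC; rewrite inE ab orbT.
    - by move: hM; rewrite /= cD1; move: (size es) #|D| => p q; clear; lia.
  have sub1 : (#|Y (j, k)| <=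
      #|[set P : {perm point} in extending D1 P1 :&: C | all (mem (edge_set P)) es]|)%N.
    apply: subset_leq_card; apply/subsetP => P; rewrite fE !inE /= -/a -/b.
    by move=> /and3P[-> -> ->].
  apply: (leq_trans (leq_mul sub1 (leqnn _))); rewrite expnSr mulnA.
  apply: (leq_trans (leq_mul IH1 (leqnn _))); rewrite -mulnA leq_mul2l.
  apply/orP; right; apply: leq_trans sc; rewrite leq_mul2l.
  by apply/orP; right; move: hM; rewrite /=; move: (size es) #|D| => p q; clear; lia.
apply: (leq_trans (leq_mul (subset_leq_card sub) (leqnn _))).
apply: (@leq_trans ((\sum_jk #|Y jk|) * M ^ (size es).+1)).
  rewrite leq_mul //; elim/big_rec2: _ => [|jk m B _ h]; first by rewrite cards0.
  by apply: leq_trans (leq_card_setU _ _) _; rewrite leq_add2l.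
rewrite big_distrl /=; apply: (@leq_trans (\sum_(jk : 'I_d * 'I_d)
    (d * d) ^ size es * #|extending D P0 :&: C|)); first exact: leq_sum.
by rewrite sum_nat_const card_prod !card_ord mulnA -expnS.
Qed.

Local Open Scope ring_scope.
Variable R : realType.
Hypothesis n_gt0 : (0 < n)%N.
Hypothesis d_gt0 : (0 < d)%N.
Hypothesis dn : (320 * d ^ 2 <= n)%N.

(** Switches at the points over [E] could create bad events there, so the count is not done inside
    the simple pairings but in [C], which avoids only the events that do not touch these points.
    There each edge costs [2 d / n]. The local lemma restores the touching events, of total weight
    [80 k d ^ 2 / n], at a cost of at most 2 per edge because [n >= 320 d ^ 2]. *)
Lemma edges_in_simple (E : {set {set 'I_n}}) : {in E, forall e : {set 'I_n}, #|e| = 2%N} ->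
  (4 * #|E| <= N)%N ->
  #|[set P : {perm point} in simple_pairings n d | E \subset edge_set P]|%:R <=
  (4 * d%:R / n%:R) ^+ #|E| * #|simple_pairings n d|%:R :> R.
Proof.
move=> E2 EN; set k := #|E|.
pose V := cover E.
pose Q := [set p : point | p.1 \in V].
pose S1 := [set e : event_index n d | ~~ [disjoint Q & event_points e]].
pose C := avoiding (pairings point) (@bad_event n d) (~: S1).
have cQ : (#|Q| <= 2 * k * d)%N.
  have -> : Q = setX V setT by apply/setP => -[x y]; rewrite !inE andbT.
  rewrite cardsX cardsT card_ord leq_mul2r; apply/orP; right.
  apply: (leq_trans (leq_card_cover E)).
  rewrite (eq_bigr (fun=> 2%N)) ?sum_nat_const; last by move=> e /E2.
  by rewrite mulnC.
have CP : C \subset pairings point by apply/subsetP => P /in_avoiding[].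
have simC : simple_pairings n d \subset C.
  by rewrite -avoiding_simple avoiding_sub // subsetT.
have S1w : \sum_(e in S1) weight R e <= 80 * k%:R * d%:R ^+ 2 / n%:R.
  rewrite (eq_bigl (fun e => ~~ [disjoint Q & event_points e])); last first.
    by move=> e; rewrite inE.
  apply: le_trans (sum_weight_touch R n_gt0 d_gt0 Q) _.
  apply: (@le_trans _ _ ((2 * k * d)%:R * (40 * d%:R / n%:R))).
    by rewrite ler_wpM2r ?ler_nat // divr_ge0 ?mulr_ge0 ?ler0n.
  by rewrite !natrM le_eqVlt; apply/orP; left; apply/eqP; ring.
have nR : 0 < n%:R :> R by rewrite ltr0n.
have := avoiding_all n_gt0 d_gt0 dn (~: S1) S1w.
rewrite setUCr avoiding_simple -/C => hsim.
have half : (1 / 2) ^+ k * #|C|%:R <= #|simple_pairings n d|%:R :> R.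
  apply: le_trans hsim; rewrite ler_wpM2r ?ler0n //.
  have -> : - (2 * (80 * k%:R * d%:R ^+ 2 / n%:R)) =
     k%:R * (- (160 * d%:R ^+ 2 / n%:R)) :> R by ring.
  rewrite expRM_natl; apply: lerXn2r; rewrite ?nnegrE ?expR_ge0 ?divr_ge0 //.
  apply: le_trans (expR_ge1Dx _).
  have h : 160 * d%:R ^+ 2 / n%:R <= 1 / 2 :> R.
    rewrite ler_pdivrMr //; move: dn; rewrite -(ler_nat R) natrM natrX; lra.
  lra.
have cnt : #|[set P : {perm point} in C | E \subset edge_set P]|%:R * (N%:R / 2) ^+ k <=
    (d%:R ^+ 2) ^+ k * #|C|%:R :> R.
  (* At least [N / 2], as [4 k <= N]. *)
  pose M := (N.+1 - 2 * k)%N.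
  have MN : (N <= 2 * M)%N by rewrite /M; move: EN; rewrite -/k; clear; lia.
  have hM : (M + #|@finset.set0 point| + 2 * size (enum E) <= N.+1)%N.
    by rewrite cards0 -cardE /M -/k; move: EN; rewrite -/k; clear; lia.
  have [C0|[P0 P0C]] := set_0Vmem C.
    rewrite C0 [X in #|pred_of_set X|](_ : _ = set0) ?cards0 ?mul0r ?mulr0 //.
    by apply/setP => P; rewrite !inE.
  have := @lift_count C M (enum E) set0 P0 (subsetP CP _ P0C).
  rewrite extending0 (setIidPr CP) -cardE -/k.
  have st0 : stable set0 P0 by move=> x; rewrite inE.
  move=> /(_ st0 (enum_uniq _)).
  have h1 : {in enum E, forall e : {set 'I_n}, #|e| = 2%N}.
    by move=> e; rewrite mem_enum; apply: E2.
  have h2 : {in @finset.set0 point, forall x : point, [set x.1; (P0 x).1] \notin enum E}.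
    by move=> x; rewrite inE.
  have h3 (a b : point) : [set a.1; b.1] \in enum E -> forall P c, P \in C ->
     P \in pairings point -> P a = b -> c != a -> switch b c P \in C.
    rewrite mem_enum => abE P c PC PP Pab ca.
    apply: (@switch_avoiding _ _ _ a) => // e.
    rewrite !inE negbK disjoint_sym => /disjointFl dis.
    have inV z : z \in [set a.1; b.1] -> z \in V.
      by move=> zab; apply/bigcupP; exists [set a.1; b.1].
    rewrite !dis //; rewrite inE; apply: inV; rewrite !inE eqxx ?orbT //.
  rewrite -cardE in hM; move=> /(_ h1 h2 h3 hM).
  have -> : [set P : {perm point} in C | all (mem (edge_set P)) (enum E)] =
      [set P : {perm point} in C | E \subset edge_set P].
    apply/setP => P; rewrite !inE; congr (_ && _).
    apply/allP/subsetP => h e; first by rewrite -mem_enum => /h.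
    by rewrite mem_enum => /h.
  rewrite -(ler_nat R) natrM [leRHS]natrM !natrX natrM -expr2; apply: le_trans.
  rewrite ler_wpM2l ?ler0n //; apply: lerXn2r; rewrite ?nnegrE ?divr_ge0 ?ler0n //.
  by rewrite ler_pdivrMr // mulrC -natrM ler_nat.
have dR : 0 < d%:R :> R by rewrite ltr0n.
have sub : #|[set P : {perm point} in simple_pairings n d | E \subset edge_set P]|%:R
    <= #|[set P : {perm point} in C | E \subset edge_set P]|%:R :> R.
  rewrite ler_nat; apply: subset_leq_card; apply/subsetP => P.
  by rewrite in_set => /andP[Ps EP]; rewrite in_set EP andbT (subsetP simC).
have N2 : 0 < (N%:R / 2) ^+ k :> R.
  by rewrite exprn_gt0 // natrM divr_gt0 // mulr_gt0.
apply: le_trans sub _.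
rewrite -(ler_pM2r N2); apply: le_trans cnt _.
have e2 : (4 * d%:R / n%:R) ^+ k * (N%:R / 2) ^+ k = (d%:R ^+ 2) ^+ k * 2 ^+ k :> R.
  rewrite -!exprMn; congr (_ ^+ k); rewrite natrM; field.
  by rewrite gt_eqF.
rewrite mulrAC e2 -mulrA ler_wpM2l ?exprn_ge0 //.
have := ler_wpM2l (exprn_ge0 k (ler0n R 2)) half; rewrite mulrA -exprMn.
by have -> : 2 * (1 / 2) = 1 :> R; [field | rewrite expr1n mul1r].
Qed.

End EdgeProbability.

(** * Regular graphs as simple pairings *)

Lemma adjC (T : finType) (G : sgraph T) x y : adj G x y = adj G y x.
Proof. by rewrite /adj setUC. Qed.

Lemma sgraph_eq (T : finType) (G H : sgraph T) : adj G =2 adj H -> G = H.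
Proof.
move=> e; apply: val_inj; apply/setP => f /=.
have h (K : sgraph T) : f \in edges K -> #|f| == 2.
  by apply: (forall_inP (edges_card2 K)).
have [/cards2P[x [y [_ ->]]]|f2] := boolP (#|f| == 2); first exact: e.
by apply/idP/idP => /h; rewrite (negPf f2).
Qed.

Section PairingGraph.
Variables n d : nat.
Local Notation point := ('I_n * 'I_d)%type.
Implicit Types P : {perm point}.

Lemma pairing_graph_subproof P :
  [forall e in [set e in edge_set P | #|e| == 2], #|e| == 2].
Proof. by apply/forall_inP => e; rewrite inE => /andP[]. Qed.

(** Filtering out loops makes this a graph for every permutation; on simple pairings nothing is
    lost, by [edges_pairing]. *)
Definition pairing_graph P : sgraph 'I_n := SGraph (pairing_graph_subproof P).

Lemma adj_pairing P x y : P \in simple_pairings n d ->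
  adj (pairing_graph P) x y = [exists j, (P (x, j)).1 == y].
Proof.
move=> /simple_pairingsP[PP nl _]; rewrite /adj inE.
apply/andP/existsP => [[/imsetP[a _ ea] xy2]|[j /eqP <-]].
  have xy : x != y by apply: contraTneq xy2 => ->; rewrite setUid cards1.
  have : x \in [set a.1; (P a).1] by rewrite -ea !inE eqxx.
  have : y \in [set a.1; (P a).1] by rewrite -ea !inE eqxx orbT.
  rewrite !inE => /orP[/eqP h1|/eqP h1] /orP[/eqP h2|/eqP h2].
  - by move: xy; rewrite h1 h2 eqxx.
  - by exists (P a).2; rewrite h2 -surjective_pairing pairingK // h1.
  - by exists a.2; rewrite h2 -surjective_pairing h1.
  - by move: xy; rewrite h1 h2 eqxx.
split; first by apply/imsetP; exists (x, j).
by rewrite cards2 [_ == (P _).1]eq_sym nl.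
Qed.

Lemma edges_pairing P : P \in simple_pairings n d ->
  edges (pairing_graph P) = edge_set P.
Proof.
move=> /simple_pairingsP[PP nl _]; apply/setP => e; rewrite inE andb_idr //.
by move=> /imsetP[a _ ->]; rewrite cards2 [_ == (P _).1]eq_sym nl.
Qed.

(** On the simple pairings of a fixed graph this amounts to ordering the neighbours of every vertex.
    So each regular graph has [d! ^ n] simple pairings, and a uniform simple pairing yields a
    uniform regular graph. *)
Definition nbr_fun P : {ffun 'I_n -> {ffun 'I_d -> 'I_n}} :=
  [ffun v => [ffun j => (P (v, j)).1]].

Lemma pairing_graph_regular P : P \in simple_pairings n d ->
  regular d (pairing_graph P).
Proof.
move=> PS; have /simple_pairingsP[PP nl inj] := PS.
apply/forallP => x; rewrite /degree.
have -> : [set y | adj (pairing_graph P) x y] = [set (P (x, j)).1 | j : 'I_d].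
  apply/setP => y; rewrite inE adj_pairing //; apply/existsP/imsetP => -[j].
    by move=> /eqP <-; exists j.
  by move=> _ ->; exists j.
rewrite card_imset ?card_ord // => j k e.
by have := inj (x, j) (x, k) erefl e => -[].
Qed.

Definition nbr_family (G : sgraph 'I_n) (v : 'I_n) : {set {ffun 'I_d -> 'I_n}} :=
  [set f in ffun_on (mem [set y | adj G v y]) | injectiveb f].

Lemma card_nbr_family G : regular d G -> #|family (nbr_family G)| = d`! ^ n.
Proof.
move=> /forallP r; rewrite card_family.
have -> : [seq #|nbr_family G v| | v : 'I_n] = [seq d`! | v : 'I_n].
  apply: eq_map => v; rewrite card_inj_ffuns_on card_ord.
  by have /eqP := r v; rewrite /degree => ->; rewrite ffactnn.
have -> : d`! ^ n = d`! ^ size (enum 'I_n) by rewrite size_enum_ord.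
by rewrite /image_mem; elim: (enum _) => //= _ s ->; rewrite expnS.
Qed.

Lemma nbr_fun_inj : {in simple_pairings n d &, injective nbr_fun}.
Proof.
move=> P Q /simple_pairingsP[PP nP iP] /simple_pairingsP[QP nQ iQ] e.
have e1 a : (P a).1 = (Q a).1.
  by have /ffunP/(_ a.1)/ffunP/(_ a.2) := e; rewrite !ffunE -!surjective_pairing.
apply/permP => a.
have h : (P (Q a)).1 = (P (P a)).1 by rewrite pairingK // e1 pairingK.
by apply: iP => //.
Qed.

Lemma nbr_fun_onto G f : regular d G -> f \in family (nbr_family G) ->
  exists2 P, (P \in simple_pairings n d) && (pairing_graph P == G) & nbr_fun P = f.
Proof.
move=> /forallP r /familyP ff.
have f1 v j : adj G v (f v j).
  by have := ff v; rewrite inE => /andP[/ffun_onP /(_ j)]; rewrite inE.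
have f2 v : injective (f v) by have := ff v; rewrite inE => /andP[_ /injectiveP].
have f3 v w : adj G v w -> exists j, f v j == w.
  move=> vw; have : w \in [set f v j | j : 'I_d].
    have -> : [set f v j | j : 'I_d] = [set y | adj G v y].
      apply/eqP; rewrite eqEcard; apply/andP; split.
        by apply/subsetP => _ /imsetP[j _ ->]; rewrite inE.
      by have /eqP := r v; rewrite /degree => ->; rewrite card_imset // card_ord.
    by rewrite inE.
  by move=> /imsetP[j _ ->]; exists j.
have ex (a : point) : exists k, f (f a.1 a.2) k == a.1.
  by apply: f3; rewrite adjC.
(* A point is matched to the slot in which its neighbour lists [a.1]. *)
pose g (a : point) : point := (f a.1 a.2, xchoose (ex a)).
have gP a : f (g a).1 (g a).2 = a.1 by apply/eqP; apply: (xchooseP (ex a)).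
have gK : involutive g.
  move=> a; rewrite [RHS]surjective_pairing [LHS]surjective_pairing.
  have e : (g (g a)).1 = a.1 by exact: gP.
  congr (_, _) => //; apply: (f2 a.1); rewrite -{1}e gP //.
pose P := perm (inv_inj gK).
have PE a : P a = g a by rewrite permE.
have PS : P \in simple_pairings n d.
  have nl a : (P a).1 != a.1.
    rewrite PE /=; apply/eqP => e; have := f1 a.1 a.2; rewrite e.
    by rewrite adj_irrefl.
  apply/simple_pairingsP; split => //.
    rewrite pairingsE; apply/forallP => a; rewrite !PE gK eqxx /=.
    by apply: contraNneq (nl a) => e; rewrite PE e.
  move=> [v j] [w k] /=; rewrite !PE /= => -> /f2 -> //.
exists P; last by apply/ffunP => v; apply/ffunP => j; rewrite !ffunE PE.
rewrite PS; apply/eqP/sgraph_eq => v w; rewrite adj_pairing //.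
apply/existsP/idP => [[j]|]; first by rewrite PE => /eqP <-; exact: f1.
by move=> /f3[j /eqP fj]; exists j; rewrite PE /= fj.
Qed.

Lemma card_pairings_of_graph G : regular d G ->
  #|[set P in simple_pairings n d | pairing_graph P == G]| = d`! ^ n.
Proof.
move=> r; rewrite -(card_nbr_family r).
set A := [set P in _ | _].
have AS P : P \in A -> P \in simple_pairings n d by rewrite in_set => /andP[].
rewrite -(card_in_imset (f := nbr_fun)); last first.
  by move=> P Q /AS PS /AS QS; apply: nbr_fun_inj.
apply: eq_card => f; apply/imsetP/idP => [[P + ->]|/(nbr_fun_onto r)[P PA <-]].
  rewrite in_set => /andP[PS /eqP <-]; apply/familyP => v; rewrite inE.
  have /simple_pairingsP[_ _ iP] := PS.
  apply/andP; split.
    apply/ffun_onP => j; rewrite inE adj_pairing // !ffunE.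
    by apply/existsP; exists j.
  apply/injectiveP => j k; rewrite !ffunE => e.
  by have := iP (v, j) (v, k) erefl e => -[].
by exists P => //; rewrite in_set.
Qed.

Lemma card_graphs_pairings (Q : pred (sgraph 'I_n)) :
  #|[set P in simple_pairings n d | Q (pairing_graph P)]| =
  #|[set G in regular_graphs n d | Q G]| * d`! ^ n.
Proof.
rewrite -sum1_card (partition_big pairing_graph
  (mem [set G in regular_graphs n d | Q G])) /=; last first.
  move=> P; rewrite in_set => /andP[PS QP]; rewrite !in_set QP andbT.
  exact: pairing_graph_regular.
rewrite -sum_nat_const; apply: eq_bigr => G; rewrite !in_set => /andP[r QG].
rewrite -(card_pairings_of_graph r) -sum1_card; apply: eq_bigl => P.
by rewrite !in_set; case: eqP => [->|]; rewrite ?QG ?andbT ?andbF.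
Qed.

Lemma card_regular_pairings :
  #|simple_pairings n d| = #|regular_graphs n d| * d`! ^ n.
Proof.
have := card_graphs_pairings predT.
have -> : [set P in simple_pairings n d | predT (pairing_graph P)] =
  simple_pairings n d by apply/setP => P; rewrite in_set andbT.
by have -> : [set G in regular_graphs n d | predT G] = regular_graphs n d
  by apply/setP => P; rewrite in_set andbT.
Qed.

End PairingGraph.

(** * Concentration on pairings *)

Local Open Scope ring_scope.

(** From [exp (- y) >= 1 - y], that is, [exp y <= 1 / (1 - y)]. *)
Lemma expR_le_quadratic (R : realType) (y : R) : y <= 1 / 2 ->
  expR y <= 1 + y + 2 * y ^+ 2.
Proof.
move=> y2; have := expR_ge1Dx (- y) => h.
have e0 : 0 < expR y by exact: expR_gt0.
have e1 : expR y * expR (- y) = 1 by rewrite -expRD subrr expR0.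
have h1 : expR y * (1 - y) <= 1 by rewrite -[leRHS]e1 ler_pM2l.
have h2 : 0 < 1 - y by lra.
rewrite -(ler_pM2r h2); apply: le_trans h1 _.
have -> : (1 + y + 2 * y ^+ 2) * (1 - y) = 1 + y ^+ 2 * (1 - 2 * y) by ring.
by rewrite lerDl mulr_ge0 ?sqr_ge0 //; lra.
Qed.

Section Variance.
Variables (R : realType) (J : finType) (A : {set J}) (g : J -> R) (B : R).
Hypothesis A_gt0 : (0 < #|A|)%N.
Hypothesis lip : {in A &, forall b c, `|g b - g c| <= 2}.
Hypothesis up : {in A, forall b, \sum_(c in A) Num.max (g c - g b) 0 <= B}.

Lemma sum_sqrB u : \sum_(c in A) (u - g c) ^+ 2 =
  #|A|%:R * u ^+ 2 - 2 * u * (\sum_(c in A) g c) + \sum_(c in A) g c ^+ 2.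
Proof.
rewrite mulr_sumr -sumr_const mulr_suml -sumrB -big_split /=.
by apply: eq_bigr => c _; ring.
Qed.

(** A squared difference is at most twice its absolute value, which splits into the increases in the
    two directions; summed over all ordered pairs the directions agree. So a bound on the total
    increase from each point controls the variance, with no such bound on decreases. *)
Lemma sum_sqr_dev_le :
  \sum_(b in A) (g b - (\sum_(b in A) g b) / #|A|%:R) ^+ 2 <= 2 * B.
Proof.
have Np : 0 < #|A|%:R :> R by rewrite ltr0n.
have N0 : #|A|%:R != 0 :> R by rewrite gt_eqF.
set S := \sum_(b in A) g b; set gbar := S / _.
pose Q := \sum_(b in A) g b ^+ 2.
have e0 : \sum_(b in A) (g b - gbar) ^+ 2 = Q - S ^+ 2 / #|A|%:R.
  under eq_bigr do rewrite -sqrrN opprB.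
  by rewrite sum_sqrB -/S -/Q /gbar; field.
have e1 : \sum_(b in A) \sum_(c in A) (g b - g c) ^+ 2 =
    2 * #|A|%:R * \sum_(b in A) (g b - gbar) ^+ 2.
  rewrite e0; under eq_bigr do rewrite sum_sqrB -/S -/Q.
  rewrite big_split sumrB /= -mulr_sumr -/Q -!mulr_suml -mulr_sumr -/S.
  by rewrite sumr_const -mulr_natl; field.
have e2 : \sum_(b in A) \sum_(c in A) (g b - g c) ^+ 2 <= 4 * #|A|%:R * B.
  pose p b c := Num.max (g c - g b) 0.
  have h : \sum_(b in A) \sum_(c in A) p b c <= #|A|%:R * B.
    by rewrite mulr_natl -sumr_const; apply: ler_sum => b; apply: up.
  apply: (@le_trans _ _ (\sum_(b in A) \sum_(c in A) 2 * (p b c + p c b))).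
    apply: ler_sum => b bA; apply: ler_sum => c cA.
    rewrite -real_normK ?num_real // expr2; have l := lip bA cA.
    apply: le_trans (ler_wpM2r (normr_ge0 _) l) _; rewrite ler_pM2l //.
    rewrite ler_norml /p; apply/andP.
    case: (lerP (g c - g b) 0) => h1; case: (lerP (g b - g c) 0) => h2; split; lra.
  under eq_bigr do rewrite -mulr_sumr big_split /=.
  rewrite -mulr_sumr big_split /= [X in _ + X]exchange_big /=.
  by move: h; set X := \sum_(b in A) _; lra.
rewrite e1 in e2.
have : 2 * #|A|%:R * (\sum_(b in A) (g b - gbar) ^+ 2) <= 2 * #|A|%:R * (2 * B).
  by apply: le_trans e2 _; rewrite le_eqVlt; apply/orP; left; apply/eqP; ring.
by rewrite ler_pM2l // mulr_gt0.
Qed.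

End Variance.

Section Concentration.
Variables (R : realType) (T : finType) (f : {perm T} -> R) (B : R).
Hypothesis lip : forall P b c, P \in pairings T -> `|f (switch b c P) - f P| <= 2.
Hypothesis up : forall P a, P \in pairings T ->
  \sum_(c | c != a) Num.max (f (switch (P a) c P) - f P) 0 <= B.

Definition mean (X : {set {perm T}}) : R := (\sum_(P in X) f P) / #|X|%:R.

(** Term [j] accounts for exposing a pair when [2 j + 2] points are free: the partner is uniform on
    [2 j + 1] points, the squared deviations sum to at most [2 B], and [expR_le_quadratic] doubles
    this. *)
Definition proxy (k : nat) : R := \sum_(j < k) 4 * B / (2 * j + 1)%:R.

Lemma mean_switch D P0 a b c : stable D P0 -> b \notin D -> c \notin D ->
  b != a -> c != a ->
  mean (fiber D P0 a c) =
  (\sum_(P in fiber D P0 a b) f (switch b c P)) / #|fiber D P0 a b|%:R.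
Proof.
move=> st bD cD ba ca; rewrite /mean (card_fiber_eq st bD cD ba ca).
rewrite (fiber_switch st bD cD ba ca) big_imset //= => P Q _ _.
exact: inv_inj (switchK b c) _ _.
Qed.

(** Given the partner [b] of [a], the conditional mean of [f] is [g b]. Switching couples the
    fibres, so the pointwise bounds [lip] and [up] pass to [g] and [sum_sqr_dev_le] applies. With
    [|l| <= 1 / 4] and deviations at most 2, the exponent stays within the [1 / 2] required by the
    quadratic bound. *)
Lemma mgf_le (l : R) (k : nat) D P0 : 0 <= B -> `|l| <= 1 / 4 ->
  P0 \in pairings T -> stable D P0 -> #|~: D| = k.*2 ->
  \sum_(P in extending D P0) expR (l * f P) <=
  #|extending D P0|%:R * expR (l * mean (extending D P0) + l ^+ 2 * proxy k).
Proof.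
move=> B0 l4; elim: k => [|k IHk] in D P0 *; move=> PP st Dk.
  have DT : D = setT by rewrite -[D]setCK (cards0_eq Dk) setC0.
  have -> : extending D P0 = [set P0].
    apply/setP => P; rewrite inE; apply/extendingP/eqP => [[_ e]|->]; last by split.
    by apply/permP => x; rewrite e // DT inE.
  by rewrite /mean !big_set1 cards1 divr1 mul1r /proxy big_ord0 mulr0 addr0.
have [a] : exists a, a \in ~: D by apply/set0Pn; rewrite -card_gt0 Dk.
rewrite inE => aD.
set J := ~: D :\ a.
have cJ : #|J| = k.*2.+1.
  by move: Dk; rewrite (cardsD1 a) inE aD doubleS => -[].
pose b0 := P0 a.
have b0D : b0 \notin D by apply: (stable_out PP).
have b0a : b0 != a by apply: pairing_neq.
have PE0 : P0 \in extending D P0 by apply/extendingP; split.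
have inJ b : b \in J -> b \notin D /\ b != a by rewrite !inE => /andP[].
pose phi : R := #|fiber D P0 a b0|%:R.
have cphi b : b \in J -> #|fiber D P0 a b|%:R = phi.
  by move=> /inJ[bD ba]; rewrite /phi (card_fiber_eq st b0D bD).
have phi0 : 0 < phi.
  by rewrite ltr0n card_gt0; apply/set0Pn; exists P0; rewrite inE PE0 eqxx.
have cE : #|extending D P0|%:R = #|J|%:R * phi.
  by rewrite (card_extending st aD b0D b0a) natrM (card_rest aD).
pose g b := mean (fiber D P0 a b).
have gE b : b \in J -> \sum_(P in fiber D P0 a b) f P = phi * g b.
  by move=> bJ; rewrite /g /mean cphi // mulrC divfK ?gt_eqF.
have J0 : 0 < #|J|%:R :> R by rewrite ltr0n cJ.
have meanE : mean (extending D P0) = (\sum_(b in J) g b) / #|J|%:R.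
  rewrite /mean (sum_fiber _ st aD) -/J (eq_bigr (fun b => phi * g b)) //.
  by rewrite -mulr_sumr cE; field; rewrite !gt_eqF.
set gbar := mean _ in meanE *.
have gsw b c : b \in J -> c \in J -> g c - g b =
    (\sum_(P in fiber D P0 a b) (f (switch b c P) - f P)) / phi.
  move=> bJ cJ'; have [bD ba] := inJ _ bJ; have [cD ca] := inJ _ cJ'.
  by rewrite sumrB mulrBl /g (mean_switch st bD cD) // /mean cphi.
have fibP b P : P \in fiber D P0 a b -> P \in pairings T.
  by rewrite inE => /andP[/extendingP[]].
have glip : {in J &, forall b c, `|g b - g c| <= 2}.
  move=> b c bJ cJ'; rewrite gsw // normrM [X in _ * X]gtr0_norm ?invr_gt0 //.
  rewrite ler_pdivrMr //; apply: le_trans (ler_norm_sum _ _ _) _.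
  rewrite -(cphi _ cJ') mulr_natr -sumr_const. apply: ler_sum => P /fibP PP'.
  exact: lip.
have gup : {in J, forall b, \sum_(c in J) Num.max (g c - g b) 0 <= B}.
  move=> b bJ; rewrite -(ler_pM2r phi0) mulr_suml.
  apply: (@le_trans _ _ (\sum_(c in J) \sum_(P in fiber D P0 a b)
      Num.max (f (switch b c P) - f P) 0)).
    apply: ler_sum => c cJ'; rewrite -[X in _ * X]gtr0_norm // mulrC.
    rewrite gsw // maxr_pMr ?normr_ge0 // mulr0 gtr0_norm //.
    rewrite mulrC divfK ?gt_eqF // ge_max; apply/andP; split.
      by apply: ler_sum => P _; rewrite le_max lexx.
    by apply: sumr_ge0 => P _; rewrite le_max lexx orbT.
  rewrite exchange_big /= -(cphi _ bJ) mulr_natr -sumr_const.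
  apply: ler_sum => P PF; have PP' := fibP _ _ PF.
  apply: le_trans (up a PP'); rewrite [leRHS]big_mkcond [leLHS]big_mkcond /=.
  move: PF; rewrite inE => /andP[_ /eqP ->].
  apply: ler_sum => c _; case: ifP => [/inJ[_ ->]//|_].
  by case: ifP => // _; rewrite le_max lexx orbT.
have var := sum_sqr_dev_le (_ : (0 < #|J|)%N) glip gup.
have {}var : \sum_(b in J) (g b - gbar) ^+ 2 <= 2 * B.
  by rewrite meanE; apply: var; rewrite cJ.
have step : \sum_(b in J) expR (l * (g b - gbar)) <=
    #|J|%:R * expR (l ^+ 2 * (4 * B / #|J|%:R)).
  apply: (@le_trans _ _ (\sum_(b in J) (1 + l * (g b - gbar) +
      2 * (l * (g b - gbar)) ^+ 2))).
    apply: ler_sum => b bJ; apply: expR_le_quadratic.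
    apply: le_trans (ler_norm _) _; rewrite normrM.
    have gb2 : `|g b - gbar| <= 2.
      have -> : g b - gbar = (\sum_(c in J) (g b - g c)) / #|J|%:R.
        by rewrite sumrB meanE sumr_const -mulr_natl; field; rewrite gt_eqF.
      rewrite normrM [X in _ * X]gtr0_norm ?invr_gt0 // ler_pdivrMr //.
      apply: le_trans (ler_norm_sum _ _ _) _.
      by rewrite mulr_natr -sumr_const; apply: ler_sum => c cJ'; apply: glip.
    have := ler_pM (normr_ge0 _) (normr_ge0 _) l4 gb2; lra.
  apply: (@le_trans _ _ (#|J|%:R * (1 + l ^+ 2 * (4 * B / #|J|%:R)))).
    rewrite !big_split /= sumr_const -mulr_sumr sumrB sumr_const.
    have -> : \sum_(b in J) g b - gbar *+ #|J| = 0.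
      by rewrite -mulr_natl meanE; field; rewrite gt_eqF.
    rewrite mulr0 addr0 -mulr_sumr; under eq_bigr do rewrite exprMn.
    rewrite -mulr_sumr mulrDr mulr1.
    have -> : #|J|%:R * (l ^+ 2 * (4 * B / #|J|%:R)) = 2 * (l ^+ 2 * (2 * B)).
      by field; rewrite gt_eqF.
    by rewrite lerD2l ler_pM2l // ler_wpM2l ?sqr_ge0.
  by rewrite ler_wpM2l ?ler0n // expR_ge1Dx.
rewrite (sum_fiber _ st aD) -/J.
apply: (@le_trans _ _ (\sum_(b in J) phi * expR (l * g b + l ^+ 2 * proxy k))).
  apply: ler_sum => b bJ; have [bD ba] := inJ _ bJ.
  rewrite -(cphi _ bJ) /g.
  have [P PF] : exists P, P \in fiber D P0 a b.
    by apply/set0Pn; rewrite -card_gt0 -(ltr0n R) cphi.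
  rewrite (fiber_ext PF); apply: IHk.
  - exact: fibP PF.
  - exact: fiber_stable PF.
  - move: Dk; rewrite (cardsD1 a) inE aD (cardsD1 b) !inE bD ba doubleS !add1n => -[<-].
    congr #|pred_of_set _|; apply/setP => z.
    by rewrite !inE; case: (z == a); case: (z == b); case: (z \in D).
rewrite cE [#|J|%:R * phi]mulrC -[phi * _ * _]mulrA -mulr_sumr ler_pM2l //.
have eP : proxy k.+1 = proxy k + 4 * B / #|J|%:R.
  by rewrite /proxy big_ord_recr /= cJ mul2n addn1.
rewrite eP; move: (proxy k) => v.
apply: (@le_trans _ _ (expR (l * gbar + l ^+ 2 * v) *
    \sum_(b in J) expR (l * (g b - gbar)))).
  rewrite mulr_sumr le_eqVlt; apply/orP; left; apply/eqP.
  by apply: eq_bigr => b _; rewrite -expRD; congr expR; ring.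
apply: le_trans (ler_wpM2l (expR_ge0 _) step) _.
by rewrite mulrCA -expRD mulrDr addrA.
Qed.

(** The mean is unknown. The bound with [- l] on [A], where [f <= 0], and the bound with [l] on the
    tail contain it with opposite signs, so it cancels in their product. *)
Lemma tail_le (l x : R) (A : {set {perm T}}) (m : nat) : 0 <= B ->
  0 <= l <= 1 / 4 -> #|T| = m.*2 -> A \subset pairings T ->
  {in A, forall P, f P <= 0} ->
  #|[set P in pairings T | x <= f P]|%:R * #|A|%:R <=
  #|pairings T|%:R ^+ 2 * expR (2 * (l ^+ 2 * proxy m) - l * x).
Proof.
move=> B0 /andP[l0 l4] Tm AP fA.
have [e|[P0 PP0]] := set_0Vmem (pairings T).
  rewrite e setIdE set0I cards0 mul0r mulr_ge0 ?exprn_ge0 ?expR_ge0 //.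
have st0 : stable set0 P0 by move=> x'; rewrite inE.
have mgf (l' : R) : `|l'| <= 1 / 4 -> \sum_(P in pairings T) expR (l' * f P) <=
    #|pairings T|%:R * expR (l' * mean (pairings T) + l' ^+ 2 * proxy m).
  move=> l'4; have := mgf_le B0 l'4 PP0 st0; rewrite extending0; apply.
  by rewrite setC0 cardsT.
set mu := mean _ in mgf.
have lA : #|A|%:R <= #|pairings T|%:R * expR (- l * mu + l ^+ 2 * proxy m).
  have := mgf (- l); rewrite normrN ger0_norm // sqrrN => /(_ l4); apply: le_trans.
  rewrite -sumr_const [leRHS](bigID (mem A)) /= -[leLHS]addr0; apply: lerD; last first.
    by apply: sumr_ge0 => P _; apply: expR_ge0.
  rewrite [leRHS](eq_bigl (mem A)); last first.
    by move=> P; rewrite andb_idl //; apply: (subsetP AP).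
  apply: ler_sum => P PA; rewrite -expR0 ler_expR mulNr -mulrN.
  by rewrite mulr_ge0 // oppr_ge0 fA.
have lX : #|[set P in pairings T | x <= f P]|%:R * expR (l * x) <=
    #|pairings T|%:R * expR (l * mu + l ^+ 2 * proxy m).
  have := mgf l; rewrite ger0_norm // => /(_ l4); apply: le_trans.
  rewrite mulr_natl -sumr_const; set X := [set P in _ | _].
  rewrite [leRHS](bigID (mem X)) /= -[leLHS]addr0; apply: lerD; last first.
    by apply: sumr_ge0 => P _; apply: expR_ge0.
  rewrite [leRHS](eq_bigl (mem X)); last first.
    by move=> P; rewrite andb_idl // inE => /andP[].
  by apply: ler_sum => P; rewrite inE => /andP[_ h]; rewrite ler_expR ler_wpM2l.
rewrite -(ler_pM2r (expR_gt0 (l * x))).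
have := ler_pM _ _ lX lA; rewrite !mulr_ge0 ?ler0n ?expR_ge0 // => /(_ isT isT).
rewrite mulrAC => h; apply: le_trans h _.
rewrite le_eqVlt; apply/orP; left; apply/eqP.
rewrite mulrACA -expRD -expr2 -[RHS]mulrA -expRD; congr (_ * expR _); ring.
Qed.

End Concentration.

Local Close Scope ring_scope.

(** * Independent sets in a pairing *)

Local Open Scope ring_scope.

Section CrossPairing.
Variables (R : realType) (T : finType).
Implicit Types (Q D : {set T}) (P : {perm T}).

(* The probability that a uniform pairing of [r] points sends each of [i]
   prescribed points outside these points. *)
Fixpoint cross_ratio (r i : nat) : R :=
  if i is i'.+1 then (r - i)%:R / (r - 1)%:R * cross_ratio (r - 2) i' else 1.

Definition crossing Q : {set {perm T}} :=
  [set P | [forall x in Q, (P : {perm T}) x \notin Q]].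

(** Expose the partner of a point of [Q]: with [r] free points, [i] of them in [Q], there are
    [r - i] good partners among [r - 1]. Afterwards two more points are exposed, only one of them in
    [Q]. *)
Lemma cross_count Q D P0 : P0 \in pairings T -> stable D P0 ->
  #|extending D P0 :&: crossing Q|%:R <=
  cross_ratio #|~: D| #|Q :\: D| * #|extending D P0|%:R.
Proof.
move: {2}#|Q :\: D| (erefl #|Q :\: D|) => i; elim: i => [|i IH] in D P0 *.
  by move=> -> PP st; rewrite /= mul1r ler_nat subset_leq_card // subsetIl.
move=> QD PP st; rewrite QD /=.
have [a] : exists a, a \in Q :\: D by apply/set0Pn; rewrite -card_gt0 QD.
rewrite inE => /andP[aD aQ].
have b0D : P0 a \notin D by apply: (stable_out PP).
have b0a : P0 a != a by apply: pairing_neq.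
have rE : #|~: D| = (#|T| - #|D|)%N by rewrite -(cardsC D) addKn.
have r1 : (0 < #|~: D| - 1)%N.
  rewrite (cardsD1 a) inE aD addKn (cardsD1 (P0 a)) !inE b0D b0a //.
have cE := card_extending st aD b0D b0a.
rewrite -rE in cE.
have sub : extending D P0 :&: crossing Q \subset
    \bigcup_(b in ~: (Q :|: D)) (fiber D P0 a b :&: crossing Q).
  apply/subsetP => P /setIP[PE PX]; apply/bigcupP; exists (P a).
    have /extendingP[PP' _] := PE.
    have aX : P a \notin Q by move: PX; rewrite inE => /forall_inP; apply.
    by rewrite !inE negb_or aX (stable_out PP' (stable_ext st PE) aD).
  by rewrite inE PX andbT inE PE eqxx.
have cb : #|~: (Q :|: D)| = (#|~: D| - i.+1)%N.
  rewrite -QD -[in RHS](cardsID Q (~: D)).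
  have -> : ~: D :&: Q = Q :\: D by apply/setP => x; rewrite !inE andbC.
  rewrite addKn; apply: eq_card => x; rewrite !inE negb_or //.
have fib b : b \in ~: (Q :|: D) -> #|fiber D P0 a b :&: crossing Q|%:R <=
   cross_ratio (#|~: D| - 2) i * #|fiber D P0 a (P0 a)|%:R.
  rewrite !inE negb_or => /andP[bQ bD].
  have ba : b != a by apply: contraNneq bQ => ->.
  rewrite -(card_fiber_eq st b0D bD b0a ba).
  have [->|[P PF]] := set_0Vmem (fiber D P0 a b).
    by rewrite set0I cards0 mulr0.
  have PP' : P \in pairings T by move: PF; rewrite inE => /andP[/extendingP[]].
  rewrite (fiber_ext PF).
  have cD1 : #|~: (a |: (b |: D))| = (#|~: D| - 2)%N.
    have := cardsD1 a (~: D); rewrite (cardsD1 b (~: D :\ a)) !inE aD bD ba => ->.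
    rewrite !add1n subSS subSS subn0; apply: eq_card => x; rewrite !inE.
    by case: (x == a); case: (x == b); case: (x \in D).
  have cQ1 : #|Q :\: (a |: (b |: D))| = i.
    move: QD; rewrite (cardsD1 a) !inE aD aQ add1n => -[<-].
    apply: eq_card => x; rewrite !inE !negb_or.
    have [->|xb] := eqVneq x b; first by rewrite (negPf bQ) !andbF.
    by case: (x == a); case: (x \in D).
  rewrite -cD1 -[X in cross_ratio _ X]cQ1; apply: IH => //.
  exact: fiber_stable PF.
apply: (@le_trans _ _ (\sum_(b in ~: (Q :|: D)) #|fiber D P0 a b :&: crossing Q|%:R)).
  rewrite -natr_sum ler_nat; apply: leq_trans (subset_leq_card sub) _.
  elim/big_rec2: _ => [|b m B _ h]; first by rewrite cards0.
  by apply: leq_trans (leq_card_setU _ _) _; rewrite leq_add2l.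
apply: (le_trans (ler_sum _ fib)); rewrite sumr_const cb cE natrM -mulr_natl.
have r0 : (#|~: D| - 1)%:R != 0 :> R by rewrite pnatr_eq0 -lt0n.
by rewrite le_eqVlt; apply/orP; left; apply/eqP; field.
Qed.

Lemma cross_ratio_ge0 r i : 0 <= cross_ratio r i.
Proof.
by elim: i r => [|i IH] r /=; rewrite ?ler01 // mulr_ge0 // divr_ge0 ?ler0n.
Qed.

(** A factor is at most [1 - (i - 1) / N <= exp (- (i - 1) / N)], and these exponents sum to
    [i (i - 1) / (2 N)]. *)
Lemma cross_ratio_le_expR N r i : (r <= N)%N ->
  cross_ratio r i <= expR (- (i%:R * (i%:R - 1) / (2 * N%:R))).
Proof.
elim: i r => [|i IH] r rN /=; first by rewrite !mul0r oppr0 expR0.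
have [ri|ri] := leqP r i.+1.
  have -> : (r - i.+1 = 0)%N by apply/eqP; rewrite subn_eq0.
  by rewrite !mul0r expR_ge0.
have N0 : 0 < N%:R :> R by rewrite ltr0n; apply: leq_trans rN; apply: leq_trans ri.
have r1 : 0 < (r - 1)%:R :> R by rewrite ltr0n; move: ri; clear; lia.
have -> : - (i.+1%:R * (i.+1%:R - 1) / (2 * N%:R)) =
   - (i%:R / N%:R) + - (i%:R * (i%:R - 1) / (2 * N%:R)) :> R.
  by rewrite -natr1; field; rewrite gt_eqF.
rewrite expRD; apply: ler_pM; rewrite ?divr_ge0 ?ler0n ?cross_ratio_ge0 //.
  apply: le_trans (expR_ge1Dx _).
  have -> : (r - i.+1)%:R = (r - 1)%:R - i%:R :> R.
    by rewrite !natrB ?(ltnW ri) //; [rewrite -natr1; ring|apply: leq_trans ri].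
  rewrite mulrBl divff ?gt_eqF // lerD2l lerN2 ler_wpM2l ?ler0n //.
  rewrite lef_pV2 ?posrE // ler_nat; apply: leq_trans rN; exact: leq_subr.
by apply: IH; apply: leq_trans rN; exact: leq_subr.
Qed.

(** With [r <= 2 i] a factor is at most [i / (2 i - 1)], hence [5 / 9] from [i = 5] on; the last
    four factors are only bounded by 1, whence [(9 / 5) ^ 4]. The base satisfies
    [4 * (5 / 9) ^ 3 < 1], which [bipartite_le] exploits. *)
Lemma cross_ratio_half r i : (r <= 2 * i)%N ->
  cross_ratio r i <= (9 / 5) ^+ 4 * (5 / 9) ^+ i.
Proof.
have step r' i' : (r' <= 2 * i'.+1)%N ->
    (r' - i'.+1)%:R / (r' - 1)%:R <= (if (4 <= i')%N then 5 / 9 else 1) :> R.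
  move=> h; have [r1|r1] := leqP (r' - 1) 0.
    have -> : (r' - 1 = 0)%N by apply/eqP; rewrite -leqn0.
    by rewrite invr0 mulr0; case: ifP => _ //; lra.
  rewrite ler_pdivrMr ?ltr0n //; case: ifP => i4.
    rewrite mulrAC ler_pdivlMr // -!natrM ler_nat; move: r1 h i4; clear; lia.
  by rewrite mul1r ler_nat; move: r1; clear; lia.
elim: i r => [|i IH] r h /=; first by rewrite expr0 mulr1; lra.
have {}IH := IH (r - 2)%N _.
have {}IH : cross_ratio (r - 2) i <= (9 / 5) ^+ 4 * (5 / 9) ^+ i.
  by apply: IH; move: h; clear; lia.
have s := step r i h.
have g0 := cross_ratio_ge0 (r - 2) i.
have s0 : 0 <= (r - i.+1)%:R / (r - 1)%:R :> R by rewrite divr_ge0 ?ler0n.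
move: s; case: ifP => i4 s.
  by have := ler_pM s0 g0 s IH; rewrite mulrCA -exprS.
have small j r' : (j <= 4)%N -> (r' <= 2 * j)%N -> cross_ratio r' j <= 1.
  clear - step; elim: j r' => [|j IHj] r' j4 hr /=; first by [].
  have := step r' j hr; rewrite ifF; last by move: j4; clear; lia.
  move=> s; have := ler_pM _ (cross_ratio_ge0 _ j) s (IHj (r' - 2)%N _ _).
  rewrite divr_ge0 ?ler0n // mulr1; apply => //; first exact: ltnW.
  by move: hr; clear; lia.
have i4' : (i < 4)%N by rewrite ltnNge i4.
have := small i.+1 r i4' h; rewrite /= => /le_trans; apply.
by case: i i4' {IH h g0 s0 s i4} => [|[|[|[|i]]]] // _; rewrite !exprS !expr0; lra.
Qed.

End CrossPairing.

Section Independent.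
Variables (R : realType) (n d : nat).
Local Notation point := ('I_n * 'I_d)%type.

Definition over (S : {set 'I_n}) : {set point} := [set p | p.1 \in S].

Lemma card_over S : #|over S| = (#|S| * d)%N.
Proof.
have -> : over S = setX S setT by apply/setP => -[x y]; rewrite !inE andbT.
by rewrite cardsX cardsT card_ord.
Qed.

Lemma indep_count (F : {set {set 'I_n}}) (c : R) :
  {in F, forall S : {set 'I_n}, cross_ratio R (n * d) (#|S| * d) <= c} ->
  #|[set P in pairings point | [exists S in F, P \in crossing (over S)]]|%:R <=
  #|F|%:R * c * #|pairings point|%:R :> R.
Proof.
move=> hF.
apply: (@le_trans _ _ (\sum_(S in F) #|pairings point :&: crossing (over S)|%:R)).
  rewrite -natr_sum ler_nat.
  apply: (@leq_trans #|\bigcup_(S in F) (pairings point :&: crossing (over S))|).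
    apply/subset_leq_card/subsetP => P; rewrite in_set => /andP[PP /exists_inP[S SF PS]].
    by apply/bigcupP; exists S => //; rewrite in_setI PP.
  elim/big_rec2: _ => [|b m B _ h]; first by rewrite cards0.
  by apply: leq_trans (leq_card_setU _ _) _; rewrite leq_add2l.
rewrite -mulrA mulr_natl -sumr_const; apply: ler_sum => S SF.
have [->|[P0 PP]] := set_0Vmem (pairings point).
  by rewrite set0I cards0 mulr0.
have st0 : stable set0 P0 by move=> x; rewrite inE.
have := cross_count R (over S) PP st0.
rewrite extending0 setC0 cardsT card_prod !card_ord setD0 card_over => /le_trans.
by apply; rewrite ler_wpM2r ?ler0n // hF.
Qed.

End Independent.

Local Close Scope ring_scope.

(** * Deleting vertices to colour a pairing *)

Local Open Scope ring_scope.

(** The step uses [1 / (2 m + 3) <= 1 / (m + 2) <= ln ((m + 2) / (m + 1))]; the convention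
    [ln 0 = 0] covers the empty sum. *)
Lemma harmonic_le (R : realType) (m : nat) :
  \sum_(j < m) 1 / (2 * j + 1)%:R <= 1 + ln (m%:R : R).
Proof.
elim: m => [|[|m] IH]; first by rewrite big_ord0 ln0 // addr0.
  by rewrite big_ord_recl big_ord0 ln1 !addr0 /= divr1.
rewrite big_ord_recr /=.
have m0 : 0 < m.+1%:R :> R by rewrite ltr0n.
have m1 : 0 < m.+2%:R :> R by rewrite ltr0n.
have h : 1 / (2 * m.+1 + 1)%:R <= 1 / m.+2%:R :> R.
  rewrite !div1r lef_pV2 ?posrE ?ltr0n ?addn1 // ler_nat; lia.
have h2 : ln (m.+1%:R / m.+2%:R : R) <= - (1 / m.+2%:R).
  rewrite -[X in ln X](_ : 1 + - (1 / m.+2%:R) = _); last first.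
    have e : m.+2%:R = m.+1%:R + 1 :> R by rewrite natr1.
    by rewrite -{1}(divff (lt0r_neq0 m1)) -mulrBl {1}e addrK.
  apply: le_ln1Dx; rewrite ltrN2 ltr_pdivrMr // mul1r ltr1n //.
rewrite lnM ?posrE ?invr_gt0 // lnV ?posrE // in h2.
apply: le_trans (lerD IH h) _; rewrite -addrA lerD2l -lerBrDl -lerN2 opprB; exact: h2.
Qed.

Section Deletion.
Variables (n d t b : nat).
Local Notation point := ('I_n * 'I_d)%type.
Implicit Types (P : {perm point}) (U : {set 'I_n}) (col : {ffun 'I_n -> 'I_t.+1}).

(* Colour classes are required to be small so that a random switch rarely
   creates a monochromatic pair. *)
Definition good_coloring P U col : bool :=
  [forall a, (a.1 \notin U) ==> ((P a).1 \notin U) ==> (col a.1 != col (P a).1)]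
  && [forall i, #|[set v | (v \notin U) && (col v == i)]| <= b]%N.

Definition deletion_set P : {set 'I_n} :=
  [arg min_(U < setT | [exists col, good_coloring P U col]) #|U|].

Lemma good_coloringT P col : good_coloring P setT col.
Proof.
apply/andP; split; first by apply/forallP => a; rewrite inE.
apply/forallP => i; have -> : [set v | (v \notin setT) && (col v == i)] = set0; last by rewrite cards0.
by apply/setP => v; rewrite !inE.
Qed.

Lemma deletion_setP P : exists2 col, good_coloring P (deletion_set P) col &
  forall U col', good_coloring P U col' -> (#|deletion_set P| <= #|U|)%N.
Proof.
rewrite /deletion_set; case: arg_minnP => [|U /existsP[col Ucol] Umin].
  (* A constant colouring exists because colours range over ['I_t.+1]. *)
  by apply/existsP; exists [ffun=> ord0]; apply: good_coloringT.
exists col => // U' col' h; apply: Umin; apply/existsP; by exists col'.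
Qed.

(** Every pair created by the switch contains [x] or [y], so deleting their two vertices as well
    keeps the old colouring valid. *)
Lemma deletion_switch_le P x y : P \in pairings point ->
  (#|deletion_set (switch x y P)| <= #|deletion_set P| + 2)%N.
Proof.
move=> PP; have [col /andP[/forallP h1 /forallP h2] _] := deletion_setP P.
set U := deletion_set P in h1 h2 *.
have [_ _ /(_ (U :|: [set x.1; y.1]) col) min] := deletion_setP (switch x y P).
apply: leq_trans (min _) _; last first.
  apply: leq_trans (leq_card_setU _ _) _; rewrite leq_add2l cards2.
  by case: eqP.
apply/andP; split.
  apply/forallP => a; apply/implyP; rewrite !inE !negb_or => /and3P[aU ax ay].
  apply/implyP => /and3P[QU Qx Qy].
  have xa : x != a by apply: contraNneq ax => ->.
  have ya : y != a by apply: contraNneq ay => ->.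
  have Qa : P a = switch x y P a.
    have := switchE x y P a; rewrite (tpermD xa ya) => e.
    rewrite e tpermD //.
    - by apply: contraNneq Qy => xP; rewrite e -xP tpermL.
    - by apply: contraNneq Qx => yP; rewrite e -yP tpermR.
  have := h1 a; rewrite aU Qa QU //.
apply/forallP => i; apply: leq_trans (h2 i).
apply/subset_leq_card/subsetP => v; rewrite !inE negb_or => /andP[/andP[-> _] ->] //.
Qed.

Lemma card_color_points U col i :
  (#|[set v | (v \notin U) && (col v == i)]| <= b)%N ->
  (#|[set p : point | (p.1 \notin U) && (col p.1 == i)]| <= b * d)%N.
Proof.
move=> h; have -> : [set p : point | (p.1 \notin U) && (col p.1 == i)] =
    setX [set v | (v \notin U) && (col v == i)] setT.
  by apply/setP => -[v j]; rewrite !inE andbT.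
by rewrite cardsX cardsT card_ord leq_mul2r h orbT.
Qed.

Variable R : realType.

(** The switch creates the pairs [a c] and [(P a) (P c)]. The old colouring survives unless [c]
    shares the colour of [a] or [P c] that of [P a]: at most [2 b d] choices of [c], each worth at
    most 2. *)
Lemma deletion_switch_sum P a : P \in pairings point ->
  \sum_(c | c != a) Num.max (#|deletion_set (switch (P a) c P)|%:R -
    #|deletion_set P|%:R) 0 <= (4 * b * d)%:R :> R.
Proof.
move=> PP; have [col /andP[/forallP h1 /forallP h2] _] := deletion_setP P.
set U := deletion_set P in h1 h2 *.
pose Z1 := [set p : point | (p.1 \notin U) && (col p.1 == col a.1)].
pose Z2 := [set p : point | (p.1 \notin U) && (col p.1 == col (P a).1)].
pose Z := Z1 :|: P @^-1: Z2.
have cZ : (#|Z| <= b * d + b * d)%N.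
  apply: leq_trans (leq_card_setU _ _) _; apply: leq_add.
    exact: card_color_points.
  rewrite on_card_preimset; last by exists P => // x _; rewrite pairingK.
  exact: card_color_points.
have hZ c : c != a -> c \notin Z ->
    (#|deletion_set (switch (P a) c P)| <= #|U|)%N.
  move=> ca; rewrite !inE negb_or => /andP[cZ1 cZ2].
  have [_ _ /(_ U col)] := deletion_setP (switch (P a) c P); apply.
  apply/andP; split; last exact/forallP.
  have [->|cb] := eqVneq c (P a).
    by rewrite /switch tperm1 conjg1; apply/forallP.
  set Q := switch _ _ _.
  have QP : Q \in pairings point by apply: switch_pairing.
  have Qa : Q a = c by apply: switch_to.
  have Qb : Q (P a) = P c.
    rewrite /Q switchE tpermL tpermD //.
    - by rewrite (inj_eq perm_inj) eq_sym.
    - by rewrite eq_sym pairing_neq.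
  apply/forallP => x; apply/implyP => xU; apply/implyP => QxU.
  have [xa|xa] := eqVneq x a.
    move: QxU; rewrite xa Qa => cU; move: cZ1; rewrite cU /= eq_sym //.
  have [xc|xc] := eqVneq x c.
    by move: cZ1; rewrite -xc xU /= xc -[X in col X.1 != col (Q X).1]Qa pairingK // Qa.
  have [xb|xb] := eqVneq x (P a).
    by move: QxU; rewrite xb Qb => cU; move: cZ2; rewrite cU /= eq_sym.
  have [xe|xe] := eqVneq x (P c).
    by move: cZ2; rewrite -xe xU /= xe -Qb pairingK // Qb.
  have Qx : Q x = P x.
    rewrite /Q switch_out // 1?eq_sym //.
    - by rewrite (inj_eq perm_inj).
    - by apply: contraNneq xe => <-; rewrite pairingK.
  by have := h1 x; rewrite -Qx xU QxU.
apply: (@le_trans _ _ (\sum_(c in Z) 2)); last first.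
  rewrite sumr_const -[2 *+ #|Z|]mulr_natr -natrM ler_nat.
  by move: cZ; rewrite addnn -mul2n => /(leq_mul (leqnn 2)); rewrite !mulnA.
rewrite big_mkcond [leRHS]big_mkcond /=; apply: ler_sum => c _.
case: ifP => ca; last by case: ifP.
case: ifPn => cZ'.
  rewrite ge_max ler0n andbT lerBlDl -natrD ler_nat.
  exact: deletion_switch_le.
by rewrite ge_max lexx andbT subr_le0 ler_nat hZ.
Qed.

(** This is [tail_le] with [B = 4 b d], the reference set being the pairings that need no
    deletion. *)
Lemma deletion_tail (l x : R) (m : nat) : (0 < m)%N -> (n * d = m.*2)%N ->
  0 <= l <= 1 / 4 ->
  #|[set P in pairings point | x <= #|deletion_set P|%:R]|%:R *
  #|[set P in pairings point | [exists col, good_coloring P set0 col]]|%:R <=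
  #|pairings point|%:R ^+ 2 *
    expR (2 * (l ^+ 2 * (16 * (b * d)%:R * (1 + ln m%:R))) - l * x).
Proof.
move=> m0 nd l4.
pose f P : R := #|deletion_set P|%:R.
have lip P y z : P \in pairings point -> `|f (switch y z P) - f P| <= 2.
  move=> PP; rewrite ler_norml; apply/andP; split.
    rewrite lerBrDl lerBlDr -natrD ler_nat -{1}(switchK y z P) addnC addnC.
    by apply: deletion_switch_le; apply: switch_pairing.
  by rewrite lerBlDl -natrD ler_nat deletion_switch_le.
have up P a : P \in pairings point ->
    \sum_(c | c != a) Num.max (f (switch (P a) c P) - f P) 0 <= (4 * b * d)%:R.
  exact: deletion_switch_sum.
set A := [set P in pairings point | [exists col, _]].
have fA : {in A, forall P, f P <= 0}.
  move=> P; rewrite in_set => /andP[_ /existsP[col]] h.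
  have [_ _ /(_ set0 col h)] := deletion_setP P.
  by rewrite cards0 /f lern0 leqn0.
have AP : A \subset pairings point.
  by apply/subsetP => P; rewrite in_set => /andP[].
have cT : #|{: point}| = m.*2 by rewrite card_prod !card_ord.
have := tail_le lip up x (ler0n _ _) l4 cT AP fA; move/le_trans; apply.
rewrite ler_wpM2l ?exprn_ge0 // ler_expR lerD2r ler_wpM2l //.
rewrite ler_wpM2l ?sqr_ge0 // /proxy.
have -> : \sum_(j < m) 4 * (4 * b * d)%:R / (2 * j + 1)%:R =
    16 * (b * d)%:R * \sum_(j < m) 1 / (2 * j + 1)%:R :> R.
  rewrite mulr_sumr; apply: eq_bigr => j _; rewrite !natrM.
  have : (2 * j + 1)%:R != 0 :> R by rewrite pnatr_eq0 addn1.
  by move: (2 * j + 1)%:R => u u0; field.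
by rewrite ler_wpM2l ?mulr_ge0 ?ler0n // harmonic_le.
Qed.

End Deletion.

Local Close Scope ring_scope.

(** * Sparsity of small vertex sets *)

Lemma card_bigcup_le (I T : finType) (A : pred I) (F : I -> {set T}) :
  (#|\bigcup_(i | A i) F i| <= \sum_(i | A i) #|F i|)%N.
Proof.
elim/big_rec2: _ => [|i m B _ h]; first by rewrite cards0.
by apply: leq_trans (leq_card_setU _ _) _; rewrite leq_add2l.
Qed.

Lemma subset_of_card (T : finType) (B : {set T}) k : (k <= #|B|)%N ->
  exists2 A : {set T}, A \subset B & #|A| = k.
Proof.
move=> kB; have : (0 < #|[set A : {set T} | A \subset B & #|A| == k]|)%N.
  by rewrite cards_draws bin_gt0.
by rewrite card_gt0 => /set0Pn[A]; rewrite inE => /andP[AB /eqP Ak]; exists A.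
Qed.

Definition inner_edges (T : finType) (G : sgraph T) (W : {set T}) : {set {set T}} :=
  [set e in edges G | e \subset W].

Local Open Scope ring_scope.

Lemma expR1_le4 (R : realType) : expR 1 <= 4 :> R.
Proof.
have := @expR_ge1Dx R (- (1 / 2)); rewrite expRN => h.
have e0 : 0 < expR (1 / 2 : R) by apply: expR_gt0.
have e2 : expR (1 / 2) <= 2 :> R.
  by move: h; rewrite -(ler_pM2r e0) mulVf ?gt_eqF //; lra.
have -> : 1 = 1 / 2 + 1 / 2 :> R by field.
rewrite expRD; have := ler_pM (ltW e0) (ltW e0) e2 e2; lra.
Qed.

(** Weak Stirling bound with 4 in place of [e]; the induction rests on [(1 + 1 / k) ^ k <= e]. *)
Lemma expn_le_fact (R : realType) (k : nat) : (k%:R / 4) ^+ k <= k`!%:R :> R.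
Proof.
elim: k => [|k IH]; first by rewrite expr0 ler1n fact_gt0.
have [->|k0] := posnP k; first by rewrite expr1 factS fact0 muln1; lra.
have kR : 0 < k%:R :> R by rewrite ltr0n.
have e4 : (1 + 1 / k%:R) ^+ k <= 4 :> R.
  apply: le_trans (expR1_le4 R).
  have -> : 1 = k%:R * (1 / k%:R) :> R by field; rewrite gt_eqF.
  rewrite expRM_natl; apply: lerXn2r; rewrite ?nnegrE ?expR_ge0 //.
    by rewrite mulrA mulr1 divff ?gt_eqF // addr_ge0 ?divr_ge0 ?ler0n.
  have -> : k%:R * (1 / k%:R) = 1 :> R by field; rewrite gt_eqF.
  exact: expR_ge1Dx.
rewrite factS natrM exprS.
have -> : (k.+1%:R / 4) ^+ k = (1 + 1 / k%:R) ^+ k * (k%:R / 4) ^+ k :> R.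
  by rewrite -exprMn; congr (_ ^+ k); rewrite -natr1; field; rewrite gt_eqF.
have A0 : 0 <= (1 + 1 / k%:R) ^+ k :> R by rewrite exprn_ge0 // addr_ge0 ?divr_ge0.
have B0 : 0 <= (k%:R / 4) ^+ k :> R by rewrite exprn_ge0 ?divr_ge0.
move: A0 B0 e4 IH; move: (_ ^+ k) ((k%:R / 4) ^+ k) => A B A0 B0 A4 IH.
have -> : k.+1%:R / 4 * (A * B) = k.+1%:R * (A / 4 * B) by ring.
have A1 : A / 4 <= 1 by lra.
rewrite ler_pM2l ?ltr0n // -[leRHS]mul1r; apply: ler_pM => //.
by rewrite divr_ge0.
Qed.

Lemma bin_fact_le (m k : nat) : ('C(m, k) * k`! <= m ^ k)%N.
Proof.
rewrite bin_ffact; elim: k m => [|k IH] m; first by rewrite ffactn0.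
rewrite ffactnS expnS leq_mul2l; apply/orP; right.
apply: leq_trans (IH _) _.
by case: k {IH} => [|k]; rewrite ?expn0 // leq_exp2r // leq_pred.
Qed.

Lemma bin_le_exp (R : realType) (m k : nat) : (0 < k)%N ->
  'C(m, k)%:R <= (4 * m%:R / k%:R) ^+ k :> R.
Proof.
move=> k0; have kR : 0 < k%:R :> R by rewrite ltr0n.
have h := bin_fact_le m k.
move: h; rewrite -(ler_nat R) natrM natrX => h.
have k4 : 0 < (k%:R / 4) ^+ k :> R by rewrite exprn_gt0 // divr_gt0.
rewrite -(ler_pM2r k4); apply: le_trans (ler_wpM2l (ler0n _ _) (expn_le_fact R k)) _.
apply: le_trans h _; rewrite -exprMn le_eqVlt; apply/orP; left; apply/eqP.
by congr (_ ^+ k); field; rewrite gt_eqF.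
Qed.

Section Sparsity.
Variables (R : realType) (V : finType) (X : {set sgraph V}) (q : R) (M : nat).
Hypothesis q_ge0 : 0 <= q.
Hypothesis edge_prob : forall E : {set {set V}},
  {in E, forall e : {set V}, #|e| = 2%N} -> (#|E| <= M)%N ->
  #|[set G in X | E \subset edges G]|%:R <= q ^+ #|E| * #|X|%:R.

Lemma dense_one (s k : nat) : (k <= M)%N ->
  #|[set G in X | [exists W : {set V}, (#|W| == s) && (k <= #|inner_edges G W|)%N]]|%:R
  <= 'C(#|V|, s)%:R * 'C('C(s, 2), k)%:R * q ^+ k * #|X|%:R.
Proof.
move=> kM.
pose pairs (W : {set V}) := [set e : {set V} | e \subset W & #|e| == 2%N].
pose F (W : {set V}) := [set E : {set {set V}} | E \subset pairs W & #|E| == k].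
pose Y (E : {set {set V}}) := [set G in X | E \subset edges G].
have sub : [set G in X | [exists W : {set V}, (#|W| == s) &&
     (k <= #|inner_edges G W|)%N]] \subset
   \bigcup_(W in [set W : {set V} | #|W| == s]) \bigcup_(E in F W) Y E.
  apply/subsetP => G; rewrite inE => /andP[GX /existsP[W /andP[Ws kW]]].
  have [E EW Ek] := subset_of_card kW.
  apply/bigcupP; exists W; first by rewrite inE.
  apply/bigcupP; exists E.
    rewrite inE Ek eqxx andbT; apply/subsetP => e /(subsetP EW).
    rewrite !inE => /andP[eG ->]; exact: (forall_inP (edges_card2 G)).
  rewrite inE GX; apply/subsetP => e /(subsetP EW); by rewrite inE => /andP[].
have := subset_leq_card sub; rewrite -(ler_nat R) => /le_trans; apply.
apply: (@le_trans _ _ (\sum_(W in [set W : {set V} | #|W| == s])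
    'C('C(s, 2), k)%:R * (q ^+ k * #|X|%:R))).
  have := card_bigcup_le (mem [set W : {set V} | #|W| == s])
    (fun W => \bigcup_(E in F W) Y E).
  rewrite -(ler_nat R) => /le_trans; apply; rewrite natr_sum.
  apply: ler_sum => W; rewrite !inE => /eqP Ws.
  have := card_bigcup_le (mem (F W)) Y; rewrite -(ler_nat R) => /le_trans; apply.
  have <- : #|F W| = 'C('C(s, 2), k).
    by rewrite cards_draws; congr 'C(_, _); rewrite cards_draws Ws.
  rewrite natr_sum [leRHS]mulr_natl -sumr_const; apply: ler_sum => E.
  rewrite !inE => /andP[EW /eqP Ek]; rewrite -Ek; apply: edge_prob; last by rewrite Ek.
  by move=> e /(subsetP EW); rewrite inE => /andP[_ /eqP].
by rewrite sumr_const card_draws -[leLHS]mulr_natl !mulrA.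
Qed.

(** The choice of the edges costs at most [(2 s ^ 2 / k) ^ k], and [k >= s] turns this into
    [(2 s) ^ k]. *)
Lemma dense_bound (s k : nat) : (0 < s)%N -> (s <= k)%N -> (k <= M)%N ->
  #|[set G in X | [exists W : {set V}, (#|W| == s) && (k <= #|inner_edges G W|)%N]]|%:R
  <= (4 * #|V|%:R / s%:R) ^+ s * (2 * s%:R * q) ^+ k * #|X|%:R.
Proof.
move=> s0 sk kM; apply: le_trans (dense_one s kM) _.
rewrite ler_wpM2r ?ler0n // -mulrA; apply: ler_pM; rewrite ?ler0n //.
- by rewrite mulr_ge0 ?exprn_ge0.
- exact: bin_le_exp.
rewrite exprMn ler_wpM2r ?exprn_ge0 //.
have k0 : (0 < k)%N by apply: leq_trans sk.
apply: le_trans (bin_le_exp R _ k0) _; apply: lerXn2r.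
- by rewrite nnegrE divr_ge0 ?mulr_ge0 ?ler0n.
- by rewrite nnegrE mulr_ge0 ?ler0n.
rewrite ler_pdivrMr ?ltr0n //.
have h1 : (2 * 'C(s, 2) <= s * s)%N by rewrite bin2 mul2n halfK; nia.
have h2 : (s * s <= s * k)%N by rewrite leq_mul2l sk orbT.
have : (4 * 'C(s, 2) <= 2 * (s * k))%N by move: h1 h2; clear; lia.
by rewrite -(ler_nat R) !natrM mulrA.
Qed.

Lemma sparse_bound (s0 : nat) (k : nat -> nat) (y : R) : 0 <= y <= 1 / 2 ->
  (forall s, (0 < s <= s0)%N -> (s <= k s <= M)%N) ->
  (forall s, (0 < s <= s0)%N ->
     (4 * #|V|%:R / s%:R) ^+ s * (2 * s%:R * q) ^+ k s <= y ^+ s) ->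
  #|[set G in X | [exists W : {set V}, [&& (0 < #|W|)%N, (#|W| <= s0)%N &
     (k #|W| <= #|inner_edges G W|)%N]]]|%:R <= 2 * y * #|X|%:R.
Proof.
move=> /andP[y0 y2] hk hy.
pose Z s := [set G in X | [exists W : {set V}, (#|W| == s) &&
   (k s <= #|inner_edges G W|)%N]].
have sub : [set G in X | [exists W : {set V}, [&& (0 < #|W|)%N, (#|W| <= s0)%N &
     (k #|W| <= #|inner_edges G W|)%N]]] \subset \bigcup_(i < s0) Z i.+1.
  apply/subsetP => G; rewrite inE => /andP[GX /existsP[W /and3P[W0 Ws kW]]].
  case e : #|W| W0 Ws => [//|w] _ ws; apply/bigcupP; exists (Ordinal ws) => //.
  by rewrite inE GX; apply/existsP; exists W; rewrite e eqxx -e.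
have := subset_leq_card sub; rewrite -(ler_nat R) => /le_trans; apply.
have := card_bigcup_le xpredT (fun i : 'I_s0 => Z i.+1).
rewrite -(ler_nat R) => /le_trans; apply; rewrite natr_sum.
apply: (@le_trans _ _ (\sum_(i < s0) y ^+ i.+1 * #|X|%:R)).
  apply: ler_sum => i _; have si : (0 < i.+1 <= s0)%N by rewrite /= ltn_ord.
  have /andP[sk kM] := hk _ si.
  apply: le_trans (dense_bound _ sk kM) _ => //.
  by rewrite ler_wpM2r ?ler0n // hy.
rewrite -mulr_suml ler_wpM2r ?ler0n //.
elim: s0 {hk hy Z sub} => [|m IH]; first by rewrite big_ord0 mulr_ge0.
rewrite big_ord_recl /= expr1 (eq_bigr (fun i : 'I_m => y * y ^+ i.+1)).
  rewrite -mulr_sumr; have := ler_wpM2l y0 IH; have := ler_wpM2l y0 y2; lra.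
by move=> i _; rewrite -exprS.
Qed.

End Sparsity.

Local Close Scope ring_scope.

(** * Sparse graphs: one extra colour *)

Section Coloring.
Variables (V : finType) (G : sgraph V).
Implicit Types (U W : {set V}).

Definition nbrs_in W x : {set V} := [set y in W | adj G x y].

Lemma handshake_le W : \sum_(x in W) #|nbrs_in W x| <= 2 * #|inner_edges G W|.
Proof.
pose A := [set p : V * V | [&& p.1 \in W, p.2 \in W & adj G p.1 p.2]].
have -> : \sum_(x in W) #|nbrs_in W x| = #|A|.
  rewrite -sum1_card (partition_big fst (mem W)) /=.
    apply: eq_bigr => x xW; rewrite sum1dep_card.
    have inj : injective (pair x : V -> V * V) by move=> y z [].
    rewrite -(card_imset _ inj); apply: eq_card => -[y z].
    rewrite !inE /=; apply/imsetP/idP => [[w + [-> ->]]|/andP[/and3P[_ zW yz] /eqP yx]].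
      by rewrite inE => /andP[wW xw]; rewrite xW wW xw eqxx.
    by rewrite -yx; exists z; rewrite // inE zW yz.
  by move=> [x y]; rewrite inE => /and3P[].
rewrite -sum1_card (partition_big (fun p : V * V => [set p.1; p.2])
  (mem (inner_edges G W))) /=; last first.
  move=> [x y]; rewrite !inE /= => /and3P[xW yW xy].
  by apply/andP; split=> //; apply/subsetP => z; rewrite !inE => /orP[] /eqP ->.
rewrite mulnC -sum_nat_const; apply: leq_sum => e; rewrite inE => /andP[eG _].
have /eqP e2 := forall_inP (edges_card2 G) _ eG.
rewrite sum1dep_card -e2.
set B := [set p | _]; rewrite -(card_in_imset (f := fst) (D := B)).
  apply: subset_leq_card; apply/subsetP => _ /imsetP[[x y] + ->].
  by rewrite !inE => /andP[_ /eqP <-]; rewrite !inE eqxx.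
move=> [x y] [x' z]; rewrite !inE /=.
move=> /andP[/and3P[_ _ xy] /eqP exy] /andP[/and3P[_ _ xz] /eqP exz] xx'.
rewrite -xx' in xz exz *; congr (_, _); apply/eqP.
have : y \in [set x; z] by rewrite exz -exy !inE eqxx orbT.
by rewrite !inE => /orP[/eqP yx|//]; rewrite yx adj_irrefl in xy.
Qed.

Lemma degenerate_coloring (h : nat) U :
  (forall W, W \subset U -> W != set0 -> exists2 x, x \in W & #|nbrs_in W x| <= h) ->
  exists c : {ffun V -> 'I_h.+1}, {in U &, forall x y, adj G x y -> c x != c y}.
Proof.
have [k] := ubnP #|U|; elim: k => // k IH in U * => Uk hU.
have [->|U0] := eqVneq U set0.
  by exists [ffun=> ord0] => x y; rewrite inE.
have [x xU xh] := hU U (subxx _) U0.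
have [|W WU W0|c cP] := IH (U :\ x).
- by move: Uk; rewrite (cardsD1 x) xU add1n ltnS.
- by apply: hU => //; apply: subset_trans WU (subsetDl _ _).
have [i ic] : exists i, i \notin c @: nbrs_in U x.
  have : (#|c @: nbrs_in U x| < #|'I_h.+1|).
    by rewrite card_ord ltnS (leq_trans (leq_imset_card _ _)).
  rewrite ltnNge => hi; apply/existsP; apply: contraNT hi.
  rewrite negb_exists => /forallP hi; apply/subset_leq_card/subsetP => i _.
  by have := hi i; rewrite negbK.
have ix y : y \in U -> adj G x y -> i != c y.
  move=> yU xy; apply: contraNneq ic => ->; apply/imsetP; exists y => //.
  by rewrite inE yU.
exists [ffun y => if y == x then i else c y] => y z yU zU yz; rewrite !ffunE.
have [yx|yx] := eqVneq y x; have [zx|zx] := eqVneq z x.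
- by rewrite yx zx adj_irrefl in yz.
- by apply: ix; rewrite // -yx.
- by rewrite eq_sym; apply: ix; rewrite // adjC -zx.
- by apply: cP; rewrite ?inE ?yx ?zx.
Qed.

Lemma sparse_coloring (h : nat) U :
  (forall W, W \subset U -> W != set0 -> 2 * #|inner_edges G W| < h.+1 * #|W|) ->
  exists c : {ffun V -> 'I_h.+1}, {in U &, forall x y, adj G x y -> c x != c y}.
Proof.
move=> hU; apply: degenerate_coloring => W WU W0.
apply/exists_inP; apply: contraLR (hU W WU W0); rewrite negb_exists_in => /forall_inP hW.
rewrite -leqNgt; apply: leq_trans (handshake_le W).
by rewrite mulnC -sum_nat_const; apply: leq_sum => x /hW; rewrite -ltnNge.
Qed.

Lemma colorableP k : (exists c : V -> 'I_k, forall x y, adj G x y -> c x != c y) ->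
  colorable G k.
Proof.
move=> [c cP]; apply/existsP; exists [ffun x => c x]; apply/forallP => x.
by apply/forallP => y; apply/implyP => xy; rewrite !ffunE cP.
Qed.

Definition proper_outside t U (c : V -> 'I_t) :=
  forall x y, x \notin U -> y \notin U -> adj G x y -> c x != c y.

(** [adm] is the invariant of adding adjacent outside pairs: three edges per two vertices give
    [3 (|U| - s) <= 2 e(U)]. Sparsity gives [e(U) < (4 / 3) |U|], and together [|U| < 9 s]. The
    margin of 2 in [adm] leaves room for one more pair, which maximality of [U] excludes. Sparsity
    also keeps average degrees inside [U] below [8 / 3], whence three colours. *)
Lemma extension_sparse t U0 (c : V -> 'I_t) : 3 <= t -> proper_outside U0 c ->
  (forall W, 0 < #|W| <= 9 * #|U0| + 2 -> 3 * #|inner_edges G W| < 4 * #|W|) ->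
  colorable G t.+1.
Proof.
move=> t3 cP sp; set s := #|U0| in sp.
pose adm U := [&& U0 \subset U, 3 * (#|U| - s) <= 2 * #|inner_edges G U| &
  #|U| <= 9 * s + 2].
have adm0 : adm U0 by rewrite /adm subxx subnn muln0 /= /s; lia.
case: (arg_maxnP (fun U => #|U|) adm0) => U /and3P[U0U eU Us] Umax.
have Us9 : #|U| <= 9 * s.
  have [->//|U_gt0] := posnP #|U|.
  have := sp U; rewrite U_gt0 Us => /(_ isT); move: eU; clear; lia.
have indep u v u' v' : u' \in U -> v' \in U -> u \notin U -> v \notin U ->
    adj G u u' -> adj G v v' -> ~~ adj G u v.
  move=> u'U v'U uU vU uu' vv'; apply/negP => uv.
  have neuv : u != v by apply: contraTneq uv => ->; rewrite adj_irrefl.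
  set U1 := u |: (v |: U).
  have cU1 : #|U1| = #|U|.+2 by rewrite !cardsU1 !inE (negPf uU) (negPf vU) (negPf neuv).
  (* The three new edges are distinct even when [u'] and [v'] coincide. *)
  have eU1 : #|inner_edges G U| + 3 <= #|inner_edges G U1|.
    have sub : [set u; v] |: ([set u; u'] |: ([set v; v'] |: inner_edges G U))
        \subset inner_edges G U1.
      rewrite !subUset !sub1set !inE; apply/and4P; split.
      - apply/andP; split; first exact: uv.
        by apply/subsetP => z; rewrite !inE => /orP[]/eqP ->; rewrite eqxx ?orbT.
      - apply/andP; split; first exact: uu'.
        by apply/subsetP => z; rewrite !inE => /orP[]/eqP ->; rewrite ?eqxx ?u'U ?orbT.
      - apply/andP; split; first exact: vv'.
        by apply/subsetP => z; rewrite !inE => /orP[]/eqP ->; rewrite ?eqxx ?v'U ?orbT.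
      apply/subsetP => e; rewrite !inE => /andP[-> /subsetP eU'] /=.
      by apply/subsetP => z /eU' zU; rewrite !inE zU !orbT.
    apply: leq_trans (subset_leq_card sub); rewrite !cardsU1 !inE.
    have out w w' : w \notin U -> ([set w; w'] \subset U) = false.
      move=> wU; apply/negP => /subsetP /(_ w); rewrite !inE eqxx => /(_ isT).
      by rewrite (negPf wU).
    have ne1 : ([set u; v] == [set u; u']) = false.
      apply/negP => /eqP/setP/(_ v); rewrite !inE eqxx orbT eq_sym (negPf neuv) /=.
      by move=> /esym/eqP vu'; rewrite vu' u'U in vU.
    have ne2 : ([set u; v] == [set v; v']) = false.
      apply/negP => /eqP/setP/(_ u); rewrite !inE eqxx (negPf neuv) /=.
      by move=> /esym/eqP vu'; rewrite vu' v'U in uU.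
    have ne3 : ([set u; u'] == [set v; v']) = false.
      apply/negP => /eqP/setP/(_ u); rewrite !inE eqxx (negPf neuv) /=.
      by move=> /esym/eqP vu'; rewrite vu' v'U in uU.
    rewrite ne1 ne2 ne3 !out // !andbF /=; move: #|_| => ?; clear; lia.
  have admU1 : adm U1.
    rewrite /adm; apply/and3P; split.
    - by apply: subset_trans U0U _; apply/subsetP => z zU; rewrite !inE zU !orbT.
    - by move: eU eU1; rewrite cU1; clear; lia.
    - by move: Us9; rewrite cU1; clear; lia.
  by have := Umax _ admU1; rewrite cU1; clear; lia.
have [|c3 c3P] := @sparse_coloring 2 U.
  move=> W WU W0; have cW : 0 < #|W| by rewrite card_gt0.
  have := sp W; rewrite cW (leq_trans (subset_leq_card WU) Us) => /(_ isT).
  by move: cW; clear; lia.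
have tt : t <= t.+1 by [].
have t3' : 3 <= t.+1 by apply: ltnW.
pose col v : 'I_t.+1 := if v \in U then widen_ord t3' (c3 v) else
  if [exists u in U, adj G v u] then ord_max else widen_ord tt (c v).
have colU v w : v \in U -> w \notin U -> adj G v w -> col v != col w.
  move=> vU wU vw; rewrite /col vU (negPf wU).
  have -> : [exists u in U, adj G w u] by apply/exists_inP; exists v; rewrite // adjC.
  rewrite -val_eqE /=; move: (ltn_ord (c3 v)) t3; clear.
  by move=> h1 h2; rewrite neq_ltn (leq_trans h1).
apply: colorableP; exists col => x y xy.
have [xU|xU] := boolP (x \in U); have [yU|yU] := boolP (y \in U).
- rewrite /col xU yU -val_eqE /= val_eqE; exact: c3P.
- exact: colU.
- by rewrite eq_sym; apply: colU; rewrite // adjC.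
rewrite /col (negPf xU) (negPf yU).
case: ifPn => [/exists_inP[u uU xu]|xN]; case: ifPn => [/exists_inP[v vU yv]|yN].
- by have := indep _ _ _ _ uU vU xU yU xu yv; rewrite xy.
- by rewrite -val_eqE /= neq_ltn ltn_ord orbT.
- by rewrite -val_eqE /= neq_ltn ltn_ord.
rewrite -val_eqE /= val_eqE; apply: cP => //.
- by apply: contra xU; apply: (subsetP U0U).
- by apply: contra yU; apply: (subsetP U0U).
Qed.

End Coloring.

(** * Closing a vertex set *)

Section Closure.
Variables (V : finType) (r b tgt : nat).
Implicit Types (G : sgraph V) (U S Y : {set V}) (F : {set {set V}}).

Definition link_step G U x S : bool :=
  [&& x \notin U, S \subset U, #|S| == r & [forall s in S, adj G x s]].

(* The [b] leaves are added in one step: as an unordered set they cost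
   ['C(n, b)], and adding them one at a time would lose the factor [1 / b!]. *)
Definition star_step G U x Y : bool :=
  [&& x \notin U, Y \subset ~: U, #|Y| == b &
      [forall y in Y, adj G x y && [exists u in U, adj G y u]]].

(** [k] is fuel. Phrasing the closure as a search for a run that reaches size [tgt] lets its failure
    be bounded by a union over runs. *)
Fixpoint grows G k U : bool :=
  (tgt <= #|U|) || if k is k'.+1 then
    [exists x, exists S : {set V}, link_step G U x S && grows G k' (x |: U)] ||
    [exists x, exists Y : {set V}, star_step G U x Y && grows G k' (x |: (Y :|: U))]
  else false.

Definition near_nbrs G U x : {set V} :=
  [set y in ~: U | adj G x y && [exists u in U, adj G y u]].

(** Steps are taken while one applies. Each adds at least one vertex, so the fuel suffices, and the
    size stays below [tgt] because [grows] fails. *)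
Lemma grows_closed G k U : ~~ grows G k U -> tgt <= #|U| + k ->
  exists U', [/\ U \subset U', #|U'| < tgt,
    forall x, x \notin U' -> #|nbrs_in G U' x| < r &
    forall x, x \notin U' -> #|near_nbrs G U' x| < b].
Proof.
elim: k U => [|k IH] U /=; rewrite negb_or -ltnNge => /andP[Ut].
  by rewrite addn0 leqNgt Ut.
rewrite negb_or => /andP[nA nB] tk.
have go U1 : ~~ grows G k U1 -> U \proper U1 -> exists U', [/\ U \subset U',
    #|U'| < tgt, forall x, x \notin U' -> #|nbrs_in G U' x| < r &
    forall x, x \notin U' -> #|near_nbrs G U' x| < b].
  move=> g /[dup] /proper_card c /proper_sub s.
  have [|U' [U1U' h1 h2 h3]] := IH U1 g; first by move: tk c; clear; lia.
  by exists U'; split => //; apply: subset_trans U1U'.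
have [/forall_inP hA|] := boolP [forall x in ~: U, #|nbrs_in G U x| < r]; last first.
  rewrite negb_forall_in => /exists_inP[x]; rewrite inE => xU.
  rewrite -leqNgt => /subset_of_card[S SN Sr].
  have st : link_step G U x S.
    rewrite /link_step xU Sr eqxx /=; apply/andP; split.
      by apply/subsetP => s /(subsetP SN); rewrite inE => /andP[].
    by apply/forall_inP => s /(subsetP SN); rewrite inE => /andP[].
  apply: (go (x |: U)).
    apply: contra nA => g; apply/existsP; exists x; apply/existsP; exists S.
    by rewrite st.
  by rewrite properEneq subsetUr andbT; apply: contraNneq xU => ->; rewrite setU11.
have [/forall_inP hB|] := boolP [forall x in ~: U, #|near_nbrs G U x| < b]; last first.
  rewrite negb_forall_in => /exists_inP[x]; rewrite inE => xU.
  rewrite -leqNgt => /subset_of_card[Y YN Yb].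
  have st : star_step G U x Y.
    rewrite /star_step xU Yb eqxx /=; apply/andP; split.
      by apply/subsetP => s /(subsetP YN); rewrite inE => /andP[].
    by apply/forall_inP => s /(subsetP YN); rewrite inE => /andP[].
  apply: (go (x |: (Y :|: U))).
    apply: contra nB => g; apply/existsP; exists x; apply/existsP; exists Y.
    by rewrite st.
  rewrite properEneq setUA subsetUr andbT; apply: contraNneq xU => ->.
  by rewrite !inE eqxx.
by exists U; split => // x xU; [apply: hA|apply: hB]; rewrite inE.
Qed.

Local Open Scope ring_scope.
Variables (R : realType) (X : {set sgraph V}) (q w : R) (M : nat).
Hypothesis q_ge0 : 0 <= q.
Hypothesis edge_prob : forall E : {set {set V}},
  {in E, forall e : {set V}, #|e| = 2%N} -> (#|E| <= M)%N ->
  #|[set G in X | E \subset edges G]|%:R <= q ^+ #|E| * #|X|%:R.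
Hypothesis r2 : (2 <= r)%N.
Hypothesis w1 : 1 <= w.
Hypothesis sizeM : (r * (tgt + b) <= M)%N.
Hypothesis link_small : #|V|%:R * (tgt%:R * q) ^+ r * w <= 1 / 2.
Hypothesis star_small :
  #|V|%:R * ('C(#|V|, b)%:R * (tgt%:R * q ^+ 2 * w) ^+ b) * w <= 1 / 2.

Definition link_edges (x : V) S : {set {set V}} := [set [set x; s] | s in S].
Definition star_edges (x : V) Y (g : {ffun V -> V}) : {set {set V}} :=
  link_edges x Y :|: [set [set y; g y] | y in Y].

Lemma set2_inj (x y z : V) : y != x -> z != x -> [set x; y] = [set x; z] -> y = z.
Proof.
move=> yx zx e; have : y \in [set x; z] by rewrite -e !inE eqxx orbT.
by rewrite !inE (negPf yx) => /eqP.
Qed.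

Lemma card_link_edges x S : x \notin S -> #|link_edges x S| = #|S|.
Proof.
move=> xS; rewrite card_in_imset // => s s' sS s'S; apply: set2_inj.
  by apply: contraNneq xS => <-.
by apply: contraNneq xS => <-.
Qed.

Lemma card_star_edges U x Y (g : {ffun V -> V}) : x \notin U -> Y \subset ~: U -> x \notin Y ->
  {in Y, forall y, g y \in U} -> #|star_edges x Y g| = (2 * #|Y|)%N.
Proof.
move=> xU YU xY gU.
have out y : y \in Y -> y \notin U by move=> /(subsetP YU); rewrite inE.
have g_inj : {in Y &, injective (fun y => [set y; g y])}.
  move=> y z yY zY e; have : y \in [set z; g z] by rewrite -e !inE eqxx.
  rewrite !inE => /orP[/eqP//|/eqP yg].
  by have := out _ yY; rewrite yg gU.
rewrite cardsU card_link_edges // (card_in_imset g_inj).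
have -> : link_edges x Y :&: [set [set y; g y] | y in Y] = set0.
  apply/setP => e; rewrite !inE; apply/negP => /andP[/imsetP[y yY ->] /imsetP[z zY]].
  move=> e'; have : x \in [set z; g z] by rewrite -e' !inE eqxx.
  rewrite !inE => /orP[/eqP xz|/eqP xg]; first by rewrite xz zY in xY.
  by rewrite xg gU in xU.
by rewrite cards0 subn0 mul2n addnn.
Qed.

(** Union bound over runs by induction on the fuel, with [F] the edges found so far and [w] a price
    per vertex. A link or star step multiplies the bound by at most the quantity in [link_small] or
    [star_small], [1 / 2] each. New edges have an end outside [U], so none is already in [F]. The
    invariant [|F| <= r |U|] keeps [edge_prob] available and survives a star step ([2 b] edges,
    [b + 1] vertices) because [r >= 2]; such a step may overshoot, hence [tgt + b]. *)
Lemma grows_le k U F : {in F, forall e : {set V}, #|e| = 2%N} ->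
  {in F, forall e : {set V}, e \subset U} ->
  (#|F| <= r * #|U|)%N -> (#|U| <= tgt + b)%N ->
  #|[set G in X | (F \subset edges G) && grows G k U]|%:R * w ^+ tgt <=
  q ^+ #|F| * w ^+ #|U| * #|X|%:R.
Proof.
have w0 : 0 < w := lt_le_trans ltr01 w1.
have base k' U' F' : {in F', forall e : {set V}, #|e| = 2%N} ->
    (#|F'| <= r * #|U'|)%N -> (#|U'| <= tgt + b)%N -> (tgt <= #|U'|)%N ->
    #|[set G in X | (F' \subset edges G) && grows G k' U']|%:R * w ^+ tgt <=
    q ^+ #|F'| * w ^+ #|U'| * #|X|%:R.
  move=> F2 Fr Ub tU.
  have FM : (#|F'| <= M)%N.
    by apply: leq_trans sizeM; apply: leq_trans Fr _; rewrite leq_mul2l Ub orbT.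
  rewrite mulrAC; apply: ler_pM; rewrite ?ler0n ?exprn_ge0 ?(ltW w0) //.
    apply: le_trans (edge_prob F2 FM); rewrite ler_nat subset_leq_card //.
    by apply/subsetP => G; rewrite !inE => /and3P[-> ->].
  by rewrite ler_weXn2l.
elim: k U F => [|k IH] U F F2 FU Fr Ub.
  have [tU|Ut] := leqP tgt #|U|; last first.
    rewrite (_ : [set G in X | _] = set0).
      by rewrite cards0 mul0r !mulr_ge0 ?exprn_ge0 // ltW.
    by apply/setP => G; rewrite !inE /= leqNgt Ut !andbF.
  exact: base.
have [tU|Ut] := leqP tgt #|U|; first exact: base.
set K := q ^+ #|F| * w ^+ #|U| * #|X|%:R.
have K0 : 0 <= K by rewrite !mulr_ge0 ?exprn_ge0 // ltW.
pose SS := [set S : {set V} | S \subset U & #|S| == r].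
pose YY x := [set Y : {set V} | Y \subset ~: U :\ x & #|Y| == b].
(* [g] selects a neighbour in [U] for each leaf; freezing it at [x] off [Y] leaves [|U| ^ |Y|]
   functions. *)
pose GG x Y := [set g : {ffun V -> V} | g \in pffun_on x (mem Y) (mem U)].
pose Za x S := [set G in X | (F :|: link_edges x S \subset edges G) && grows G k (x |: U)].
pose Zb x Y g := [set G in X | (F :|: star_edges x Y g \subset edges G)
   && grows G k (x |: (Y :|: U))].
have sub : [set G in X | (F \subset edges G) && grows G k.+1 U] \subset
    (\bigcup_(x in ~: U) \bigcup_(S in SS) Za x S) :|:
    (\bigcup_(x in ~: U) \bigcup_(Y in YY x) \bigcup_(g in GG x Y) Zb x Y g).
  apply/subsetP => G; rewrite inE => /andP[GX /andP[FG]] /=.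
  rewrite leqNgt Ut /= => /orP[]/existsP[x]/existsP[S]/andP[/and4P[xU SU Sr /forall_inP Sx] g].
    rewrite inE; apply/orP; left; apply/bigcupP; exists x; first by rewrite inE.
    apply/bigcupP; exists S; first by rewrite inE SU.
    rewrite inE GX g andbT subUset FG /=; apply/subsetP => _ /imsetP[s sS ->].
    exact: Sx.
  rewrite inE; apply/orP; right; apply/bigcupP; exists x; first by rewrite inE.
  have xS : x \notin S.
    by apply/negP => /Sx; rewrite adj_irrefl.
  apply/bigcupP; exists S.
    by rewrite inE Sr andbT subsetD1 SU.
  pose gg := [ffun y => if y \in S then odflt x [pick u in U | adj G y u] else x].
  have ggP y : y \in S -> (gg y \in U) && adj G y (gg y).
    move=> yS; rewrite ffunE yS; case: pickP => [u //|no].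
    have /andP[_ /exists_inP[u uU yu]] := Sx y yS.
    by have := no u; rewrite uU yu.
  apply/bigcupP; exists gg.
    rewrite inE; apply/pffun_onP; split.
      apply/subsetP => y; rewrite !inE ffunE; by case: ifP; rewrite ?eqxx.
    by move=> _ /imageP[y yS ->]; have /andP[] := ggP y yS.
  rewrite inE GX g andbT !subUset FG /=; apply/andP; split.
    by apply/subsetP => _ /imsetP[s sS ->]; have /andP[] := Sx s sS.
  by apply/subsetP => _ /imsetP[s sS ->]; have /andP[] := ggP s sS.
have hA x S : x \notin U -> S \in SS -> #|Za x S|%:R * w ^+ tgt <= q ^+ r * w * K.
  move=> xU; rewrite inE => /andP[SU /eqP Sr].
  have xS : x \notin S by apply: contra xU; apply: (subsetP SU).
  have cE : #|F :|: link_edges x S| = (#|F| + r)%N.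
    rewrite cardsU card_link_edges // Sr (_ : F :&: _ = set0) ?cards0 ?subn0 //.
    apply/setP => e; rewrite !inE; apply/negP => /andP[eF /imsetP[s _ e2]].
    by have /subsetP/(_ x) := FU _ eF; rewrite e2 !inE eqxx (negPf xU) => /(_ isT).
  have cU : #|x |: U| = #|U|.+1 by rewrite cardsU1 xU.
  have := IH (x |: U) (F :|: link_edges x S); rewrite cE cU => H.
  apply: le_trans (H _ _ _ _) _.
  - move=> e /setUP[/F2//|/imsetP[s sS ->]]; rewrite cards2.
    by case: eqP => // xs; rewrite xs sS in xS.
  - move=> e /setUP[/FU eU|/imsetP[s sS ->]].
      by apply: subset_trans eU _; apply: subsetUr.
    by rewrite subUset !sub1set !inE eqxx (subsetP SU _ sS) orbT.
  - by rewrite mulnS addnC leq_add2l.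
  - by apply: leq_trans Ut _; apply: leq_addr.
  rewrite [q ^+ (_ + _)]exprD [w ^+ _.+1]exprS /K le_eqVlt; apply/orP; left.
  move: (q ^+ #|F|) (q ^+ r) (w ^+ #|U|) (#|X|%:R) => k1 k2 k3 k4.
  by apply/eqP; ring.
have hB x Y g : x \notin U -> Y \in YY x -> g \in GG x Y ->
    #|Zb x Y g|%:R * w ^+ tgt <= (q ^+ 2 * w) ^+ b * w * K.
  move=> xU; rewrite inE subsetD1 => /andP[/andP[YU xY] /eqP Yb].
  rewrite inE => /pffun_onP[_ gU'].
  have gU : {in Y, forall y, g y \in U}.
    by move=> y yY; apply: gU'; apply/imageP; exists y.
  have YUo y : y \in Y -> y \notin U by move=> /(subsetP YU); rewrite inE.
  have cE : #|F :|: star_edges x Y g| = (#|F| + 2 * b)%N.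
    rewrite cardsU (card_star_edges xU) // Yb (_ : F :&: _ = set0) ?cards0 ?subn0 //.
    apply/setP => e; rewrite !inE; apply/negP => /andP[eF /orP[]/imsetP[s sY e2]].
      by have /subsetP/(_ x) := FU _ eF; rewrite e2 !inE eqxx (negPf xU) => /(_ isT).
    have /subsetP/(_ s) := FU _ eF; rewrite e2 !inE eqxx => /(_ isT) sU.
    by have := YUo _ sY; rewrite sU.
  have cU : #|x |: (Y :|: U)| = (#|U| + b.+1)%N.
    rewrite cardsU1 !inE negb_or xY xU cardsU Yb (_ : Y :&: U = set0).
      by rewrite cards0 subn0 add1n -addSn addnC.
    by apply/setP => y; rewrite !inE; apply/negP => /andP[/YUo]; move/negP.
  have := IH (x |: (Y :|: U)) (F :|: star_edges x Y g); rewrite cE cU => H.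
  apply: le_trans (H _ _ _ _) _.
  - move=> e /setUP[/F2//|/setUP[]/imsetP[s sS ->]]; rewrite cards2.
      by case: eqP => // xs; rewrite xs sS in xY.
    by case: eqP => // xs; have := YUo _ sS; rewrite xs gU.
  - move=> e /setUP[/FU eU|/setUP[]/imsetP[s sS ->]].
    + by apply: subset_trans eU _; rewrite setUA subsetUr.
    + by rewrite subUset !sub1set !inE eqxx sS orbT.
    + by rewrite subUset !sub1set !inE sS gU // !orbT.
  - rewrite mulnDr leq_add // (leq_trans (leq_mul r2 (leqnn b))) //.
    by rewrite leq_mul2l leqnSn orbT.
  - by rewrite addnS -addSn leq_add2r.
  rewrite [q ^+ (_ + _)]exprD [w ^+ (_ + _)]exprD [w ^+ _.+1]exprS.
  rewrite [(q ^+ 2 * w) ^+ b]exprMn -[(q ^+ 2) ^+ b]exprM /K le_eqVlt; apply/orP; left.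
  move: (q ^+ #|F|) (q ^+ (2 * b)) (w ^+ #|U|) (w ^+ b) (#|X|%:R) => k1 k2 k3 k4 k5.
  by apply/eqP; ring.
clearbody K.
have wt0 : 0 <= w ^+ tgt by rewrite exprn_ge0 // ltW.
have tU : #|U|%:R <= tgt%:R :> R by rewrite ler_nat ltnW.
have := subset_leq_card sub; rewrite -(ler_nat R) => sub'.
apply: (le_trans (ler_wpM2r wt0 sub')).
have natU (A1 A2 : {set sgraph V}) : #|A1 :|: A2|%:R <= #|A1|%:R + #|A2|%:R :> R.
  by rewrite -natrD ler_nat leq_card_setU.
have sub2 := natU (\bigcup_(x in ~: U) \bigcup_(S in SS) Za x S)
    (\bigcup_(x in ~: U) \bigcup_(Y in YY x) \bigcup_(g in GG x Y) Zb x Y g).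
apply: (le_trans (ler_wpM2r wt0 sub2)); rewrite mulrDl.
have -> : K = 1 / 2 * K + 1 / 2 * K by field.
apply: lerD.
  apply: (@le_trans _ _ (#|V|%:R * (tgt%:R * q) ^+ r * w * K)); last first.
    by rewrite ler_wpM2r.
  have h1 := card_bigcup_le (mem (~: U)) (fun x => \bigcup_(S in SS) Za x S).
  have h2 x : x \in ~: U -> #|\bigcup_(S in SS) Za x S|%:R * w ^+ tgt <=
      #|SS|%:R * (q ^+ r * w * K).
    rewrite inE => xU; have := card_bigcup_le (mem SS) (Za x).
    rewrite -(ler_nat R) natr_sum => /(ler_wpM2r wt0) /le_trans; apply.
    rewrite mulr_suml [leRHS]mulr_natl -sumr_const; apply: ler_sum => S SSS.
    exact: hA.
  move: h1; rewrite -(ler_nat R) natr_sum => /(ler_wpM2r wt0) /le_trans; apply.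
  rewrite mulr_suml; apply: le_trans (ler_sum _ h2) _.
  rewrite sumr_const -[leLHS]mulr_natl.
  have cSS : #|SS|%:R <= tgt%:R ^+ r :> R.
    rewrite cards_draws; apply: (@le_trans _ _ (#|U|%:R ^+ r)).
      rewrite -natrX ler_nat; apply: leq_trans (bin_fact_le _ _).
      by rewrite leq_pmulr // fact_gt0.
    by apply: lerXn2r; rewrite ?nnegrE ?ler0n.
  have -> : #|V|%:R * (tgt%:R * q) ^+ r * w * K =
      #|V|%:R * (tgt%:R ^+ r * (q ^+ r * w * K)).
    rewrite exprMn.
    by ring.
  apply: ler_pM; rewrite ?ler0n ?ler_nat ?max_card //.
    by rewrite !mulr_ge0 ?ler0n ?exprn_ge0 // ltW.
  by rewrite ler_wpM2r // !mulr_ge0 ?exprn_ge0 // ltW.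
apply: (@le_trans _ _ (#|V|%:R * ('C(#|V|, b)%:R * (tgt%:R * q ^+ 2 * w) ^+ b) * w * K)); last first.
  by rewrite ler_wpM2r.
have qw0 : 0 <= (q ^+ 2 * w) ^+ b * w * K.
  by rewrite !mulr_ge0 ?exprn_ge0 ?mulr_ge0 ?exprn_ge0 // ltW.
have h2 x : x \in ~: U -> #|\bigcup_(Y in YY x) \bigcup_(g in GG x Y) Zb x Y g|%:R
    * w ^+ tgt <= #|YY x|%:R * (tgt%:R ^+ b * ((q ^+ 2 * w) ^+ b * w * K)).
  rewrite inE => xU; have := card_bigcup_le (mem (YY x)) (fun Y => \bigcup_(g in GG x Y) Zb x Y g).
  rewrite -(ler_nat R) natr_sum => /(ler_wpM2r wt0) /le_trans; apply.
  rewrite mulr_suml [leRHS]mulr_natl -sumr_const; apply: ler_sum => Y YYY.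
  have := card_bigcup_le (mem (GG x Y)) (Zb x Y).
  rewrite -(ler_nat R) natr_sum => /(ler_wpM2r wt0) /le_trans; apply.
  apply: (@le_trans _ _ (#|GG x Y|%:R * ((q ^+ 2 * w) ^+ b * w * K))).
    rewrite mulr_suml [leRHS]mulr_natl -sumr_const; apply: ler_sum => g gG.
    exact: hB.
  rewrite ler_wpM2r // /GG cardsE card_pffun_on.
  have -> : #|mem Y| = b by move: YYY; rewrite !inE => /andP[_ /eqP].
  by rewrite natrX; apply: lerXn2r; rewrite ?nnegrE ?ler0n.
have h1 := card_bigcup_le (mem (~: U)) (fun x => \bigcup_(Y in YY x) \bigcup_(g in GG x Y) Zb x Y g).
move: h1; rewrite -(ler_nat R) natr_sum => /(ler_wpM2r wt0) /le_trans; apply.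
rewrite mulr_suml; apply: le_trans (ler_sum _ h2) _.
have cYY x : #|YY x|%:R <= 'C(#|V|, b)%:R :> R.
  by rewrite cards_draws ler_nat leq_bin2l // max_card.
have -> : #|V|%:R * ('C(#|V|, b)%:R * (tgt%:R * q ^+ 2 * w) ^+ b) * w * K =
   #|V|%:R * ('C(#|V|, b)%:R * (tgt%:R ^+ b * ((q ^+ 2 * w) ^+ b * w * K))).
  rewrite -[tgt%:R * _ * w]mulrA [(tgt%:R * _) ^+ b]exprMn.
  by ring.
apply: (@le_trans _ _ (\sum_(x in ~: U) 'C(#|V|, b)%:R *
    (tgt%:R ^+ b * ((q ^+ 2 * w) ^+ b * w * K)))).
  by apply: ler_sum => x _; rewrite ler_wpM2r // mulr_ge0 ?exprn_ge0.
rewrite sumr_const -[leLHS]mulr_natl ler_wpM2r ?ler_nat ?max_card //.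
by rewrite mulr_ge0 ?ler0n // mulr_ge0 ?exprn_ge0.
Qed.

Lemma grows_start_le (s k : nat) : (s <= tgt)%N ->
  #|[set G in X | [exists U : {set V}, (#|U| == s) && grows G k U]]|%:R * w ^+ (tgt - s) <=
  #|V|%:R ^+ s * #|X|%:R.
Proof.
move=> st; have w0 : 0 < w := lt_le_trans ltr01 w1.
pose Z U := [set G in X | (set0 \subset edges G) && grows G k U].
have sub : [set G in X | [exists U : {set V}, (#|U| == s) && grows G k U]] \subset
    \bigcup_(U in [set U : {set V} | #|U| == s]) Z U.
  apply/subsetP => G; rewrite inE => /andP[GX /existsP[U /andP[Us g]]].
  apply/bigcupP; exists U; first by rewrite inE.
  by rewrite inE GX sub0set.
have ws : 0 < w ^+ s by rewrite exprn_gt0.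
rewrite -(ler_pM2r ws) -mulrA -exprD subnK //.
have := subset_leq_card sub; rewrite -(ler_nat R).
move=> /(ler_wpM2r (exprn_ge0 tgt (ltW w0))) /le_trans; apply.
have := card_bigcup_le (mem [set U : {set V} | #|U| == s]) Z.
rewrite -(ler_nat R) natr_sum => /(ler_wpM2r (exprn_ge0 tgt (ltW w0))) /le_trans; apply.
rewrite mulr_suml.
apply: (@le_trans _ _ (\sum_(U in [set U : {set V} | #|U| == s]) w ^+ s * #|X|%:R)).
  apply: ler_sum => U; rewrite !inE => /eqP Us.
  have := @grows_le k U set0; rewrite cards0 expr0 mul1r Us; apply => //.
  - by move=> e; rewrite inE.
  - by move=> e; rewrite inE.
  - by apply: leq_trans st _; apply: leq_addr.
rewrite sumr_const card_draws -[leLHS]mulr_natl mulrA [leRHS]mulrAC ler_wpM2r ?ler0n //.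
rewrite ler_wpM2r ?(ltW ws) // -natrX ler_nat; apply: leq_trans (bin_fact_le _ _).
by rewrite leq_pmulr // fact_gt0.
Qed.

End Closure.

(** * Dense range: recolouring by an independent transversal *)

Section Transversal.
Variables (V I : finType) (L : V -> {set I}) (conf : V * I -> V * I -> bool).
Variables (l D : nat).
Hypothesis card_L : forall u, l <= #|L u|.
Hypothesis l_gt0 : 0 < l.
Hypothesis confC : forall e f, conf e f = conf f e.
Hypothesis conf_neq : forall e f, conf e f -> e.1 != f.1.
Hypothesis conf_L : forall e f, conf e f -> e.2 \in L e.1.
Hypothesis conf_deg : forall e, #|[set f | conf e f]| <= D.
Hypothesis lD : 16 * D <= l.

Local Notation fam := [set f : {ffun V -> I} | [forall u, f u \in L u]].

Definition conflict (e : (V * I) * (V * I)) : {set {ffun V -> I}} :=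
  [set f : {ffun V -> I} | [&& conf e.1 e.2, f e.1.1 == e.1.2 & f e.2.1 == e.2.2]].

Local Open Scope ring_scope.

(** Twice the probability that independent uniform choices from the lists pick both ends. *)
Definition conflict_weight (e : (V * I) * (V * I)) : rat :=
  if conf e.1 e.2 then 2 / (#|L e.1.1| * #|L e.2.1|)%:R else 0.

Definition conflict_nb (e e' : (V * I) * (V * I)) : bool :=
  conf e'.1 e'.2 && ~~ [disjoint [set e.1.1; e.2.1] & [set e'.1.1; e'.2.1]].

Let cL u : 0 < #|L u|%:R :> rat.
Proof. by rewrite ltr0n; apply: leq_trans (card_L u). Qed.

Lemma conflict_weight_ge0 e : 0 <= conflict_weight e.
Proof. by rewrite /conflict_weight; case: ifP => // _; rewrite divr_ge0. Qed.

(** Resampling the choices at [u] and [u'] is injective on the conflict event, where both are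
    prescribed, and cannot affect the events of [S] that can occur, since these involve neither
    vertex. *)
Lemma conflict_cond e (S : {set (V * I) * (V * I)}) :
  (forall j, j \in S -> ~~ conflict_nb e j) ->
  #|conflict e :&: avoiding fam conflict S|%:R <=
  conflict_weight e / 2 * #|avoiding fam conflict S|%:R :> rat.
Proof.
move=> hS; rewrite /conflict_weight; case: ifP => ce; last first.
  rewrite (_ : conflict e = set0) ?set0I ?cards0 ?mul0r //.
  by apply/setP => f; rewrite !inE ce.
case: e ce hS => -[u i] [u' i'] /= ce hS.
have uu' : u != u' := conf_neq ce.
set C := avoiding _ _ _; set A := conflict _ :&: C.
pose g (z : {ffun V -> I} * (I * I)) : {ffun V -> I} :=
  [ffun v => if v == u then z.2.1 else if v == u' then z.2.2 else z.1 v].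
have le : (#|A| * (#|L u| * #|L u'|) <= #|C|)%N.
  rewrite -[(#|L u| * _)%N]cardsX -cardsX -(card_in_imset (f := g)).
    apply/subset_leq_card/subsetP => _ /imsetP[[f [a b]] + ->].
    rewrite !in_setX /= => /and3P[/setIP[fe /in_avoiding[fL fS]] aL bL].
    apply/in_avoiding; split.
      move: fL; rewrite !inE => /forallP fL; apply/forallP => v; rewrite ffunE /=.
      by case: eqP => [->//|_]; case: eqP => [->//|_].
    move=> j jS; apply: contra (fS j jS); rewrite !inE => /and3P[cj].
    have := hS j jS; rewrite /conflict_nb cj /= negbK => dis.
    have out v : v \in [set j.1.1; j.2.1] -> (v == u = false) * (v == u' = false).
      by move=> /(disjointFl dis); rewrite !inE => /negbT/norP[/negPf -> /negPf ->].
    by rewrite !ffunE !out ?inE ?eqxx ?orbT // => -> ->.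
  move=> [f [a b]] [f' [a' b']]; rewrite !in_setX /=.
  move=> /and3P[fA _ _] /and3P[fA' _ _] /ffunP e.
  have [fu fu'] : f u = i /\ f u' = i'.
    by move: fA; rewrite !inE => /andP[/and3P[_ /eqP -> /eqP ->]].
  have [gu gu'] : f' u = i /\ f' u' = i'.
    by move: fA'; rewrite !inE => /andP[/and3P[_ /eqP -> /eqP ->]].
  have ea : a = a' by have := e u; rewrite !ffunE eqxx.
  have eb : b = b' by have := e u'; rewrite !ffunE eqxx eq_sym (negPf uu').
  congr (_, (_, _)) => //; apply/ffunP => v.
  have := e v; rewrite !ffunE /=; case: eqP => [->|_]; first by rewrite fu gu.
  by case: eqP => [->|_ //]; rewrite fu' gu'.
move: le; rewrite -(ler_nat rat) !natrM => le.
rewrite (_ : 2 / _ / 2 = (#|L u|%:R * #|L u'|%:R)^-1); last first.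
  by field; rewrite !gt_eqF.
by rewrite mulrC ler_pdivlMr // mulr_gt0.
Qed.

Lemma conflict_sum_left w :
  \sum_(e | conf e.1 e.2 && (e.1.1 == w)) conflict_weight e <= 2 * D%:R / l%:R.
Proof.
have l0 : 0 < l%:R :> rat by rewrite ltr0n.
apply: (@le_trans _ _ (\sum_(i in L w) \sum_(f | conf (w, i) f)
    2 / (#|L w|%:R * l%:R))).
  rewrite (eq_bigl (fun e => (e.1.1 == w) && conf e.1 e.2)); last by move=> e; rewrite andbC.
  rewrite -(pair_big_dep (fun e1 : V * I => e1.1 == w) (fun e1 e2 => conf e1 e2)
    (fun e1 e2 => conflict_weight (e1, e2))) /=.
  rewrite (reindex_onto (fun i => (w, i)) snd) /=; last by move=> [v i] /= /eqP ->.
  rewrite (eq_bigl xpredT) => [|i]; last by rewrite !eqxx.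
  rewrite [leRHS]big_mkcond; apply: ler_sum => i _.
  case: ifPn => iL.
    apply: ler_sum => f cf; rewrite /conflict_weight cf ler_wpM2l // natrM.
    rewrite lef_pV2 ?posrE ?mulr_gt0 // ler_wpM2l ?ler0n // ler_nat.
    exact: card_L.
  rewrite big1 // => f cf; have := conf_L cf; by rewrite /= (negPf iL).
apply: (@le_trans _ _ (\sum_(i in L w) D%:R * (2 / (#|L w|%:R * l%:R)))).
  apply: ler_sum => i _; rewrite sumr_const -[leLHS]mulr_natl.
  rewrite ler_wpM2r ?divr_ge0 ?mulr_ge0 ?ler0n // ler_nat -cardsE.
  exact: conf_deg.
rewrite sumr_const -[leLHS]mulr_natl le_eqVlt; apply/orP; left; apply/eqP.
by field; rewrite !gt_eqF.
Qed.

Lemma conflict_sum_right w :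
  \sum_(e | conf e.1 e.2 && (e.2.1 == w)) conflict_weight e <= 2 * D%:R / l%:R.
Proof.
apply: le_trans (conflict_sum_left w).
pose sw (e : (V * I) * (V * I)) := (e.2, e.1).
have swK : involutive sw by case.
rewrite (reindex_inj (inv_inj swK)) /= le_eqVlt; apply/orP; left; apply/eqP.
apply: eq_big => [e|e _]; first by rewrite confC.
by rewrite /conflict_weight /= confC mulnC.
Qed.

(** Each vertex carries at most [2 D / l] as a left end and as much as a right end; two vertices
    make [8 D / l], whence [16 D <= l]. *)
Lemma conflict_nb_le e : \sum_(e' | conflict_nb e e') conflict_weight e' <= 1 / 2.
Proof.
have l0 : 0 < l%:R :> rat by rewrite ltr0n.
pose s w := \sum_(e' | conf e'.1 e'.2 && (e'.1.1 == w)) conflict_weight e' +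
  \sum_(e' | conf e'.1 e'.2 && (e'.2.1 == w)) conflict_weight e'.
have sle w : s w <= 4 * D%:R / l%:R.
  have := lerD (conflict_sum_left w) (conflict_sum_right w).
  by rewrite -mulrDl -mulrDl.
apply: (@le_trans _ _ (s e.1.1 + s e.2.1)).
  rewrite /s [leLHS]big_mkcond.
  rewrite ![\sum_(e' | _ && _) _]big_mkcond -!big_split /=.
  apply: ler_sum => e' _; have w0 := conflict_weight_ge0 e'.
  rewrite /conflict_nb; case: (conf _ _) => /=; last by rewrite !addr0.
  have n0 (c : bool) : 0 <= (if c then conflict_weight e' else 0) by case: c.
  case: ifP => [|_]; last by rewrite !addr_ge0.
  case: (e'.1.1 =P e.1.1) => [_ _|n1]; first by rewrite -addrA lerDl !addr_ge0.
  case: (e'.2.1 =P e.1.1) => [_ _|n2]; first by rewrite add0r lerDl !addr_ge0.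
  case: (e'.1.1 =P e.2.1) => [_ _|n3]; first by rewrite !add0r lerDl.
  case: (e'.2.1 =P e.2.1) => [_ _|n4]; first by rewrite !add0r.
  rewrite disjoint_sym disjoints_subset => /subsetPn[v]; rewrite !inE negbK.
  move=> /orP[]/eqP -> /orP[]/eqP h; [by case: n1|by case: n3|by case: n2|by case: n4].
apply: le_trans (lerD (sle _) (sle _)) _.
rewrite -mulrDl ler_pdivrMr //; move: lD; rewrite -(ler_nat rat) natrM; lra.
Qed.

Lemma transversal_exists : exists f : {ffun V -> I},
  (forall u, f u \in L u) /\ (forall u v, ~~ conf (u, f u) (v, f v)).
Proof.
have le1 e : conflict_weight e <= 1 / 2.
  rewrite {1}/conflict_weight; case: ifP => [ce|_]; last by lra.
  have ne : conflict_nb e e.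
    by rewrite /conflict_nb ce -setI_eq0 setIid; apply/set0Pn; exists e.1.1; rewrite !inE eqxx.
  have := conflict_nb_le e; rewrite (bigD1 e) //= {1}/conflict_weight ce.
  have : 0 <= \sum_(i | conflict_nb e i && (i != e)) conflict_weight i.
    by apply: sumr_ge0 => i _; apply: conflict_weight_ge0.
  lra.
have := local_lemma conflict_weight_ge0 conflict_cond conflict_nb_le set0 (S' := setT).
have h1 i : conflict_weight i <= 1 by have := le1 i; lra.
move=> /(_ (fun i _ => h1 i)); rewrite setU0 => h.
have fam0 : (0 < #|avoiding fam conflict set0|)%N.
  have ex u : exists i, i \in L u.
    by apply/set0Pn; rewrite -card_gt0; apply: leq_trans (card_L u).
  rewrite card_gt0; apply/set0Pn; exists [ffun u => xchoose (ex u)].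
  apply/in_avoiding; split; last by move=> j; rewrite inE.
  by rewrite inE; apply/forallP => u; rewrite ffunE; apply: xchooseP.
have : 0 < #|avoiding fam conflict setT|%:R :> rat.
  apply: lt_le_trans h; rewrite mulr_gt0 ?ltr0n //; apply: prodr_gt0 => i _.
  by have := le1 i; lra.
rewrite ltr0n card_gt0 => /set0Pn[f /in_avoiding[fL fC]].
exists f; split; first by move: fL; rewrite inE => /forallP.
move=> u v; have := fC ((u, f u), (v, f v)); rewrite !inE => /(_ isT).
by rewrite !eqxx !andbT.
Qed.

End Transversal.

(** * Recolouring around a closed set *)

Section ClosedColoring.
Variables (V : finType) (G : sgraph V) (U : {set V}) (t : nat) (c : V -> 'I_t).
Variables (h r b d ell : nat) (phi : V -> 'I_h).
Hypothesis c_proper : proper_outside G U c.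
Hypothesis phi_proper : {in U &, forall x y, adj G x y -> phi x != phi y}.
Hypothesis link : forall x, x \notin U -> #|nbrs_in G U x| <= r.
Hypothesis star : forall x, x \notin U -> #|near_nbrs G U x| <= b.
Hypothesis deg : forall x, degree G x <= d.
Hypothesis size : 16 * (ell * (b * r)) <= t %/ h - d %/ ell.+1.
Hypothesis size0 : 0 < t %/ h - d %/ ell.+1.

Definition color_nbrs u (i : 'I_t) : {set V} :=
  [set x in ~: U | adj G u x && (c x == i)].

(* Splitting the colours by residue mod [h] along [phi] keeps adjacent vertices of
   [U] apart without any conflict. *)
Definition palette u : {set 'I_t} :=
  [set i : 'I_t | (i %% h == phi u) && (#|color_nbrs u i| <= ell)].

(** A residue class holds at least [t / h] colours, and by the degree bound at most [d / (ell + 1)]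
    colours occur on more than [ell] neighbours of [u]. *)
Lemma card_palette u : t %/ h - d %/ ell.+1 <= #|palette u|.
Proof.
have h0 : 0 < h by apply: leq_ltn_trans (ltn_ord (phi u)).
pose A := [set i : 'I_t | i %% h == phi u].
pose B := [set i : 'I_t | ell < #|color_nbrs u i|].
have cA : t %/ h <= #|A|.
  have lt (j : 'I_(t %/ h)) : phi u + h * j < t.
    have := ltn_ord j; have := leq_divM t h; have := ltn_ord (phi u).
    by move: (t %/ h) (nat_of_ord j) (nat_of_ord (phi u)) => p q s; clear; nia.
  pose f j := Ordinal (lt j).
  have f_inj : injective f.
    move=> j k /(congr1 val) /= /eqP; rewrite eqn_add2l eqn_pmul2l // => /eqP.
    exact: val_inj.
  rewrite -[t %/ h]card_ord -(card_imset _ f_inj); apply: subset_leq_card.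
  apply/subsetP => _ /imsetP[j _ ->]; rewrite inE /= addnC mulnC modnMDl modn_small ?eqxx ?ltn_ord //.
have cB : #|B| <= d %/ ell.+1.
  rewrite leq_divRL // -sum_nat_const.
  apply: (@leq_trans (\sum_(i in B) #|color_nbrs u i|)).
    by apply: leq_sum => i; rewrite inE.
  apply: (@leq_trans (\sum_i #|color_nbrs u i|)).
    by rewrite [leqRHS](bigID (mem B)) /= leq_addr.
  apply: leq_trans (deg u); rewrite /degree -sum1_card.
  rewrite (partition_big c predT) //=; apply: leq_sum => i _.
  rewrite sum1dep_card; apply: subset_leq_card; apply/subsetP => x.
  by rewrite !inE => /andP[_].
have sub : A \subset palette u :|: B.
  by apply/subsetP => i; rewrite !inE => ->; rewrite /= leqNgt; case: (ltnP ell).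
rewrite leq_subLR addnC; apply: leq_trans cA _.
apply: leq_trans (subset_leq_card sub) _; apply: leq_trans (leq_card_setU _ _) _.
by rewrite leq_add2l.
Qed.

Definition recolor_conflict (e f : V * 'I_t) : bool :=
  [&& e.1 != f.1, e.1 \in U, f.1 \in U, e.2 \in palette e.1, f.2 \in palette f.1 &
    [exists x in color_nbrs e.1 e.2, exists y in color_nbrs f.1 f.2, adj G x y]].

Lemma recolor_conflictC e f : recolor_conflict e f = recolor_conflict f e.
Proof.
have imp e' f' : recolor_conflict e' f' -> recolor_conflict f' e'.
  case/and5P => ef eU fU eP /andP[fP /exists_inP[x xe /exists_inP[y yf xy]]].
  rewrite /recolor_conflict eq_sym ef eU fU eP fP /=.
  apply/exists_inP; exists y => //; apply/exists_inP; exists x => //.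
  by rewrite adjC.
by apply/idP/idP; apply: imp.
Qed.

(** For a given choice there are at most [ell] recoloured [x], then at most [b] neighbours [y] of
    [x] that touch [U], then at most [r] vertices [v] of [U] next to [y]; the colour chosen at [v]
    must be [c y]. *)
Lemma recolor_conflict_deg e : #|[set f | recolor_conflict e f]| <= ell * (b * r).
Proof.
have [eP|eP] := boolP (e.2 \in palette e.1); last first.
  rewrite (_ : [set f | _] = set0) ?cards0 //.
  by apply/setP => f; rewrite !inE /recolor_conflict (negPf eP) !andbF.
have sub : [set f | recolor_conflict e f] \subset
    \bigcup_(x in color_nbrs e.1 e.2) \bigcup_(y in near_nbrs G U x)
      [set (v, c y) | v in nbrs_in G U y].
  apply/subsetP => -[v i]; rewrite inE /recolor_conflict /=.
  case/and5P => ef eU vU _ /andP[_ /exists_inP[x xe /exists_inP[y + xy]]].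
  rewrite !inE => /and3P[yU vy /eqP cy].
  have yv : adj G y v by rewrite adjC.
  apply/bigcupP; exists x => //; apply/bigcupP; exists y.
    rewrite !inE yU xy /=; apply/exists_inP; by exists v.
  by apply/imsetP; exists v; rewrite ?cy // inE vU.
apply: leq_trans (subset_leq_card sub) _.
apply: leq_trans (card_bigcup_le _ _) _.
have xell : #|color_nbrs e.1 e.2| <= ell by move: eP; rewrite inE => /andP[].
apply: leq_trans (leq_mul xell (leqnn _)); rewrite -sum_nat_const.
apply: leq_sum => x; rewrite inE => /andP[xU _]; rewrite inE in xU.
apply: leq_trans (card_bigcup_le _ _) _.
apply: leq_trans (leq_mul (star xU) (leqnn _)); rewrite -sum_nat_const.
apply: leq_sum => y; rewrite inE => /andP[yU _]; rewrite inE in yU.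
by apply: leq_trans (leq_imset_card _ _) _; apply: link.
Qed.

(** The recoloured vertices must be independent. Two that owe the new colour to the same [u] had
    equal old colours, so they are not adjacent; two with different [u] are kept apart by the
    transversal. *)
Lemma recolor_closed : colorable G t.+1.
Proof.
have [||f [fL fC]] := @transversal_exists V 'I_t palette recolor_conflict
  (t %/ h - d %/ ell.+1) (ell * (b * r)) card_palette size0 recolor_conflictC
  _ _ recolor_conflict_deg size.
- by move=> e f /andP[].
- by move=> e f /and5P[].
pose rec x := [exists u in U, x \in color_nbrs u (f u)].
pose wd := @widen_ord t t.+1 (leqnSn t).
pose col x : 'I_t.+1 := if x \in U then wd (f x) else if rec x then ord_max else wd (c x).
have wd_neq i j : (wd i != wd j) = (i != j) by rewrite -val_eqE /= val_eqE.
have wd_max i : wd i != ord_max by rewrite -val_eqE /= neq_ltn ltn_ord.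
have colU x y : x \in U -> y \notin U -> adj G x y -> col x != col y.
  move=> xU yU xy; rewrite /col xU (negPf yU); case: ifPn => [_|nr]; first exact: wd_max.
  rewrite wd_neq; apply: contra nr => /eqP e; apply/exists_inP; exists x => //.
  by rewrite !inE yU xy e eqxx.
apply: colorableP; exists col => x y xy.
have [xU|xU] := boolP (x \in U); have [yU|yU] := boolP (y \in U).
- rewrite /col xU yU wd_neq; apply: contraTneq (phi_proper xU yU xy) => fxy.
  have := fL x; rewrite inE => /andP[/eqP hx _].
  have := fL y; rewrite inE => /andP[/eqP hy _].
  by rewrite negbK -val_eqE /= -hx -hy fxy.
- exact: colU.
- by rewrite eq_sym; apply: colU; rewrite // adjC.
rewrite /col (negPf xU) (negPf yU).
case: ifPn => rx; case: ifPn => ry.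
- have /exists_inP[u uU xu] := rx; have /exists_inP[v vU yv] := ry.
  have [uv|uv] := eqVneq u v.
    move: xu yv; rewrite uv !inE => /and3P[_ _ /eqP cx] /and3P[_ _ /eqP cy].
    by have := c_proper xU yU xy; rewrite cx cy eqxx.
  have := fC u v; rewrite /recolor_conflict /= uv uU vU !fL /=.
  by move=> /negP[]; apply/exists_inP; exists x => //; apply/exists_inP; exists y.
- by rewrite eq_sym wd_max.
- exact: wd_max.
- by rewrite wd_neq; apply: c_proper.
Qed.

End ClosedColoring.

(** * From pairings to regular graphs *)

Lemma pairings_exist (T : finType) : ~~ odd #|T| -> exists P, P \in pairings T.
Proof.
move=> evT.
have flip_lt i : i < #|T| -> (if odd i then i.-1 else i.+1) < #|T|.
  move=> iT; case: ifPn => oi; first by apply: leq_ltn_trans iT; apply: leq_pred.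
  rewrite ltn_neqAle iT andbT; apply: contraNneq evT => <- /=; by rewrite oi.
pose flip (i : 'I_#|T|) := Ordinal (flip_lt i (ltn_ord i)).
have flipK : involutive flip.
  move=> [[|i] lti]; apply: val_inj => //=.
  by case oi: (odd i); rewrite /= oi.
have flip_neq i : flip i != i.
  rewrite -val_eqE /=; case: i => [[|i] lti] //=.
  by case: (odd i); rewrite /= ?neq_ltn ?ltnSn ?orbT.
pose g x := enum_val (flip (enum_rank x)).
have gK : involutive g by move=> x; rewrite /g enum_valK flipK enum_rankK.
exists (perm (inv_inj gK)); rewrite pairingsE; apply/forallP => x.
rewrite !permE gK eqxx /=; apply: contra (flip_neq (enum_rank x)) => /eqP e.
by rewrite -(inj_eq enum_val_inj) enum_rankK; apply/eqP.
Qed.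

Local Open Scope ring_scope.

Section Removal.
Variables (R : realType) (n d : nat).
Local Notation point := ('I_n * 'I_d)%type.
Local Notation gs := (regular_graphs n d).
Local Notation sp := (simple_pairings n d).

Definition removable (t x : nat) (G : sgraph 'I_n) : bool :=
  [exists U : {set 'I_n}, (#|U| < x)%N && [exists c : {ffun 'I_n -> 'I_t},
    [forall v, forall v', (v \notin U) ==> (v' \notin U) ==> adj G v v' ==>
       (c v != c v')]]].

Lemma removableP t x G : removable t x G ->
  exists (U : {set 'I_n}) (c : {ffun 'I_n -> 'I_t}), (#|U| < x)%N /\ proper_outside G U c.
Proof.
move=> /existsP[U /andP[Ux /existsP[c /forallP h]]]; exists U, c; split => //.
by move=> v v' vU v'U vv'; have /forallP/(_ v') := h v; rewrite vU v'U vv'.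
Qed.

Definition independent (G : sgraph 'I_n) (S : {set 'I_n}) : bool :=
  [forall v in S, forall v' in S, ~~ adj G v v'].

Lemma independent_crossing P S : P \in sp -> independent (pairing_graph P) S ->
  P \in crossing (over d S).
Proof.
move=> PS /forall_inP h; rewrite inE; apply/forall_inP => p; rewrite !inE => pS.
apply/negP => qS; have /forall_inP/(_ _ qS)/negP := h _ pS; apply.
rewrite adj_pairing //; apply/existsP; exists p.2.
by rewrite -surjective_pairing.
Qed.

Definition wide (b : nat) (G : sgraph 'I_n) : bool :=
  [exists S : {set 'I_n}, (#|S| == b.+1) && independent G S].

Lemma color_class_le b G t (c : 'I_n -> 'I_t) i : ~~ wide b G ->
  (forall x y, adj G x y -> c x != c y) -> (#|[set v | c v == i]| <= b)%N.
Proof.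
move=> nw cP; rewrite leqNgt; apply: contra nw => /subset_of_card[S Sc Sb].
apply/existsP; exists S; rewrite Sb eqxx /=.
apply/forall_inP => v /(subsetP Sc); rewrite inE => /eqP vi.
apply/forall_inP => v' /(subsetP Sc); rewrite inE => /eqP v'i.
by apply/negP => /cP; rewrite vi v'i eqxx.
Qed.

Lemma colorableE (V : finType) (G : sgraph V) k : colorable G k ->
  exists c : {ffun V -> 'I_k}, forall x y, adj G x y -> c x != c y.
Proof.
move=> /existsP[c /forallP h]; exists c => x y xy.
by have /forallP/(_ y) := h x; rewrite xy.
Qed.

Lemma graphs_le (Q : pred (sgraph 'I_n)) (c : R) :
  #|[set P in sp | Q (pairing_graph P)]|%:R <= c * #|sp|%:R <->
  #|[set G in gs | Q G]|%:R <= c * #|gs|%:R.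
Proof.
rewrite card_graphs_pairings card_regular_pairings !natrM mulrA ler_pM2r //.
by rewrite ltr0n expn_gt0 fact_gt0.
Qed.

Lemma graphs_ge (Q : pred (sgraph 'I_n)) (c : R) :
  c * #|sp|%:R <= #|[set P in sp | Q (pairing_graph P)]|%:R <->
  c * #|gs|%:R <= #|[set G in gs | Q G]|%:R.
Proof.
rewrite card_graphs_pairings card_regular_pairings !natrM mulrA ler_pM2r //.
by rewrite ltr0n expn_gt0 fact_gt0.
Qed.

Hypothesis n_gt0 : (0 < n)%N.
Hypothesis d_gt0 : (0 < d)%N.
Hypothesis dn : (320 * d ^ 2 <= n)%N.
Local Notation p0 := (expR (- (24 * d%:R ^+ 2)) : R).

(** Union bound over all pairings; passing to the simple ones costs the factor [1 / p0]. *)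
Lemma wide_le b (eta : R) :
  'C(n, b.+1)%:R * cross_ratio R (n * d) (b.+1 * d) <= eta * p0 ->
  #|[set G in gs | wide b G]|%:R <= eta * #|gs|%:R.
Proof.
move=> h; apply/graphs_le.
pose F := [set S : {set 'I_n} | #|S| == b.+1].
have hF : {in F, forall S : {set 'I_n},
    cross_ratio R (n * d) (#|S| * d) <= cross_ratio R (n * d) (b.+1 * d)}.
  by move=> S; rewrite inE => /eqP ->.
have := indep_count hF; rewrite card_draws card_ord => h1.
apply: (@le_trans _ _ #|[set P in pairings point | [exists S in F, P \in crossing (over d S)]]|%:R).
  rewrite ler_nat; apply/subset_leq_card/subsetP => P.
  rewrite in_set => /andP[PS /existsP[S /andP[Sb Si]]].
  have /simple_pairingsP[PP _ _] := PS.
  rewrite in_set PP; apply/exists_inP; exists S; first by rewrite inE.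
  exact: independent_crossing.
apply: le_trans h1 _; apply: (@le_trans _ _ (eta * p0 * #|pairings point|%:R)).
  by rewrite ler_wpM2r ?ler0n.
have eta0 : 0 <= eta.
  have : 0 <= eta * p0.
    by apply: le_trans h; rewrite mulr_ge0 ?ler0n ?cross_ratio_ge0.
  by rewrite pmulr_lge0 // expR_gt0.
by rewrite -mulrA ler_wpM2l // card_simple_pairings.
Qed.

Lemma card_sp_gt0 : ~~ odd (n * d) -> (0 < #|sp|)%N.
Proof.
move=> ev; rewrite -(ltr0n R).
apply: (lt_le_trans _ (card_simple_pairings R n_gt0 d_gt0 dn)).
rewrite mulr_gt0 ?expR_gt0 // ltr0n card_gt0; apply/set0Pn.
by apply: pairings_exist; rewrite card_prod !card_ord.
Qed.

(** Among simple pairings a fraction [2 eta] is colourable and at most [eta] wide, so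
    [|A| >= eta |sp|]. [deletion_tail] bounds [|A| |B|] by the square of [eta p0 |pairings|]; [|A|]
    is at least one of these factors, so [|B|] is at most the other. The square is the source of
    [2 ln eta - 48 d ^ 2]. *)
Lemma removable_whp (t b m x : nat) (eta l : R) : (n * d = m.*2)%N -> (0 < m)%N ->
  0 < eta -> 0 <= l <= 1 / 4 ->
  2 * (l ^+ 2 * (16 * (b * d)%:R * (1 + ln m%:R))) - l * x%:R <=
     2 * ln eta - 48 * d%:R ^+ 2 ->
  #|[set G in gs | wide b G]|%:R <= eta * #|gs|%:R ->
  2 * eta * #|gs|%:R <= #|[set G in gs | colorable G t.+1]|%:R ->
  #|[set G in gs | ~~ removable t.+1 x G]|%:R <= eta * #|gs|%:R.
Proof.
move=> nd m0 eta0 l4 hl /graphs_le hw /graphs_ge hc; apply/graphs_le.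
have spge := card_simple_pairings R n_gt0 d_gt0 dn.
have ev : ~~ odd (n * d) by rewrite nd odd_double.
have sp0 : 0 < #|sp|%:R :> R by rewrite ltr0n card_sp_gt0.
pose A := [set P in pairings point |
  [exists col, good_coloring (t := t) b P (@finset.set0 'I_n) col]].
have Age : eta * #|sp|%:R <= #|A|%:R.
  have sub : [set P in sp | colorable (pairing_graph P) t.+1] \subset
      A :|: [set P in sp | wide b (pairing_graph P)].
    apply/subsetP => P; rewrite in_set => /andP[PS /colorableE[c cP]].
    rewrite in_setU [X in _ || X]in_set PS /=.
    have [//|nw] := boolP (wide b _); first by rewrite orbT.
    have /simple_pairingsP[PP _ _] := PS.
    rewrite orbF in_set PP; apply/existsP; exists c; apply/andP; split.
      apply/forallP => a; rewrite !inE /=; apply: cP.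
      rewrite adj_pairing //; apply/existsP; exists a.2.
      by rewrite -surjective_pairing.
    apply/forallP => i; have := color_class_le i nw cP; apply: leq_trans.
    by apply/subset_leq_card/subsetP => v; rewrite !inE.
  have := subset_leq_card sub; rewrite -(ler_nat R).
  have : #|A :|: [set P in sp | wide b (pairing_graph P)]|%:R <=
      #|A|%:R + #|[set P in sp | wide b (pairing_graph P)]|%:R :> R.
    by rewrite -natrD ler_nat leq_card_setU.
  move: hw hc; rewrite -mulrA.
  move: (#|[set P in sp | wide b (pairing_graph P)]|%:R) (#|sp|%:R) (#|A|%:R)
    (#|A :|: _|%:R) (#|[set P in sp | colorable _ _]|%:R) (eta) => z1 z2 z3 z4 z5 z6.
  lra.
pose B := [set P in pairings point | x%:R <= #|deletion_set t b P|%:R :> R].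
have BA : #|B|%:R * #|A|%:R <= (eta * p0 * #|pairings point|%:R) ^+ 2 :> R.
  apply: le_trans (deletion_tail t b x%:R m0 nd l4) _.
  rewrite [leRHS]exprMn mulrC ler_wpM2r ?exprn_ge0 //.
  apply: (@le_trans _ _ (expR (2 * ln eta - 48 * d%:R ^+ 2))); first by rewrite ler_expR.
  have -> : 2 * ln eta - 48 * d%:R ^+ 2 =
     (ln eta - 24 * d%:R ^+ 2) + (ln eta - 24 * d%:R ^+ 2) by ring.
  by rewrite [leLHS]expRD -expr2 expRD lnK.
have Bsp : #|B|%:R <= eta * #|sp|%:R.
  have s0 : 0 < eta * p0 * #|pairings point|%:R.
    have := pairings_exist (T := [the finType of point]); rewrite card_prod !card_ord.
    move=> /(_ ev)[P PP]; rewrite !mulr_gt0 ?expR_gt0 // ltr0n card_gt0.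
    by apply/set0Pn; exists P.
  have s1 : eta * p0 * #|pairings point|%:R <= eta * #|sp|%:R.
    by rewrite -mulrA ler_wpM2l // ltW.
  apply: le_trans s1; rewrite -(ler_pM2r s0) -expr2; apply: le_trans BA.
  rewrite ler_wpM2l ?ler0n //; apply: le_trans Age.
  by rewrite -mulrA ler_wpM2l // ltW.
apply: le_trans Bsp; rewrite ler_nat; apply/subset_leq_card/subsetP => P.
rewrite in_set => /andP[PS nr]; have /simple_pairingsP[PP _ _] := PS.
rewrite in_set PP ler_nat leqNgt; apply: contra nr => dx.
have [col /andP[/forallP h _] _] := deletion_setP t b P.
apply/existsP; exists (deletion_set t b P); rewrite dx /=.
apply/existsP; exists col; apply/forallP => v; apply/forallP => v'.
apply/implyP => vU; apply/implyP => v'U; rewrite adj_pairing //.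
apply/implyP => /existsP[j /eqP e]; have := h (v, j); rewrite /= e vU v'U //.
Qed.

End Removal.

Local Close Scope ring_scope.

(** * Degrees up to a small power of n *)

Local Open Scope ring_scope.

Lemma scale_pow_le (R : realDomainType) (C w : R) (a b : nat) : 1 <= w -> C <= w ->
  (a < b)%N -> C * w ^+ a <= w ^+ b.
Proof.
move=> w1 Cw ab; have w0 : 0 <= w by apply: le_trans w1.
apply: (@le_trans _ _ (w ^+ a.+1)); first by rewrite exprS ler_wpM2r ?exprn_ge0.
exact: ler_weXn2l.
Qed.

Section EdgeProb.
Variables (R : realType) (n d : nat).
Hypothesis n_gt0 : (0 < n)%N.
Hypothesis d_gt0 : (0 < d)%N.
Hypothesis dn : (320 * d ^ 2 <= n)%N.
Local Notation gs := (regular_graphs n d).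

Lemma regular_edge_prob (E : {set {set 'I_n}}) :
  {in E, forall e : {set 'I_n}, #|e| = 2%N} -> (#|E| <= (n * d) %/ 4)%N ->
  #|[set G in gs | E \subset edges G]|%:R <=
  (4 * d%:R / n%:R) ^+ #|E| * #|gs|%:R :> R.
Proof.
move=> E2 EM; apply/graphs_le.
have EN : (4 * #|E| <= n * d)%N by rewrite mulnC -leq_divRL.
have := edges_in_simple R n_gt0 d_gt0 dn E2 EN; apply: le_trans.
rewrite ler_nat; apply/subset_leq_card/subsetP => P.
by rewrite in_set => /andP[PS]; rewrite edges_pairing // in_set PS.
Qed.

(** One side has at least half the vertices and is independent. There are at most [4 ^ uphalf n]
    candidates, each of probability at most a constant times [(5 / 9) ^ (3 uphalf n)]. *)
Lemma bipartite_le (eta : R) : (3 <= d)%N ->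
  (9 / 5) ^+ 4 * (500 / 729) ^+ (uphalf n) <= eta * expR (- (24 * d%:R ^+ 2)) ->
  #|[set G in gs | colorable G 2]|%:R <= eta * #|gs|%:R.
Proof.
move=> d3 h; apply/graphs_le.
pose F := [set S : {set 'I_n} | (uphalf n <= #|S|)%N].
pose c : R := (9 / 5) ^+ 4 * (125 / 729) ^+ uphalf n.
have hn : (n <= 2 * uphalf n)%N by rewrite uphalf_half mulnDr mul2n -[X in (X <= _)%N]odd_double_half -mul2n; case: odd.
have hF : {in F, forall S : {set 'I_n}, cross_ratio R (n * d) (#|S| * d) <= c}.
  move=> S; rewrite inE => hS.
  have le2 : (n * d <= 2 * (#|S| * d))%N.
    by rewrite mulnA leq_mul2r (leq_trans hn) ?orbT // leq_mul2l.
  apply: le_trans (cross_ratio_half R le2) _.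
  rewrite ler_wpM2l ?exprn_ge0 ?divr_ge0 //.
  have -> : 125 / 729 = (5 / 9) ^+ 3 :> R by field.
  rewrite -exprM; apply: ler_wiXn2l; rewrite ?divr_ge0 //; first by lra.
  by rewrite mulnC leq_mul.
have cF : #|F|%:R <= 4 ^+ uphalf n :> R.
  have : (#|F| <= 2 ^ n)%N.
    have -> : (2 ^ n = #|powerset [set: 'I_n]|)%N by rewrite card_powerset cardsT card_ord.
    rewrite subset_leq_card //.
    by apply/subsetP => S _; rewrite inE subsetT.
  rewrite -(ler_nat R) natrX => /le_trans; apply.
  have -> : 4 = 2 ^+ 2 :> R by ring.
  by rewrite -exprM; apply: ler_weXn2l => //; rewrite ler1n.
have hX : #|[set P in simple_pairings n d | colorable (pairing_graph P) 2]|%:R <=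
  #|[set P in pairings ('I_n * 'I_d)%type | [exists S in F, P \in crossing (over d S)]]|%:R :> R.
  rewrite ler_nat; apply/subset_leq_card/subsetP => P.
  rewrite in_set => /andP[PS /colorableE[col colP]].
  have /simple_pairingsP[PP _ _] := PS; rewrite in_set PP.
  have ind i : independent (pairing_graph P) [set v | col v == i].
    apply/forall_inP => v; rewrite inE => /eqP vi; apply/forall_inP => v'.
    by rewrite inE => /eqP v'i; apply/negP => /colP; rewrite vi v'i eqxx.
  have tot : (#|[set v | col v == ord0]| + #|[set v | col v == ord_max]| = n)%N.
    rewrite -[RHS]card_ord -cardsT -(cardsID [set v | col v == ord0] setT) setTI.
    congr (_ + _)%N; apply: eq_card => v; rewrite !inE andbT.
    by case: (col v) => [[|[|]]].
  apply/exists_inP; have [i0|i0] := leqP (uphalf n) #|[set v | col v == ord0]|.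
    by exists [set v | col v == ord0]; [rewrite inE | apply: independent_crossing].
  exists [set v | col v == ord_max]; last exact: independent_crossing.
  by rewrite inE; move: tot i0 hn; rewrite uphalf_half; clear; lia.
have := indep_count hF => h1.
apply: le_trans hX _; apply: le_trans h1 _.
have ck : #|F|%:R * c <= eta * expR (- (24 * d%:R ^+ 2)).
  apply: le_trans h; apply: (@le_trans _ _ (4 ^+ uphalf n * c)).
    by rewrite ler_wpM2r // mulr_ge0 ?exprn_ge0 ?divr_ge0.
  rewrite /c mulrCA -exprMn (_ : 4 * (125 / 729) = 500 / 729) //; by field.
apply: (le_trans (ler_wpM2r (ler0n _ _) ck)); rewrite -mulrA ler_wpM2l //.
  have : 0 <= eta * expR (- (24 * d%:R ^+ 2)).
    by apply: le_trans h; rewrite mulr_ge0 ?exprn_ge0 ?divr_ge0.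
  by rewrite pmulr_lge0 // expR_gt0.
exact: card_simple_pairings.
Qed.

End EdgeProb.

(* [w] is about [n ^ (1 / 200)]: logarithms and constants are absorbed by powers
   of [w], which leaves inequalities between monomials in [w] and [d]. *)
Section Regime.
Variables (R : realType) (n d w : nat) (eta : R).
Local Notation gs := (regular_graphs n d).
Local Notation W := (w%:R : R).
Hypothesis d_gt0 : (0 < d)%N.
Hypothesis eta01 : 0 < eta <= 1.
Hypothesis w_big : (1000 <= w)%N.
Hypothesis n_lo : (w ^ 200 <= n)%N.
Hypothesis n_hi : (n <= 2 * w ^ 200)%N.
Hypothesis d_hi : (d <= w ^ 40)%N.
Hypothesis w_eta : 48 - 2 * ln eta <= W.
Hypothesis w_eta' : 2 / W <= eta.
Hypothesis even_nd : ~~ odd (n * d).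

Lemma W_big : 1000 <= W.
Proof. by rewrite ler_nat. Qed.

Lemma W_ge1 : 1 <= W. Proof. by have := W_big; lra. Qed.
Lemma W_gt0 : 0 < W. Proof. by have := W_big; lra. Qed.
Lemma n_loR : W ^+ 200 <= n%:R. Proof. by rewrite -natrX ler_nat. Qed.
Lemma n_hiR : n%:R <= 2 * W ^+ 200. Proof. by rewrite -natrX -natrM ler_nat. Qed.
Lemma d_hiR : d%:R <= W ^+ 40. Proof. by rewrite -natrX ler_nat. Qed.
Lemma d_ge1 : 1 <= d%:R :> R. Proof. by rewrite ler1n. Qed.

Lemma n_gt0 : (0 < n)%N.
Proof. by apply: leq_trans n_lo; rewrite expn_gt0 (leq_trans _ w_big). Qed.

Lemma d2_hi : d%:R ^+ 2 <= W ^+ 80.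
Proof.
by have -> : W ^+ 80 = (W ^+ 40) ^+ 2; [rewrite -exprM | apply: lerXn2r; rewrite ?nnegrE ?ler0n ?exprn_ge0 ?d_hiR].
Qed.

Lemma dn_small : (320 * d ^ 2 <= n)%N.
Proof.
rewrite -(ler_nat R) natrM natrX; apply: le_trans n_loR.
apply: (@le_trans _ _ (320 * W ^+ 80)); first by rewrite ler_pM2l // d2_hi.
by apply: scale_pow_le; rewrite ?W_ge1 //; have := W_big; lra.
Qed.

Lemma ln_m_le m : (n * d = m.*2)%N -> 1 + ln m%:R <= W ^+ 2.
Proof.
move=> nd; have W0 := W_gt0.
have m0 : (0 < m)%N.
  by rewrite -double_gt0 -nd muln_gt0 n_gt0.
have mle : m%:R <= W ^+ 241.
  apply: (@le_trans _ _ (n%:R * d%:R)).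
    by rewrite -natrM nd ler_nat -addnn leq_addr.
  apply: (@le_trans _ _ (2 * W ^+ 200 * W ^+ 40)).
    by apply: ler_pM; rewrite ?ler0n ?n_hiR ?d_hiR.
  rewrite -mulrA -exprD; apply: scale_pow_le; rewrite ?W_ge1 //.
  by have := W_big; lra.
have : ln (m%:R : R) <= ln (W ^+ 241) by rewrite ler_ln ?posrE ?ltr0n ?exprn_gt0.
rewrite lnXn // => h.
have h2 : ln W <= W - 1.
  have := @le_ln1Dx R (W - 1); rewrite (_ : 1 + (W - 1) = W); last by ring.
  apply.
  by have := W_big; lra.
have h3 : ln W *+ 241 <= (W - 1) *+ 241 by rewrite lerMn2r h2 orbT.
rewrite -[leRHS]mulr_natl in h3.
have h4 : 241 * W <= W * W.
  by rewrite ler_pM2r //; have := W_big; lra.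
rewrite expr2; move: (W * W) (ln W *+ 241) h h3 h4 => z1 z2; lra.
Qed.

(* The failure probability must beat the squared probability
   [exp (- 48 d^2)] of being simple. *)
Lemma budget (Z : R) : Z <= d%:R ^+ 2 * W ->
  Z - 2 * d%:R ^+ 2 * W <= 2 * ln eta - 48 * d%:R ^+ 2.
Proof.
move=> hZ; have d2 : 1 <= d%:R ^+ 2 :> R by rewrite exprn_ege1 ?d_ge1.
have l0 : ln eta <= 0 by apply: ln_le0; case/andP: eta01.
have h1 : (48 - 2 * ln eta) * d%:R ^+ 2 <= W * d%:R ^+ 2.
  by rewrite ler_wpM2r // exprn_ge0.
have h2 : ln eta * d%:R ^+ 2 <= ln eta * 1 by rewrite ler_wnM2l.
move: h1 h2 hZ; rewrite !mulrBl.
move: (ln eta) (d%:R ^+ 2) W => z1 z2 z3.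
move=> h1 h2 hZ; nra.
Qed.

Lemma half_even : exists2 m, (0 < m)%N & (n * d = m.*2)%N.
Proof.
exists (n * d)./2; last by rewrite -[LHS]odd_double_half (negPf even_nd).
rewrite half_gt0; apply: leq_trans (leq_pmulr _ d_gt0).
rewrite -(ltr_nat R); apply: lt_le_trans n_loR.
by have := @ler_weXn2l _ W W_ge1 1 200 isT; have := W_big; rewrite expr1; lra.
Qed.

Lemma quarter_le (k : nat) : k%:R <= W ^+ 190 -> (k <= (n * d) %/ 4)%N.
Proof.
move=> hk; rewrite leq_divRL // -(ler_nat R) !natrM mulrC.
apply: (@le_trans _ _ (4 * W ^+ 190)); first by rewrite ler_pM2l.
apply: (@le_trans _ _ (W ^+ 200)).
  by apply: scale_pow_le; rewrite ?W_ge1 //; have := W_big; lra.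
by rewrite -[leLHS]mulr1; apply: ler_pM; rewrite ?exprn_ge0 ?ler0n ?n_loR ?d_ge1.
Qed.

(** Colour classes are left unrestricted ([b = n]), at the price of the larger exceptional set
    [s = w ^ 103 d ^ 2]. The choice [l = 2 / w ^ 102] makes [l s] the [2 d ^ 2 w] of [budget]. *)
Lemma small_regime t : (d <= w ^ 15)%N -> (2 <= t)%N ->
  2 * eta * #|gs|%:R <= #|[set G in gs | colorable G t.+1]|%:R ->
  #|[set G in gs | ~~ colorable G t.+2]|%:R <= 2 * eta * #|gs|%:R.
Proof.
move=> dW t2 hc.
have W0 := W_gt0; have W1 := W_ge1; have Wb := W_big; have n0 := n_gt0.
have nR : 0 < n%:R :> R by rewrite ltr0n.
have dR : 0 < d%:R :> R by rewrite ltr0n.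
have dWR : d%:R <= W ^+ 15 by rewrite -natrX ler_nat.
have dpow k : d%:R ^+ k <= W ^+ (15 * k).
  by rewrite exprM; apply: lerXn2r; rewrite ?nnegrE ?ler0n ?exprn_ge0.
have [m m0 nd] := half_even.
pose s := (w ^ 103 * d ^ 2)%N.
have sR : s%:R = W ^+ 103 * d%:R ^+ 2 :> R by rewrite natrM !natrX.
have sW : s%:R <= W ^+ 133.
  rewrite sR (_ : 133 = 103 + 15 * 2)%N // exprD ler_wpM2l ?exprn_ge0 // dpow //.
pose s0 := (9 * s + 2)%N.
have s0W : s0%:R <= W ^+ 134.
  have h1 : 1 <= W ^+ 133 by apply: exprn_ege1.
  have h2 : 11 * W ^+ 133 <= W ^+ 134 by apply: scale_pow_le => //; lra.
  rewrite natrD natrM; move: (W ^+ 133) (W ^+ 134) sW h1 h2 => z1 z2; lra.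
have rem : #|[set G in gs | ~~ removable t.+1 s G]|%:R <= eta * #|gs|%:R.
  apply: (@removable_whp R n d n0 d_gt0 dn_small t n m s eta (2 / W ^+ 102)) => //.
  - by case/andP: eta01.
  - rewrite divr_ge0 ?exprn_ge0 //= ler_pdivrMr ?exprn_gt0 //.
    have : 8 * W ^+ 0 <= W ^+ 102 by apply: scale_pow_le => //; lra.
    by rewrite expr0; lra.
  - have -> : 2 / W ^+ 102 * s%:R = 2 * d%:R ^+ 2 * W.
      rewrite sR (_ : W ^+ 103 = W * W ^+ 102) ?exprS //.
      by field; rewrite gt_eqF.
    apply: budget; set L := 1 + ln _.
    have -> : 2 * ((2 / W ^+ 102) ^+ 2 * (16 * (n * d)%:R * L)) =
      128 * (n%:R * d%:R * L) / (W ^+ 102) ^+ 2.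
      by rewrite natrM; field; rewrite gt_eqF.
    rewrite ler_pdivrMr ?exprn_gt0 // -exprM.
    have hL : L <= W ^+ 2 := ln_m_le nd.
    have L0 : 0 <= L by rewrite addr_ge0 // ln_ge0 // ler1n.
    have h1 : n%:R * d%:R * L <= 2 * W ^+ 200 * d%:R * W ^+ 2.
      by apply: ler_pM => //; [rewrite mulr_ge0 | rewrite ler_wpM2r // n_hiR].
    apply: (@le_trans _ _ (128 * (2 * W ^+ 200 * d%:R * W ^+ 2))); first by rewrite ler_pM2l.
    have -> : 128 * (2 * W ^+ 200 * d%:R * W ^+ 2) = 256 * W ^+ (200 + 2) * d%:R.
      by rewrite exprD; ring.
    have -> : d%:R ^+ 2 * W * W ^+ (102 * 2) = W ^+ (102 * 2).+1 * d%:R * d%:R.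
      by rewrite exprS; ring.
    apply: (@le_trans _ _ (W ^+ (102 * 2).+1 * d%:R)).
      by rewrite ler_wpM2r ?ler0n //; apply: scale_pow_le => //; lra.
    by rewrite -[leLHS]mulr1 ler_wpM2l ?d_ge1 // mulr_ge0 ?exprn_ge0 // ltW.
  - rewrite (_ : [set G in gs | wide n G] = set0).
      by rewrite cards0 mulr_ge0 ?ler0n //; case/andP: eta01 => /ltW.
    apply/setP => G; rewrite in_set in_set0; apply/negP => /andP[_ /existsP[S]].
    by move=> /andP[/eqP Sn _]; have := max_card (mem S); rewrite Sn card_ord ltnn.
(* The ceiling of [4 z / 3]. *)
pose k (z : nat) := ((4 * z + 2) %/ 3)%N.
have kz z : (4 * z <= 3 * k z <= 4 * z + 2)%N.
  have := leq_divM (4 * z + 2) 3; have := ltn_ceil (4 * z + 2) (isT : (0 < 3)%N).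
  by rewrite /k; move: (_ %/ 3)%N => u; clear; lia.
pose q : R := 4 * d%:R / n%:R.
have q0 : 0 <= q by rewrite divr_ge0 ?mulr_ge0 ?ler0n.
have y2 : 0 <= 1 / W <= 1 / 2.
  by rewrite divr_ge0 ?ler0n //= ler_pdivrMr // ; lra.
have sparse := @sparse_bound R _ gs q _ q0 (regular_edge_prob R n0 d_gt0 dn_small)
  s0 k (1 / W) y2 _ _.
have {}sparse : #|[set G in gs | [exists W0 : {set 'I_n}, [&& (0 < #|W0|)%N,
    (#|W0| <= s0)%N & (k #|W0| <= #|inner_edges G W0|)%N]]]|%:R <= eta * #|gs|%:R.
  apply: le_trans (sparse _ _) _.
  - move=> z /andP[z0 zs]; have := kz z => /andP[kz1 kz2]; apply/andP; split.
      by move: kz1; clear; lia.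
    apply: quarter_le; apply: (@le_trans _ _ (2 * W ^+ 134)).
      apply: (@le_trans _ _ (2 * s0%:R)); last by rewrite ler_pM2l.
      by rewrite -natrM ler_nat; move: kz2 z0 zs; clear; lia.
    by apply: scale_pow_le => //; lra.
  - move=> z /andP[z0 zs]; have := kz z => /andP[kz1 _]; rewrite card_ord.
    have zR : 0 < z%:R :> R by rewrite ltr0n.
    have zW : z%:R <= W ^+ 134 by apply: le_trans s0W; rewrite ler_nat.
    set A := 4 * n%:R / z%:R; set B := 2 * z%:R * q.
    have A0 : 0 <= A by rewrite divr_ge0 ?mulr_ge0 ?ler0n.
    have B0 : 0 <= B by rewrite mulr_ge0 // mulr_ge0 ?ler0n.
    have B1 : B <= 1.
      rewrite /B /q !mulrA ler_pdivrMr // mul1r; apply: le_trans n_loR.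
      apply: (@le_trans _ _ (8 * W ^+ (134 + 15))).
        rewrite exprD -[2 * _ * 4 * _](_ : 8 * (z%:R * d%:R) = _); last by ring.
        by rewrite ler_pM2l // ; apply: ler_pM.
      by apply: scale_pow_le => //; lra.
    (* Three vertices against four edges: up to a constant this is [z d ^ 4 / n]. With
       [z <= w ^ 134] and [d <= w ^ 15] the numerator is at most [w ^ 194]; the constant and the
       wanted [w ^ 3] bring it to 199 of the available 200. *)
    have AB : A ^+ 3 * B ^+ 4 <= (1 / W) ^+ 3.
      have -> : A ^+ 3 * B ^+ 4 = 64 * 4096 * (z%:R * d%:R ^+ 4) / n%:R.
        by rewrite /A /B /q; field; rewrite !gt_eqF.
      rewrite expr_div_n expr1n ler_pdivrMr // [leRHS]mulrAC ler_pdivlMr ?exprn_gt0 // mul1r.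
      apply: le_trans n_loR.
      have h1 : 64 * 4096 <= W ^+ 2.
        by rewrite expr2; have := ler_pM _ _ Wb Wb; lra.
      have h2 : z%:R * d%:R ^+ 4 <= W ^+ 134 * W ^+ (15 * 4).
        by apply: ler_pM; rewrite ?exprn_ge0 ?ler0n.
      have h3 := ler_pM _ _ h1 h2.
      apply: (@le_trans _ _ (W ^+ 2 * (W ^+ 134 * W ^+ (15 * 4)) * W ^+ 3)).
        by rewrite ler_wpM2r ?exprn_ge0 // h3 ?mulr_ge0 ?exprn_ge0.
      by rewrite -!exprD; apply: ler_weXn2l.
    have yW0 : 0 <= 1 / W by case/andP: y2.
    have P1 : 0 <= A ^+ z * B ^+ k z by apply: mulr_ge0; apply: exprn_ge0.
    have P2 : 0 <= A ^+ 3 * B ^+ 4 by apply: mulr_ge0; apply: exprn_ge0.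
    rewrite -(@ler_pXn2r _ 3) ?nnegrE ?P1 ?(exprn_ge0 _ yW0) //.
    rewrite exprMn -!exprM [(z * 3)%N]mulnC [in X in _ <= X]exprM.
    apply: (@le_trans _ _ (A ^+ (3 * z) * B ^+ (4 * z))).
      rewrite ler_wpM2l ?exprn_ge0 //; apply: ler_wiXn2l => //.
      by rewrite [X in (_ <= X)%N]mulnC.
    by rewrite !exprM -exprMn; apply: lerXn2r; rewrite ?nnegrE ?P2 ?(exprn_ge0 _ yW0).
  rewrite ler_wpM2r ?ler0n //; apply: le_trans w_eta'; lra.
have sub : [set G in gs | ~~ colorable G t.+2] \subset
  [set G in gs | ~~ removable t.+1 s G] :|: [set G in gs | [exists W0 : {set 'I_n},
     [&& (0 < #|W0|)%N, (#|W0| <= s0)%N & (k #|W0| <= #|inner_edges G W0|)%N]]].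
  apply/subsetP => G; rewrite in_set => /andP[Gg nc]; rewrite in_setU.
  rewrite [X in X || _]in_set [X in _ || X]in_set Gg /=.
  apply: contraR nc; rewrite negb_or negbK => /andP[/removableP[U [c [Us cP]]] nsp].
  apply: (extension_sparse (U0 := U) (c := c)) => // W1' /andP[w0 ws].
  have := nsp; rewrite negb_exists => /forallP/(_ W1'); rewrite w0 /=.
  have -> : (#|W1'| <= s0)%N.
    by apply: leq_trans ws _; rewrite leq_add2r leq_mul2l /= ltnW.
  rewrite -ltnNge => h; have /andP[_ k2] := kz #|W1'|.
  by move: h k2; move: (k #|W1'|) #|inner_edges G W1'| #|W1'| => x1 x2 x3; clear; lia.
have := subset_leq_card sub; rewrite -(ler_nat R) => /le_trans; apply.
apply: (@le_trans _ _ (#|[set G in gs | ~~ removable t.+1 s G]|%:R +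
   #|[set G in gs | [exists W0 : {set 'I_n},
     [&& (0 < #|W0|)%N, (#|W0| <= s0)%N & (k #|W0| <= #|inner_edges G W0|)%N]]]|%:R)).
  by rewrite -natrD ler_nat leq_card_setU.
by apply: le_trans (lerD rem sparse) _; rewrite -mulrDl; have -> : eta + eta = 2 * eta by ring.
Qed.

End Regime.

Local Close Scope ring_scope.

(** * Larger degrees *)

Local Open Scope ring_scope.

Lemma superset_of_card (T : finType) (A : {set T}) k : (#|A| <= k <= #|T|)%N ->
  exists2 B : {set T}, A \subset B & #|B| = k.
Proof.
move=> /andP[Ak kT]; have [|S SA Sk] := @subset_of_card T (~: A) (k - #|A|).
  by rewrite -(leq_add2l #|A|) cardsC subnKC.
exists (A :|: S); first exact: subsetUl.
rewrite cardsU Sk (_ : A :&: S = set0) ?cards0 ?subn0 ?subnKC //.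
apply/setP => x; rewrite !inE; apply/negP => /andP[xA /(subsetP SA)].
by rewrite inE xA.
Qed.

Section Large.
Variables (R : realType) (n d w : nat) (eta : R).
Local Notation gs := (regular_graphs n d).
Local Notation W := (w%:R : R).
Hypothesis d_gt0 : (0 < d)%N.
Hypothesis eta01 : 0 < eta <= 1.
Hypothesis w_big : (1000 <= w)%N.
Hypothesis n_lo : (w ^ 200 <= n)%N.
Hypothesis n_hi : (n <= 2 * w ^ 200)%N.
Hypothesis d_hi : (d <= w ^ 40)%N.
Hypothesis w_eta : 48 - 2 * ln eta <= W.
Hypothesis w_eta' : 2 / W <= eta.
Hypothesis even_nd : ~~ odd (n * d).
Hypothesis d_lo : (w ^ 15 < d)%N.

(** About [w ^ 3 n / d]: large enough that larger independent sets are unlikely, while [b d], which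
    governs the variance, does not grow with [d]. *)
Let b := (w ^ 203 %/ d)%N.

Lemma class_size_ub : (b * d)%:R <= W ^+ 203.
Proof. by rewrite -natrX ler_nat leq_divM. Qed.

Lemma class_size_lb : W ^+ 203 <= (b.+1 * d)%:R - 1.
Proof.
have : (w ^ 203 < b.+1 * d)%N by apply: ltn_ceil.
by rewrite -(ler_nat R) -natr1 natrX lerBrDr.
Qed.

(** Per vertex of the set, choosing it costs [ln n <= w ^ 2] while the exponent gains
    [(K - 1) / (2 n) >= w ^ 3 / 4]. At least 1 per vertex remains, and [b + 1 >= w ^ 163] vertices
    outweigh [24 d ^ 2 - ln eta]. *)
Lemma wide_large : #|[set G in gs | wide b G]|%:R <= eta * #|gs|%:R.
Proof.
have W0 := W_gt0 R w_big; have W1 := W_ge1 R w_big; have Wb := W_big R w_big.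
have n0 := n_gt0 w_big n_lo; have nlo := n_loR R n_lo; have nhi := n_hiR R n_hi.
have dhi := d_hiR R d_hi; have dn := dn_small R w_big n_lo d_hi.
have nR : 0 < n%:R :> R by rewrite ltr0n.
have dR : 0 < d%:R :> R by rewrite ltr0n.
have Wk j : 0 <= W ^+ j by rewrite exprn_ge0 // ltW.
have eta0 : 0 < eta by case/andP: eta01.
have [m m0 nd] := half_even R d_gt0 w_big n_lo even_nd.
apply: (wide_le n0 d_gt0 dn); set K := (b.+1 * d)%N.
have lnn : ln (n%:R : R) <= W ^+ 2.
  have := ln_m_le R d_gt0 w_big n_lo n_hi d_hi nd.
  have : ln (n%:R : R) <= ln m%:R.
    rewrite ler_ln ?posrE ?ltr0n // ler_nat.
    have d2 : (2 <= d)%N.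
      by apply: leq_ltn_trans d_lo; rewrite expn_gt0 (leq_trans _ w_big).
    have := leq_mul (leqnn n) d2; rewrite nd -muln2 leq_pmul2r //.
  move: (ln _) (ln _) => z1 z2; lra.
have Clt : 'C(n, b.+1)%:R <= expR (b.+1%:R * ln n%:R) :> R.
  rewrite expRM_natl lnK ?posrE // -natrX ler_nat; apply: leq_trans (bin_fact_le _ _).
  by rewrite leq_pmulr // fact_gt0.
have cr := cross_ratio_le_expR R K (leqnn (n * d)).
apply: le_trans (ler_pM _ _ Clt cr) _; rewrite ?ler0n ?cross_ratio_ge0 //.
rewrite -expRD -{1}(lnK eta0) -expRD ler_expR.
have Kb : K%:R * (K%:R - 1) / (2 * (n * d)%:R) = b.+1%:R * ((K%:R - 1) / (2 * n%:R)) :> R.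
  by rewrite /K !natrM; field; rewrite !gt_eqF.
rewrite Kb.
have h1 : W ^+ 3 / 4 <= (K%:R - 1) / (2 * n%:R).
  rewrite ler_pdivlMr ?mulr_gt0 //; apply: le_trans class_size_lb.
  rewrite (_ : W ^+ 203 = W ^+ 3 * W ^+ 200); last by rewrite -exprD.
  have -> : W ^+ 3 / 4 * (2 * n%:R) = W ^+ 3 * (n%:R / 2) by field.
  by rewrite ler_wpM2l // ler_pdivrMr // mulrC.
have h2 : W ^+ 2 + 1 <= W ^+ 3 / 4.
  rewrite [W ^+ 3]exprS; have : 1 <= W ^+ 2 by apply: exprn_ege1.
  have := ler_wpM2r (Wk 2) Wb; move: (W * W ^+ 2) (W ^+ 2) => z1 z2; lra.
have bl : W ^+ 163 <= b.+1%:R.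
  have : W ^+ 163 * W ^+ 40 <= b.+1%:R * W ^+ 40.
    rewrite -exprD; apply: le_trans (_ : b.+1%:R * d%:R <= _).
      by apply: le_trans class_size_lb _; rewrite natrM gerBl.
    by rewrite ler_wpM2l ?ler0n.
  by rewrite ler_pM2r // exprn_gt0.
have h3 : 24 * d%:R ^+ 2 - ln eta <= b.+1%:R.
  apply: le_trans bl.
  have h4 := d2_hi R d_hi.
  have h5 : 24 * W ^+ 80 <= W ^+ 81 by apply: scale_pow_le => //; lra.
  have h6 : 2 * W ^+ 81 <= W ^+ 163 by apply: scale_pow_le => //; lra.
  have h7 : W <= W ^+ 81 by rewrite -[leLHS]expr1; apply: ler_weXn2l.
  move: h4 h5 h6 h7 w_eta; move: (d%:R ^+ 2) (W ^+ 80) (W ^+ 81) (W ^+ 163) (ln eta).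
  move=> z1 z2 z3 z4 z5; lra.
have h4 : b.+1%:R * (ln n%:R - (K%:R - 1) / (2 * n%:R)) <= b.+1%:R * (-1) :> R.
  apply: ler_wpM2l; first exact: ler0n.
  move: h1 h2 lnn; move: (ln _) (W ^+ 2) (W ^+ 3) (_ / _).
  move=> z1 z2 z3 z4; lra.
rewrite mulrBr mulrN1 in h4; apply: (le_trans h4).
by rewrite lerNl opprB.
Qed.

(** [s] bounds the exceptional set and [tgt] its closure. The factor 52 makes [(w ^ 4) ^ (51 s)]
    beat the at most [w ^ (201 s)] starting sets; the [w ^ 8] in [beta] is spent on the palettes in
    [large_regime]. *)
Let s := (w ^ 105 * d)%N.
Let tgt := (52 * s)%N.
Let beta := (d %/ w ^ 8)%N.
Let q : R := 4 * d%:R / n%:R.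

Lemma removable_large t :
  2 * eta * #|gs|%:R <= #|[set G in gs | colorable G t.+1]|%:R ->
  #|[set G in gs | ~~ removable t.+1 s G]|%:R <= eta * #|gs|%:R.
Proof.
have W0 := W_gt0 R w_big; have W1 := W_ge1 R w_big; have Wb := W_big R w_big.
have n0 := n_gt0 w_big n_lo; have nlo := n_loR R n_lo; have nhi := n_hiR R n_hi.
have dhi := d_hiR R d_hi; have dn := dn_small R w_big n_lo d_hi.
have nR : 0 < n%:R :> R by rewrite ltr0n.
have dR : 0 < d%:R :> R by rewrite ltr0n.
have Wk j : 0 <= W ^+ j by rewrite exprn_ge0 // ltW.
have eta0 : 0 < eta by case/andP: eta01.
move=> hc; have [m m0 nd] := half_even R d_gt0 w_big n_lo even_nd.
have sR : s%:R = W ^+ 105 * d%:R :> R by rewrite natrM natrX.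
apply: (@removable_whp R n d n0 d_gt0 dn t b m s eta (2 * d%:R / W ^+ 104)) => //.
- rewrite divr_ge0 ?mulr_ge0 ?exprn_ge0 //= ler_pdivrMr ?exprn_gt0 //.
  have h1 : 8 * W ^+ 40 <= W ^+ 104 by apply: scale_pow_le => //; lra.
  move: h1 dhi; move: (W ^+ 40) (W ^+ 104) => z1 z2; lra.
- have -> : 2 * d%:R / W ^+ 104 * s%:R = 2 * d%:R ^+ 2 * W.
    rewrite sR (_ : W ^+ 105 = W * W ^+ 104) ?exprS //.
    by field; rewrite gt_eqF.
  apply: budget => //; set L := 1 + ln _.
  have -> : 2 * ((2 * d%:R / W ^+ 104) ^+ 2 * (16 * (b * d)%:R * L)) =
    128 * ((b * d)%:R * L) * d%:R ^+ 2 / (W ^+ 104) ^+ 2.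
    by move: (b * d)%N => bd; field; rewrite gt_eqF.
  rewrite ler_pdivrMr ?exprn_gt0 // -exprM.
  have hL : L <= W ^+ 2 := ln_m_le R d_gt0 w_big n_lo n_hi d_hi nd.
  have L0 : 0 <= L by rewrite addr_ge0 // ln_ge0 // ler1n.
  have h1 : (b * d)%:R * L <= W ^+ 203 * W ^+ 2.
    by apply: ler_pM => //; exact: class_size_ub.
  have h2 : 128 * ((b * d)%:R * L) <= W ^+ (104 * 2).
    apply: (@le_trans _ _ (128 * (W ^+ 203 * W ^+ 2))); first by rewrite ler_pM2l.
    by rewrite -exprD; apply: scale_pow_le => //; lra.
  apply: (@le_trans _ _ (W ^+ (104 * 2) * d%:R ^+ 2)).
    by rewrite ler_wpM2r ?exprn_ge0.
  rewrite [leRHS]mulrC; apply: ler_wpM2l => //.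
  by rewrite -[leLHS]mulr1; apply: ler_wpM2l; rewrite ?exprn_ge0.
exact: wide_large.
Qed.

(** Since [2 eta > eta], some colourable graph is not wide; its [t + 1] classes of at most [b]
    vertices cover all [n]. *)
Lemma many_colors t :
  2 * eta * #|gs|%:R <= #|[set G in gs | colorable G t.+1]|%:R ->
  (d <= t.+1 * w ^ 3)%N.
Proof.
have W0 := W_gt0 R w_big; have W1 := W_ge1 R w_big; have Wb := W_big R w_big.
have n0 := n_gt0 w_big n_lo; have nlo := n_loR R n_lo; have nhi := n_hiR R n_hi.
have dhi := d_hiR R d_hi; have dn := dn_small R w_big n_lo d_hi.
have nR : 0 < n%:R :> R by rewrite ltr0n.
have dR : 0 < d%:R :> R by rewrite ltr0n.
have Wk j : 0 <= W ^+ j by rewrite exprn_ge0 // ltW.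
have eta0 : 0 < eta by case/andP: eta01.
move=> hc.
have gs0 : 0 < #|gs|%:R :> R.
  have := card_sp_gt0 R n0 d_gt0 dn even_nd; rewrite card_regular_pairings muln_gt0.
  by rewrite ltr0n => /andP[].
have : ([set G in gs | colorable G t.+1] :\: [set G in gs | wide b G]) != set0.
  apply: contraTneq hc => /eqP; rewrite setD_eq0 => /subset_leq_card.
  rewrite -ltNge -(ler_nat R) => /le_lt_trans; apply.
  apply: le_lt_trans wide_large _; rewrite ltr_pM2r //; lra.
case/set0Pn => G; rewrite in_setD in_set [X in _ && X]in_set.
case/andP=> nw /andP[Gg /colorableE[c cP]].
have {}nw : ~~ wide b G by apply: contra nw => ->; rewrite Gg.
have nb : (n <= t.+1 * b)%N.
  rewrite -[X in (X <= _)%N]card_ord -cardsT -sum1_card (partition_big c predT) //=.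
  apply: (@leq_trans (\sum_(i < t.+1) b)); last by rewrite sum_nat_const card_ord.
  apply: leq_sum => i _.
  apply: leq_trans (color_class_le i nw cP); rewrite sum1dep_card.
  by apply: subset_leq_card; apply/subsetP => v; rewrite !inE.
have w200 : (0 < w ^ 200)%N by rewrite expn_gt0 (leq_trans _ w_big).
rewrite -(leq_pmul2l w200); apply: leq_trans (leq_mul n_lo (leqnn d)) _.
apply: leq_trans (leq_mul nb (leqnn d)) _.
rewrite -mulnA [(w ^ 200 * _)%N]mulnCA -expnD leq_mul2l /=; exact: leq_divM.
Qed.

Lemma beta_ge : (w ^ 7 <= beta)%N.
Proof.
have w8 : (0 < w ^ 8)%N by rewrite expn_gt0 (leq_trans _ w_big).
by rewrite leq_divRL // -expnD ltnW.
Qed.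

(** Here [d <= w ^ 40], the fifth root of [n], is decisive: [w ^ 105 d ^ 2] is at most [w ^ 185],
    which leaves [w ^ 14] after one power for the constant. *)
Lemma tgt_q : 2 * tgt%:R * q <= 1 / W ^+ 14.
Proof.
have W0 := W_gt0 R w_big; have W1 := W_ge1 R w_big; have Wb := W_big R w_big.
have n0 := n_gt0 w_big n_lo; have nlo := n_loR R n_lo; have nhi := n_hiR R n_hi.
have dhi := d_hiR R d_hi; have dn := dn_small R w_big n_lo d_hi.
have nR : 0 < n%:R :> R by rewrite ltr0n.
have dR : 0 < d%:R :> R by rewrite ltr0n.
have Wk j : 0 <= W ^+ j by rewrite exprn_ge0 // ltW.
have eta0 : 0 < eta by case/andP: eta01.
rewrite /q mulrA ler_pdivrMr // [leRHS]mulrAC ler_pdivlMr ?exprn_gt0 // mul1r.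
apply: le_trans nlo.
have -> : 2 * tgt%:R * (4 * d%:R) = 416 * W ^+ 105 * (d%:R ^+ 2) :> R.
  by rewrite /tgt natrM /s natrM natrX; ring.
have d2 := d2_hi R d_hi.
apply: (@le_trans _ _ (416 * W ^+ 105 * W ^+ 80 * W ^+ 14)).
  by rewrite ler_wpM2r // ler_wpM2l // mulr_ge0.
by rewrite -[416 * _ * _]mulrA -exprD -[416 * _ * _]mulrA -exprD; apply: scale_pow_le => //; lra.
Qed.

Lemma tgt_hi : tgt%:R <= W ^+ 146.
Proof.
have W0 := W_gt0 R w_big; have W1 := W_ge1 R w_big; have Wb := W_big R w_big.
have n0 := n_gt0 w_big n_lo; have nlo := n_loR R n_lo; have nhi := n_hiR R n_hi.
have dhi := d_hiR R d_hi; have dn := dn_small R w_big n_lo d_hi.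
have nR : 0 < n%:R :> R by rewrite ltr0n.
have dR : 0 < d%:R :> R by rewrite ltr0n.
have Wk j : 0 <= W ^+ j by rewrite exprn_ge0 // ltW.
have eta0 : 0 < eta by case/andP: eta01.
rewrite /tgt natrM /s natrM natrX.
apply: (@le_trans _ _ (52 * (W ^+ 105 * W ^+ 40))).
  by rewrite ler_pM2l // ler_wpM2l.
by rewrite -exprD; apply: scale_pow_le => //; lra.
Qed.

(** A link step has 15 edges, each saving [w ^ 14]: the resulting [w ^ 210] beats [n] times small
    powers. In a star step a leaf costs [tgt q * (d / beta) * w ^ 4] up to a constant, at most
    [1 / w] as [d / beta <= 2 w ^ 8], and there are [beta >= w ^ 7] leaves. *)
Lemma grows_large k :
  #|[set G in gs | [exists U : {set 'I_n}, (#|U| == s) && grows 15 beta tgt G k U]]|%:R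
  <= eta * #|gs|%:R.
Proof.
have W0 := W_gt0 R w_big; have W1 := W_ge1 R w_big; have Wb := W_big R w_big.
have n0 := n_gt0 w_big n_lo; have nlo := n_loR R n_lo; have nhi := n_hiR R n_hi.
have dhi := d_hiR R d_hi; have dn := dn_small R w_big n_lo d_hi.
have nR : 0 < n%:R :> R by rewrite ltr0n.
have dR : 0 < d%:R :> R by rewrite ltr0n.
have Wk j : 0 <= W ^+ j by rewrite exprn_ge0 // ltW.
have eta0 : 0 < eta by case/andP: eta01.
have tq : tgt%:R * q <= 1 / (2 * W ^+ 14).
  have := tgt_q; rewrite !ler_pdivlMr ?mulr_gt0 ?exprn_gt0 //; apply: le_trans.
  by rewrite le_eqVlt; apply/orP; left; apply/eqP; ring.
have q0 : 0 <= q by rewrite divr_ge0 ?mulr_ge0 ?ler0n.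
have tq0 : 0 <= tgt%:R * q by rewrite mulr_ge0 ?ler0n.
have w1 : 1 <= W ^+ 4 by apply: exprn_ege1.
have s_gt0 : (0 < s)%N by rewrite muln_gt0 d_gt0 andbT expn_gt0 (leq_trans _ w_big).
have bt : (beta <= tgt)%N.
  apply: (leq_trans (leq_div _ _)); rewrite /tgt /s mulnA leq_pmull //.
  by rewrite muln_gt0 expn_gt0 (leq_trans _ w_big).
have sizeM : (15 * (tgt + beta) <= (n * d) %/ 4)%N.
  apply: (quarter_le d_gt0 w_big n_lo (R := R)).
  apply: (@le_trans _ _ (30 * tgt%:R)).
    by rewrite -natrM ler_nat; move: bt; move: tgt beta => z1 z2; clear; lia.
  apply: (@le_trans _ _ (30 * W ^+ 146)); first by rewrite ler_pM2l // tgt_hi.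
  by apply: scale_pow_le => //; lra.
have small u v : (v <= 4)%N -> 0 <= u -> u * W ^+ 206 <= 1 -> n%:R * u * W ^+ v <= 1 / 2.
  move=> v4 u0 hu.
  apply: (@le_trans _ _ (2 * W ^+ 200 * u * W ^+ 4)).
    by apply: ler_pM; rewrite ?mulr_ge0 ?ler0n // ?ler_wpM2r // ler_weXn2l.
  have -> : 2 * W ^+ 200 * u * W ^+ 4 = 2 * W ^+ (200 + 4) * u by rewrite exprD; ring.
  have h : 4 * W ^+ (200 + 4) <= W ^+ 206 by apply: scale_pow_le => //; lra.
  have := ler_wpM2r u0 h; move: hu.
  by move: (W ^+ (200 + 4)) (W ^+ 206) => z1 z2; lra.
have link_small : n%:R * (tgt%:R * q) ^+ 15 * W ^+ 4 <= 1 / 2.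
  apply: small => //; first exact: exprn_ge0.
  have h : (tgt%:R * q) ^+ 15 <= (1 / W ^+ 14) ^+ 15.
    apply: lerXn2r; rewrite ?nnegrE ?divr_ge0 ?tq0 //.
    apply: le_trans tq _; rewrite ler_wpM2l // lef_pV2 ?posrE ?mulr_gt0 ?exprn_gt0 //.
    by rewrite -[leLHS]mul1r ler_wpM2r // ler1n.
  apply: le_trans (ler_wpM2r (Wk 206) h) _.
  rewrite expr_div_n expr1n -exprM mul1r mulrC ler_pdivrMr ?exprn_gt0 // mul1r.
  exact: ler_weXn2l.
have beta0 : (0 < beta)%N.
  by apply: leq_trans beta_ge; rewrite expn_gt0 (leq_trans _ w_big).
have bR : 0 < beta%:R :> R by rewrite ltr0n.
have t4 : 0 <= tgt%:R * q ^+ 2 * W ^+ 4.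
  by apply: mulr_ge0 => //; apply: mulr_ge0; [exact: ler0n | exact: exprn_ge0].
have nb0 : 0 <= 4 * n%:R / beta%:R :> R by rewrite divr_ge0 ?mulr_ge0 ?ler0n.
have star_small : n%:R * ('C(n, beta)%:R * (tgt%:R * q ^+ 2 * W ^+ 4) ^+ beta) * W ^+ 4
    <= 1 / 2.
  apply: small => //.
    by rewrite mulr_ge0 ?ler0n ?(exprn_ge0 _ t4).
  have base : 4 * n%:R / beta%:R * (tgt%:R * q ^+ 2 * W ^+ 4) <= 1 / W.
    have -> : 4 * n%:R / beta%:R * (tgt%:R * q ^+ 2 * W ^+ 4) =
        tgt%:R * q * (16 * (d%:R / beta%:R) * W ^+ 4).
      by rewrite /q; field; rewrite !gt_eqF.
    have db : d%:R / beta%:R <= 2 * W ^+ 8.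
      rewrite ler_pdivrMr // -mulrA -natrX -!natrM ler_nat.
      have w8 : (0 < w ^ 8)%N by rewrite expn_gt0 (leq_trans _ w_big).
      have := ltn_ceil d w8; rewrite -/beta => h; apply: leq_trans (ltnW h) _.
      by rewrite mulSn [(w ^ 8 * _)%N]mulnC mul2n -addnn leq_add2r leq_pmull.
    apply: (@le_trans _ _ (1 / (2 * W ^+ 14) * (16 * (2 * W ^+ 8) * W ^+ 4))).
      apply: ler_pM => //; first by rewrite !mulr_ge0 ?invr_ge0 ?ler0n.
      by rewrite ler_wpM2r // ler_pM2l.
    rewrite mulrAC mul1r ler_pdivrMr ?mulr_gt0 ?exprn_gt0 //.
    rewrite [leRHS]mulrC ler_pdivlMr //.
    rewrite mul1r; have -> : 16 * (2 * W ^+ 8) * W ^+ 4 * W = 32 * W ^+ 13.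
      have -> : W ^+ 13 = W ^+ 8 * W ^+ 4 * W by rewrite -exprD -exprSr.
      by ring.
    have h13 : 32 * W ^+ 13 <= W ^+ 14 by apply: scale_pow_le => //; lra.
    by move: h13 (Wk 14); move: (W ^+ 13) (W ^+ 14) => z1 z2; lra.
  have base0 : 0 <= 4 * n%:R / beta%:R * (tgt%:R * q ^+ 2 * W ^+ 4).
    exact: mulr_ge0.
  have W10 : 0 <= 1 / W by rewrite divr_ge0 // ltW.
  have h : 'C(n, beta)%:R * (tgt%:R * q ^+ 2 * W ^+ 4) ^+ beta <= (1 / W) ^+ 206.
    apply: (@le_trans _ _ ((4 * n%:R / beta%:R) ^+ beta * (tgt%:R * q ^+ 2 * W ^+ 4) ^+ beta)).
      apply: ler_wpM2r; last exact: bin_le_exp.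
      exact: exprn_ge0.
    rewrite -exprMn; apply: (@le_trans _ _ ((1 / W) ^+ beta)).
      by apply: lerXn2r; rewrite ?nnegrE.
    apply: ler_wiXn2l => //; first by rewrite ler_pdivrMr // mul1r.
    apply: leq_trans beta_ge; apply: (@leq_trans w).
      by apply: leq_trans w_big.
    by rewrite -[X in (X <= _)%N]expn1 leq_pexp2l // (leq_trans _ w_big).
  apply: le_trans (ler_wpM2r (Wk 206) h) _.
  by rewrite -exprMn mul1r mulVf ?gt_eqF // expr1n.
have edge := @regular_edge_prob R n d n0 d_gt0 dn.
have := @grows_start_le 'I_n 15 beta tgt R gs q (W ^+ 4) _ q0 edge isT w1 sizeM.
rewrite card_ord => /(_ link_small star_small s k).
have -> : (s <= tgt)%N by rewrite leq_pmull.
have -> : (tgt - s = 51 * s)%N by rewrite /tgt; move: s => z; clear; lia.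
move=> /(_ isT); rewrite -exprM; set cnt := #|_|%:R => hg.
have h1 : n%:R ^+ s <= W ^+ (201 * s).
  rewrite exprM; apply: lerXn2r; rewrite ?nnegrE ?ler0n //.
  by apply: le_trans nhi _; apply: scale_pow_le => //; lra.
have h2 : cnt * W <= #|gs|%:R.
  have c0 : 0 <= cnt by rewrite ler0n.
  rewrite -(ler_pM2r (exprn_gt0 (201 * s) W0)) [leRHS]mulrC.
  apply: (@le_trans _ _ (n%:R ^+ s * #|gs|%:R)); last by rewrite ler_wpM2r ?ler0n.
  apply: le_trans hg; rewrite -mulrA ler_wpM2l // -exprS ler_weXn2l //.
  by move: s_gt0; move: s => z; clear; lia.
have h3 : 1 <= eta * W.
  have := w_eta'; rewrite ler_pdivrMr //; move: (eta * W) => z; lra.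
rewrite -(ler_pM2r W0); apply: le_trans h2 _.
by rewrite mulrAC -[leLHS]mul1r ler_wpM2r ?ler0n.
Qed.

(** Per vertex, fifteen edges save [w ^ 210] against a choice factor of [w ^ 201]. *)
Lemma sparse_large :
  #|[set G in gs | [exists A : {set 'I_n}, [&& (0 < #|A|)%N, (#|A| <= tgt)%N &
     (15 * #|A| <= #|inner_edges G A|)%N]]]|%:R <= eta * #|gs|%:R.
Proof.
have W0 := W_gt0 R w_big; have W1 := W_ge1 R w_big; have Wb := W_big R w_big.
have n0 := n_gt0 w_big n_lo; have nlo := n_loR R n_lo; have nhi := n_hiR R n_hi.
have dhi := d_hiR R d_hi; have dn := dn_small R w_big n_lo d_hi.
have nR : 0 < n%:R :> R by rewrite ltr0n.
have dR : 0 < d%:R :> R by rewrite ltr0n.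
have Wk j : 0 <= W ^+ j by rewrite exprn_ge0 // ltW.
have eta0 : 0 < eta by case/andP: eta01.
have q0 : 0 <= q by rewrite divr_ge0 ?mulr_ge0 ?ler0n.
have edge := @regular_edge_prob R n d n0 d_gt0 dn.
have y2 : 0 <= 1 / W <= 1 / 2.
  by rewrite divr_ge0 ?ler0n //= ler_pdivrMr //; lra.
have yW0 : 0 <= 1 / W by case/andP: y2.
have := @sparse_bound R _ gs q _ q0 edge tgt (fun z => 15 * z)%N (1 / W) y2 _ _.
move=> h; apply: le_trans (h _ _) _.
- move=> z /andP[z0 zt]; apply/andP; split; first by rewrite leq_pmull.
  apply: (quarter_le d_gt0 w_big n_lo (R := R)); rewrite natrM.
  apply: (@le_trans _ _ (15 * W ^+ 146)).
    by rewrite ler_pM2l //; apply: le_trans tgt_hi; rewrite ler_nat.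
  by apply: scale_pow_le => //; lra.
- move=> z /andP[z0 zt]; rewrite card_ord exprM -exprMn.
  have zR : 0 < z%:R :> R by rewrite ltr0n.
  have zq0 : 0 <= 2 * z%:R * q by rewrite mulr_ge0 // mulr_ge0 ?ler0n.
  apply: lerXn2r; rewrite ?nnegrE ?yW0 //.
    by rewrite mulr_ge0 ?exprn_ge0 // divr_ge0 ?mulr_ge0 ?ler0n.
  have hq : (2 * z%:R * q) ^+ 15 <= (1 / W ^+ 14) ^+ 15.
    apply: lerXn2r; rewrite ?nnegrE ?divr_ge0 //.
    apply: le_trans tgt_q; rewrite ler_wpM2r // ler_pM2l // ler_nat //.
  have hn : 4 * n%:R / z%:R <= W ^+ 201.
    rewrite ler_pdivrMr //; apply: (@le_trans _ _ (W ^+ 201 * 1)).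
      rewrite mulr1; apply: (@le_trans _ _ (4 * (2 * W ^+ 200))); first by rewrite ler_pM2l.
      have : 8 * W ^+ 200 <= W ^+ 201 by apply: scale_pow_le => //; lra.
      by move: (W ^+ 200) (W ^+ 201) => z1 z2; lra.
    by rewrite ler_wpM2l // ler1n.
  apply: le_trans (ler_pM _ _ hn hq) _; rewrite ?exprn_ge0 //.
    by rewrite divr_ge0 ?mulr_ge0 ?ler0n.
  rewrite expr_div_n expr1n -exprM mulrA mulr1 ler_pdivrMr ?exprn_gt0 //.
  rewrite [leRHS]mulrAC mul1r ler_pdivlMr // -exprSr; exact: ler_weXn2l.
rewrite ler_wpM2r ?ler0n //; apply: le_trans w_eta'; lra.
Qed.

Lemma large_regime t :
  2 * eta * #|gs|%:R <= #|[set G in gs | colorable G t.+1]|%:R ->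
  #|[set G in gs | ~~ colorable G t.+2]|%:R <= 3 * eta * #|gs|%:R.
Proof.
have W0 := W_gt0 R w_big; have W1 := W_ge1 R w_big; have Wb := W_big R w_big.
have n0 := n_gt0 w_big n_lo; have nlo := n_loR R n_lo; have nhi := n_hiR R n_hi.
have dhi := d_hiR R d_hi; have dn := dn_small R w_big n_lo d_hi.
have nR : 0 < n%:R :> R by rewrite ltr0n.
have dR : 0 < d%:R :> R by rewrite ltr0n.
have Wk j : 0 <= W ^+ j by rewrite exprn_ge0 // ltW.
have eta0 : 0 < eta by case/andP: eta01.
move=> hc.
pose Q1 := [set G in gs | ~~ removable t.+1 s G].
pose Q2 := [set G in gs | [exists U : {set 'I_n}, (#|U| == s) && grows 15 beta tgt G tgt U]].
pose Q3 := [set G in gs | [exists A : {set 'I_n}, [&& (0 < #|A|)%N, (#|A| <= tgt)%N &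
     (15 * #|A| <= #|inner_edges G A|)%N]]].
have many := many_colors hc.
have sub : [set G in gs | ~~ colorable G t.+2] \subset Q1 :|: (Q2 :|: Q3).
  apply/subsetP => G; rewrite in_set => /andP[Gg nc]; rewrite !in_setU.
  rewrite [X in X || _]in_set [X in _ || (X || _)]in_set [X in _ || (_ || X)]in_set Gg /=.
  apply: contraR nc; rewrite !negb_or negbK.
  move=> /andP[/removableP[U [c [Us cP]]] /andP[ng nsp]].
  have sn : (s <= n)%N.
    rewrite -(ler_nat R); apply: (@le_trans _ _ tgt%:R); first by rewrite ler_nat leq_pmull.
    apply: le_trans tgt_hi _; apply: le_trans nlo; exact: ler_weXn2l.
  have [|U0 UU0 cU0] := @superset_of_card _ U s.
    by rewrite (ltnW Us) card_ord.
  have {}ng : ~~ grows 15 beta tgt G tgt U0.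
    by move: ng; rewrite negb_exists => /forallP/(_ U0); rewrite cU0 eqxx.
  have [|U1 [U01 U1t link star]] := grows_closed ng; first by rewrite leq_addl.
  (* Fewer than 15 edges per vertex means average degree below 30 in every subset. *)
  have [|phi phiP] := @sparse_coloring _ G 29 U1.
    move=> A AU A0; move: nsp; rewrite negb_exists => /forallP/(_ A).
    rewrite card_gt0 A0 /= (leq_trans (subset_leq_card AU) (ltnW U1t)) /= -ltnNge.
    by move: #|A| #|inner_edges G A| => z1 z2; clear; lia.
  have U1c : proper_outside G U1 c.
    move=> x y xU yU; apply: cP.
      by apply: contra xU => xU; apply: (subsetP U01); apply: (subsetP UU0).
    by apply: contra yU => yU; apply: (subsetP U01); apply: (subsetP UU0).
  (* At least [60 X] colours are at hand: 30 residue classes of [2 X], each losing at most [X]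
     colours at the threshold [ell = 60 w ^ 3]. *)
  pose X := (d %/ (60 * w ^ 3))%N.
  have w3 : (0 < 60 * w ^ 3)%N by rewrite muln_gt0 expn_gt0 (leq_trans _ w_big).
  have X0 : (0 < X)%N.
    rewrite divn_gt0 //; apply: leq_trans (ltnW d_lo).
    rewrite (_ : 15 = 12 + 3)%N // expnD leq_mul2r; apply/orP; right.
    apply: (@leq_trans w); first by apply: leq_trans w_big.
    by rewrite -[X in (X <= _)%N]expn1 leq_pexp2l // (leq_trans _ w_big).
  have TX : (60 * X <= t.+1)%N.
    have w3' : (0 < w ^ 3)%N by rewrite expn_gt0 (leq_trans _ w_big).
    rewrite -(leq_pmul2r w3'); apply: leq_trans many.
    by rewrite mulnAC mulnC leq_divM.
  have T30 : (2 * X <= t.+1 %/ 30)%N.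
    by rewrite leq_divRL // mulnAC; exact: TX.
  have dX : (d %/ (60 * w ^ 3).+1 <= X)%N by apply: leq_div2l.
  have diff : (X <= t.+1 %/ 30 - d %/ (60 * w ^ 3).+1)%N.
    by rewrite leq_subRL; [move: (leq_add dX (leqnn X)) => /leq_trans; apply; rewrite addnn -mul2n | apply: leq_trans dX (leq_trans _ T30); rewrite leq_pmull].
  apply: (@recolor_closed _ G U1 t.+1 c 30 15 beta d (60 * w ^ 3) phi) => //.
  - by move=> x xU; apply: ltnW; apply: link.
  - by move=> x xU; apply: ltnW; apply: star.
  - by move=> x; move: Gg; rewrite in_set => /forallP/(_ x)/eqP ->.
  - apply: leq_trans diff; rewrite leq_divRL //.
    have bd : (beta * w ^ 8 <= d)%N by apply: leq_divM.
    apply: leq_trans bd.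
    (* The transversal needs [16 * ell * beta * 15 <= X], that is, [864000 w ^ 6 beta <= d]; with
       [beta <= d / w ^ 8] this asks for [864000 <= w ^ 2], which [w >= 1000] grants. *)
    have ww : (240 * 60 * 60 <= w * w)%N.
      by apply: leq_trans (leq_mul w_big w_big); clear; lia.
    have -> : (16 * (60 * w ^ 3 * (beta * 15)) * (60 * w ^ 3) =
       beta * (240 * 60 * 60 * (w ^ 3 * w ^ 3)))%N.
      by move: (w ^ 3)%N beta => z1 z2; clear; lia.
    rewrite -expnD leq_mul2l; apply/orP; right.
    have -> : (w ^ 8 = w * w * w ^ (3 + 3))%N by rewrite !expnS expn0 muln1 !mulnA.
    by rewrite leq_mul2r ww orbT.
  - exact: leq_trans X0 diff.
have := subset_leq_card sub; rewrite -(ler_nat R) => /le_trans; apply.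
apply: (@le_trans _ _ (#|Q1|%:R + (#|Q2|%:R + #|Q3|%:R))).
  rewrite -!natrD ler_nat; apply: leq_trans (leq_card_setU _ _) _.
  by rewrite leq_add2l leq_card_setU.
have h1 := removable_large hc; have h2 := grows_large tgt; have h3 := sparse_large.
apply: le_trans (lerD h1 (lerD h2 h3)) _; rewrite le_eqVlt; apply/orP; left.
by apply/eqP; ring.
Qed.

End Large.

Local Close Scope ring_scope.

(** * Two-point concentration *)

Local Open Scope ring_scope.

Lemma colorable_mono (V : finType) (G : sgraph V) k l : (k <= l)%N ->
  colorable G k -> colorable G l.
Proof.
move=> kl /colorableE[c cP]; apply: colorableP; exists (fun x => widen_ord kl (c x)).
by move=> x y /cP; rewrite -!val_eqE.
Qed.

Lemma chromatic_number_pair (V : finType) (G : sgraph V) k :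
  ~~ colorable G k -> colorable G k.+2 -> chromatic_number G \in [:: k.+1; k.+2].
Proof.
move=> nk ck; rewrite /chromatic_number; case: ex_minnP => m cm mmin.
have mk := mmin _ ck.
have km : (k < m)%N by rewrite ltnNge; apply: contra nk => /colorable_mono; apply.
by rewrite !inE; move: mk km; clear; lia.
Qed.

Section TwoPoint.
Variables (R : realType) (n d w : nat) (eta : R).
Local Notation gs := (regular_graphs n d).
Local Notation W := (w%:R : R).
Hypothesis d_gt0 : (0 < d)%N.
Hypothesis eta01 : 0 < eta <= 1 / 2.
Hypothesis w_big : (1000 <= w)%N.
Hypothesis n_lo : (w ^ 200 <= n)%N.
Hypothesis n_hi : (n <= 2 * w ^ 200)%N.
Hypothesis d_hi : (d <= w ^ 40)%N.
Hypothesis w_eta : 48 - 2 * ln eta <= W.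
Hypothesis w_eta' : 2 / W <= eta.
Hypothesis even_nd : ~~ odd (n * d).

(** Ensures the three old colours on which [extension_sparse] relies. *)
Lemma bipartite_rare : (3 <= d)%N ->
  #|[set G in gs | colorable G 2]|%:R <= eta * #|gs|%:R.
Proof.
move=> d3; have eta0 : 0 < eta by case/andP: eta01.
apply: bipartite_le => //; [exact: (n_gt0 w_big n_lo)|exact: (dn_small R w_big n_lo d_hi)|].
have Wb := W_big R w_big; have W1 := W_ge1 R w_big; have nlo := n_loR R n_lo.
have d2 := d2_hi R d_hi.
have hn : n%:R <= 2 * (uphalf n)%:R :> R.
  by rewrite -natrM ler_nat uphalf_half mulnDr mul2n -[X in (X <= _)%N]odd_double_half -mul2n; case: odd.
have e1 : 500 / 729 <= expR (- (1 / 4)) :> R.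
  by apply: le_trans (expR_ge1Dx _); lra.
have e2 : (9 / 5) ^+ 4 <= expR 10 :> R.
  by apply: le_trans (expR_ge1Dx _); rewrite !exprS expr0; lra.
apply: (@le_trans _ _ (expR 10 * expR ((uphalf n)%:R * (- (1 / 4))))).
  apply: ler_pM; rewrite ?exprn_ge0 ?divr_ge0 //.
  by rewrite expRM_natl; apply: lerXn2r; rewrite ?nnegrE ?divr_ge0 ?expR_ge0.
rewrite -expRD -{1}(lnK eta0) -expRD ler_expR.
have h1 : 24 * W ^+ 80 <= W ^+ 81 by apply: scale_pow_le => //; lra.
have h2 : 24 * W ^+ 81 <= W ^+ 200 by apply: scale_pow_le => //; lra.
have h3 : W <= W ^+ 81 by rewrite -[leLHS]expr1; apply: ler_weXn2l.
move: hn h1 h2 h3 d2 nlo w_eta.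
move: (uphalf n)%:R (W ^+ 80) (W ^+ 81) (W ^+ 200) (d%:R ^+ 2) n%:R (ln eta).
by move=> z1 z2 z3 z4 z5 z6 z7; lra.
Qed.

Lemma gs_gt0 : 0 < #|gs|%:R :> R.
Proof.
have := card_sp_gt0 R (n_gt0 w_big n_lo) d_gt0 (dn_small R w_big n_lo d_hi) even_nd.
by rewrite card_regular_pairings muln_gt0 ltr0n => /andP[].
Qed.

Lemma count_window k (a b : R) :
  #|[set G in gs | colorable G k]|%:R <= a * #|gs|%:R ->
  #|[set G in gs | ~~ colorable G k.+2]|%:R <= b * #|gs|%:R ->
  (1 - (a + b)) * #|gs|%:R <=
    #|[set G in gs | chromatic_number G \in [:: k.+1; k.+2]]|%:R.
Proof.
move=> ha hb; set C := [set G in gs | _ \in _].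
have sub : gs \subset [set G in gs | colorable G k] :|:
    ([set G in gs | ~~ colorable G k.+2] :|: C).
  apply/subsetP => G Gg; rewrite !in_setU.
  rewrite [X in X || _]in_set [X in _ || (X || _)]in_set [X in _ || (_ || X)]in_set Gg /=.
  case: (boolP (colorable G k)) => //= nk; case: (boolP (colorable G k.+2)) => //= ck.
  exact: chromatic_number_pair.
have := subset_leq_card sub; rewrite -(ler_nat R) => h1.
have h2 : #|[set G in gs | colorable G k] :|: ([set G in gs | ~~ colorable G k.+2] :|: C)|%:R
   <= #|[set G in gs | colorable G k]|%:R + (#|[set G in gs | ~~ colorable G k.+2]|%:R + #|C|%:R) :> R.
  rewrite -!natrD ler_nat; apply: leq_trans (leq_card_setU _ _) _.
  by rewrite leq_add2l leq_card_setU.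
have h3 := le_trans h1 h2; rewrite mulrBl mul1r mulrDl; lra.
Qed.

(** For [d >= 3] the window starts at the least number of colours that suffices with probability at
    least [2 eta]: one fewer suffices with probability at most [2 eta], one more fails with
    probability at most [3 eta]. For [d <= 2] the window is always 2, 3. *)
Lemma two_point : exists t : nat, (1 - 5 * eta) * #|gs|%:R <=
  #|[set G in gs | chromatic_number G \in [:: t; t.+1]]|%:R.
Proof.
have eta0 : 0 < eta by case/andP: eta01.
have eta1 : 0 < eta <= 1 by case/andP: eta01 => -> h; apply: le_trans h _; lra.
have g0 := gs_gt0; have n0 := n_gt0 w_big n_lo.
have [d2|d3] := leqP d 2.
  exists 2%N; have c1 : #|[set G in gs | colorable G 1]|%:R <= 0 * #|gs|%:R :> R.
    rewrite mul0r lern0 cards_eq0; apply/eqP/setP => G; rewrite in_set in_set0.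
    apply/negP => /andP[]; rewrite in_set => /forallP/(_ (Ordinal n0))/eqP r.
    move=> /colorableE[c cP]; have : (0 < degree G (Ordinal n0))%N by rewrite r.
    rewrite card_gt0 => /set0Pn[y]; rewrite inE => /cP.
    by rewrite (ord1 (c _)) (ord1 (c y)) eqxx.
  have c3 : #|[set G in gs | ~~ colorable G 3]|%:R <= 0 * #|gs|%:R :> R.
    rewrite mul0r lern0 cards_eq0; apply/eqP/setP => G; rewrite in_set in_set0.
    apply/negP => /andP[]; rewrite in_set => /forallP r; apply/negP; rewrite negbK.
    have [|c cP] := @degenerate_coloring _ G 2 setT.
      move=> A _ /set0Pn[x xA]; exists x => //; apply: leq_trans d2.
      have /eqP <- := r x; apply/subset_leq_card/subsetP => y.
      by rewrite !inE => /andP[].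
    by apply: colorableP; exists c => x y xy; apply: cP; rewrite ?inE.
  apply: le_trans (count_window c1 c3); rewrite ler_wpM2r ?ler0n //; lra.
pose P T := 2 * eta * #|gs|%:R <= #|[set G in gs | colorable G T]|%:R :> R.
have exP : exists T, P T.
  exists n; rewrite /P (_ : [set G in gs | colorable G n] = gs).
    rewrite -[leRHS]mul1r ler_wpM2r ?ler0n //; case/andP: eta01; lra.
  apply/setP => G; rewrite [LHS]in_set andb_idr // => _.
  by have := colorable_card G; rewrite card_ord.
case: (ex_minnP exP) => -[|T] PT Tmin.
  have : 0 < 2 * eta * #|gs|%:R by rewrite !mulr_gt0.
  rewrite ltNge; case/negP; apply: le_trans PT _.
  rewrite lern0 cards_eq0; apply/eqP/setP => G; rewrite in_set in_set0.
  by apply/negP => /andP[_ /colorableE[c _]]; case: (c (Ordinal n0)).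
have low : #|[set G in gs | colorable G T]|%:R <= 2 * eta * #|gs|%:R.
  rewrite leNgt; apply/negP => /ltW /Tmin; by rewrite ltnn.
exists T.+1; have high : #|[set G in gs | ~~ colorable G T.+2]|%:R <= 3 * eta * #|gs|%:R.
  have [ds|dl] := leqP d (w ^ 15); last exact: (large_regime d_gt0 eta1 w_big n_lo n_hi d_hi w_eta w_eta' even_nd dl PT).
  have T2 : (2 <= T)%N.
    rewrite leqNgt; apply/negP => T1.
    have h := bipartite_rare d3.
    have h2 : #|[set G in gs | colorable G T.+1]|%:R <=
        #|[set G in gs | colorable G 2]|%:R :> R.
      rewrite ler_nat; apply/subset_leq_card/subsetP => G.
      rewrite in_set => /andP[Gg cG]; rewrite in_set Gg /=.
      by apply: colorable_mono cG.
    have := le_trans PT (le_trans h2 h); rewrite ler_pM2r //; lra.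
  apply: le_trans (small_regime d_gt0 eta1 w_big n_lo n_hi d_hi w_eta w_eta' even_nd ds T2 PT) _.
  rewrite ler_wpM2r ?ler0n //; lra.
by apply: le_trans (count_window low high); rewrite ler_wpM2r ?ler0n //; lra.
Qed.

End TwoPoint.

(** [w] is the integer part of the 200th root of [n]; [(1 + 1 / w) ^ 200 <= exp (1 / 5) <= 2]
    compares it with its successor. *)
Lemma root_window (R : realType) (n w0 : nat) : (1000 <= w0)%N -> (w0 ^ 200 <= n)%N ->
  exists w, [/\ (w0 <= w)%N, (w ^ 200 <= n)%N & (n <= 2 * w ^ 200)%N].
Proof.
move=> w01 w0n; have exw : exists w, (w ^ 200 <= n)%N by exists w0.
have bound w : (w ^ 200 <= n)%N -> (w <= n)%N.
  apply: leq_trans; case: w => [//|w]; rewrite -[leqLHS]expn1.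
  by rewrite leq_pexp2l.
case: (ex_maxnP exw bound) => w wn wmax; exists w; split => //; first exact: wmax.
have w1 : (1000 <= w)%N by apply: leq_trans w01 (wmax _ w0n).
apply: (@leq_trans (w.+1 ^ 200)).
  by rewrite ltnW // ltnNge; apply/negP => /wmax; rewrite ltnn.
have wb := W_big R w1.
have w0R : 0 < w%:R :> R by lra.
rewrite -(ler_nat R) natrM !natrX -natr1.
have e5 : expR (1 / 5) <= 2 :> R.
  have := @expR_ge1Dx R (- (1 / 5)); rewrite expRN => h.
  have e0 : 0 < expR (1 / 5 : R) by apply: expR_gt0.
  by move: h; rewrite -(ler_pM2r e0) mulVf ?gt_eqF //; lra.
have h : (1 + 1 / w%:R) ^+ 200 <= 2 :> R.
  apply: le_trans e5; apply: (@le_trans _ _ (expR (1 / w%:R) ^+ 200)).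
    by apply: lerXn2r; rewrite ?nnegrE ?expR_ge0 ?addr_ge0 ?divr_ge0 ?ler0n // expR_ge1Dx.
  rewrite -expRM_natl ler_expR mulrA mulr1 ler_pdivrMr //; lra.
have -> : w%:R + 1 = (1 + 1 / w%:R) * w%:R :> R by field; rewrite gt_eqF.
by rewrite exprMn ler_wpM2r // exprn_ge0 // ltW.
Qed.

Local Close Scope ring_scope.

Unset Implicit Arguments.
From mathcomp Require Import all_classical all_reals all_analysis.

Import Order.TTheory GRing.Theory Num.Theory.
Import numFieldNormedType.Exports.

Local Open Scope classical_set_scope.
Local Open Scope ring_scope.

(** The factor 2 absorbs the loss in [n <= 2 * w ^ 200] when [d <= w ^ 40] is derived. *)
Lemma degree_fifth_power (R : realType) (d : nat -> nat) :
  (fun n : nat => (d n)%:R : R) =o_\oo (fun n : nat => n%:R `^ (5%:R^-1) : R) ->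
  exists N : nat, forall n : nat, (N <= n)%N -> ((2 * d n) ^ 5 <= n)%N.
Proof.
move=> /eqoP/(_ (1 / 2)) h; have /h[N _ hN] : 0 < 1 / 2 :> R by lra.
exists N => n Nn.
have := hN n Nn; rewrite /= ger0_norm // ger0_norm ?powR_ge0 // => hd.
rewrite -(ler_nat R) natrX natrM.
have -> : n%:R = (n%:R `^ (5%:R^-1)) ^+ 5 :> R.
  by rewrite -powR_mulrn ?powR_ge0 // -powRrM mulVf ?pnatr_eq0 // powRr1.
by apply: lerXn2r; rewrite ?nnegrE ?mulr_ge0 ?powR_ge0 //; lra.
Qed.

Theorem theorem1p2 (R : realType) (d : nat -> nat)
    (d_gt0 : forall n : nat, (0 < d n)%N)
    (d_littleo : (fun n : nat => (d n)%:R : R) =o_\oo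
                 (fun n : nat => n%:R `^ (5%:R^-1) : R))
    (eps : R) (eps_gt0 : 0 < eps) :
  exists n0 : nat, forall n : nat, (n0 < n)%N -> ~~ odd (d n * n) ->
    exists t : nat,
      1 - eps <= prob_regular R (d n)
        (fun G : sgraph 'I_n => chromatic_number G \in [:: t; t.+1]).
Proof.
have [N hN] := degree_fifth_power R d d_littleo.
(* The [5 * eta] lost in [two_point] must fit in [eps], and the cap keeps the threshold [2 * eta] at
   most 1, so that some number of colours reaches it. *)
pose eta := Num.min (eps / 5) (1 / 2).
have eta0 : 0 < eta by rewrite lt_min divr_gt0 //=; lra.
have eta_half : 0 < eta <= 1 / 2 by rewrite eta0 ge_min lexx orbT.
have eta_eps : 5 * eta <= eps.
  have : eta <= eps / 5 by rewrite ge_min lexx.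
  lra.
pose w0 := (1000 + Num.bound `|48 - 2 * ln eta|%R + Num.bound (2 / eta)%R)%N.
have w0_big : (1000 <= w0)%N by rewrite /w0 -addnA leq_addr.
have w0_ln : 48 - 2 * ln eta <= w0%:R.
  apply: le_trans (ler_norm _) _; apply: le_trans (ltW (archi_boundP (normr_ge0 _))) _.
  by rewrite ler_nat /w0 addnAC leq_addl.
have w0_eta : 2 / eta <= w0%:R.
  have /archi_boundP/ltW h : 0 <= 2 / eta by rewrite divr_ge0 // ltW.
  by apply: le_trans h _; rewrite ler_nat /w0 leq_addl.
exists (maxn N (w0 ^ 200)) => n; rewrite gtn_max => /andP[Nn w0n] ev.
have [w [w0w n_lo n_hi]] := @root_window R n w0 w0_big (ltnW w0n).
have w_big := leq_trans w0_big w0w.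
have w0wR : w0%:R <= w%:R :> R by rewrite ler_nat.
have W0 : 0 < w%:R :> R by rewrite ltr0n (leq_trans _ w_big).
have d_hi : (d n <= w ^ 40)%N.
  have h5 : ((d n) ^ 5 <= (w ^ 40) ^ 5)%N.
    rewrite -expnM -(leq_pmul2l (isT : 0 < 2)%N); apply: leq_trans n_hi.
    apply: leq_trans (hN n (ltnW Nn)); rewrite expnMn leq_mul2r.
    by rewrite (_ : 2 <= 2 ^ 5)%N ?orbT.
  by rewrite leq_exp2r in h5.
have w_ln : 48 - 2 * ln eta <= w%:R by apply: le_trans w0wR.
have w_eta : 2 / w%:R <= eta.
  rewrite ler_pdivrMr // mulrC -ler_pdivrMr //; exact: le_trans w0_eta w0wR.
have ev' : ~~ odd (n * d n) by rewrite mulnC.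
have [t ht] := two_point (d_gt0 n) eta_half w_big n_lo n_hi d_hi w_ln w_eta ev'.
have g0 := gs_gt0 R (d_gt0 n) w_big n_lo d_hi ev'.
exists t; rewrite /prob_regular ler_pdivlMr //; apply: le_trans ht.
by rewrite ler_wpM2r ?ler0n // lerD2l lerN2.
Qed.
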